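(* Let $a\in C^0(M,\mathbb{C})$ with $a_\infty := \sup_{\mathrm{x}\in M}|a(\mathrm{x})|$ and let $C:= 4+8a_\infty^2 C_P$. Suppose $f\in L^{2,C}(SM)$. Then there exists $g\in L^2(SM)$, depending linearly on $f$, satisfying $I_a f = I_a g$, of the form $$ g = g_0 + X_\perp g_s + \sum_{k=1}^{\infty} g_k,\qquad g_0 \in L^2(M), \quad g_s \in H_0^1(M),\quad g_k\in H^{\mathrm{sol}}_k, \quad k\ge 1. $$ Moreover, $\|g\|^2 \le 4 \|f\|^2_{C}$.
   Context: $M=\{(x,y)\in\mathbb{R}^2: x^2+y^2\le 1\}$ is the Euclidean unit disc and $SM=M\times\mathbb{S}^1$, with points $(\mathrm{x},\theta)$, the angle $\theta$ representing the direction $v=(\cos\theta,\sin\theta)$. $\partial_+SM$ is the set of inward-pointing boundary directions. It is parameterized by fan-beam coordinates $(\beta,\alpha)$, $\beta\in\mathbb{S}^1$, $\alpha\in[-\pi/2,\pi/2]$: base point $(\cos\beta,\sin\beta)$, direction angle $\theta=\beta+\pi+\alpha$. $L^2(\partial_+SM)$ uses the measure $d\beta\,d\alpha$. Attenuated X-ray transform: for $f$ on $SM$ and $(\mathrm{x},v)\in\partial_+SM$, $$I_af(\mathrm{x},v)=\int_0^{\tau(\mathrm{x},v)} f(\mathrm{x}+tv,v)\exp\Big(\int_0^t a(\mathrm{x}+sv)\,ds\Big)dt,$$ where $\tau(\mathrm{x},v)$ is the exit time from $M$ of the line $t\mapsto \mathrm{x}+tv$. It extends to a bounded operator $L^2(SM)\to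 L^2(\partial_+SM)$. Norms: $\|u\|^2=\int_{SM}|u|^2\,d\mathrm{x}\,d\theta$ and $\|f\|_M^2=\int_M|f|^2\,d\mathrm{x}$. $C_P$ is the Poincaré constant of $M$, i.e. the smallest $C>0$ such that $\|u\|_{L^2(M)}^2\le C\|\nabla u\|^2_{L^2(M)}$ for all $u\in H^1_0(M)$ (equivalently $C_P=\lambda_1^{-1}$ with $\lambda_1$ the smallest eigenvalue of the Dirichlet Laplacian on $M$). Every $u\in L^2(SM)$ decomposes as $u=u_0(\mathrm{x})+\sum_{k\ge1}(u_{k,+}(\mathrm{x})e^{ik\theta}+u_{k,-}(\mathrm{x})e^{-ik\theta})$. For $\kappa\ge1$, $L^{2,\kappa}(SM)=\{f\in L^2(SM): \|f\|_\kappa<\infty\}$ with $$\|f\|_\kappa^2=2\pi\Big(\|f_0\|_M^2+\sum_{k\ge1}\kappa^k(\|f_{k,+}\|_M^2+\|f_{k,-}\|_M^2)\Big).$$ With $\partial=\frac12(\partial_x-i\partial_y)$ and $\overline\partial=\frac12(\partial_x+i\partial_y)$, for $k\ge1$, $$H_k^{\mathrm{sol}}=\{e^{ik\theta}f_{k,+}(\mathrm{x})+e^{-ik\theta}f_{k,-}(\mathrm{x}):\ f_{k,\pm}\in L^2(M),\ \overline\partial f_{k,+}=0,\ \partial f_{k,-}=0\}.$$ $X_\perp=\sin\theta\,\partial_x-\cos\theta\,\partial_y$. *)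

(* Defs.v *)
(* MathComp-Analysis, over an arbitrary [R : realType]; complex numbers are [R[i]]. *)
From HB Require Import structures.
From mathcomp Require Import all_boot all_order all_algebra.
From mathcomp Require Import all_classical all_reals all_analysis.
From mathcomp Require Export complex.

Set Implicit Arguments.
Unset Strict Implicit.
Unset Printing Implicit Defensive.

Import Order.TTheory GRing.Theory Num.Theory.
Import numFieldNormedType.Exports.

Local Open Scope classical_set_scope.
Local Open Scope ring_scope.
Local Open Scope complex_scope.

(* Elements of L^2 spaces are represented by complex-valued functions; two
   functions represent the same element when they agree almost everywhere. *)
Section ComplexL2.
Context d (T : measurableType d) (R : realType).
Variables (mu : {measure set T -> \bar R}) (D : set T).

Definition cmeasurable (f : T -> R[i]) :=
  measurable_fun D (fun x => complex.Re (f x)) /\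
  measurable_fun D (fun x => complex.Im (f x)).

Definition Cintegral (f : T -> R[i]) : R[i] :=
  Rintegral mu D (fun x => complex.Re (f x)) +i*
  Rintegral mu D (fun x => complex.Im (f x)).

Definition sqnorm (f : T -> R[i]) : \bar R :=
  (\int[mu]_(x in D) (Normc.normc (f x) ^+ 2)%:E)%E.

Definition L2 (f : T -> R[i]) := cmeasurable f /\ (sqnorm f < +oo)%E.

Definition L2_cvg (u : nat -> T -> R[i]) (f : T -> R[i]) :=
  (fun n => sqnorm (fun x => u n x - f x)) @ \oo --> 0%E.

Definition ae_eq_in (f g : T -> R[i]) :=
  {ae mu, forall x, D x -> f x = g x}.

End ComplexL2.

Section Disc.
Variable R : realType.
Local Notation C := R[i].
Local Notation plane := (R * R)%type.

Definition expi (t : R) : C := cos t +i* sin t.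

Definition cexp (z : C) : C := (expR (complex.Re z))%:C * expi (complex.Im z).

Definition disc : set plane := [set z | z.1 ^+ 2 + z.2 ^+ 2 <= 1].

(* [mR] is R with the display over which [lebesgue_measure] is declared. *)
Local Notation mR := (measurableTypeR R).

Definition area : {measure set (mR * mR)%type -> \bar R} :=
  (@lebesgue_measure R \x @lebesgue_measure R)%E.

Definition sqnormM := sqnorm area disc.
Definition L2M := L2 area disc.

(* Complex derivatives are taken componentwise. *)
Definition pderiv (v : plane) (f : plane -> C) (z : plane) : C :=
  'D_v (fun w => complex.Re (f w)) z +i* 'D_v (fun w => complex.Im (f w)) z.

Definition dx := pderiv (1, 0).
Definition dy := pderiv (0, 1).
Definition del (f : plane -> C) z : C := 2%:R^-1 * (dx f z - 'i%C * dy f z).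
Definition delbar (f : plane -> C) z : C := 2%:R^-1 * (dx f z + 'i%C * dy f z).

Fixpoint Cn (n : nat) (f : plane -> R) : Prop :=
  if n is m.+1 then
    [/\ forall z, differentiable f z,
        Cn m (fun z => 'D_((1, 0) : plane) f z) &
        Cn m (fun z => 'D_((0, 1) : plane) f z)]
  else continuous f.

Definition smooth (f : plane -> C) := forall n,
  Cn n (fun z => complex.Re (f z)) /\ Cn n (fun z => complex.Im (f z)).

(* C_c^oo of the open disc, extended by zero to the plane *)
Definition test_function (phi : plane -> C) :=
  [/\ smooth phi, compact (closure [set z | phi z != 0]) &
      closure [set z | phi z != 0] `<=` interior disc].

(* [weakly L u w]: L u = w in the sense of distributions on the open disc, for
   [L] one of the homogeneous first-order operators [dx], [dy], [del], [delbar]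
   (whose formal transpose is - L). *)
Definition weakly (L : (plane -> C) -> plane -> C) (u w : plane -> C) :=
  forall phi, test_function phi ->
    Cintegral area disc (fun z => u z * L phi z) =
    - Cintegral area disc (fun z => w z * phi z).

(* u is in H^1_0(M) with weak gradient (ux, uy): H^1_0 is the closure of C_c^oo
   in H^1(M). *)
Definition H10_grad (u ux uy : plane -> C) :=
  [/\ [/\ L2M u, L2M ux & L2M uy], weakly dx u ux, weakly dy u uy &
      exists phi : nat -> plane -> C,
        [/\ forall n, test_function (phi n),
            L2_cvg area disc phi u,
            L2_cvg area disc (fun n => dx (phi n)) ux &
            L2_cvg area disc (fun n => dy (phi n)) uy]].

(* This infimum is attained: it is the smallest constant in the inequality. *)
Definition poincare_constant : R :=
  inf [set c : R | 0 < c /\ forall u ux uy, H10_grad u ux uy ->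
    (sqnormM u <= c%:E * (sqnormM ux + sqnormM uy))%E].

Definition sup_disc (a : plane -> C) : R :=
  sup [set Normc.normc (a z) | z in disc].

(* Points of SM are pairs (z, t); functions on the circle are 2 pi-periodic
   functions of the angle t, integrated over a period. *)
Definition SM : set (plane * R) := disc `*` `[0, 2 * pi[%classic.

Definition vol : {measure set ((mR * mR) * mR)%type -> \bar R} :=
  (area \x @lebesgue_measure R)%E.

Definition periodic (f : plane * R -> C) :=
  forall z t, disc z -> f (z, t + 2 * pi) = f (z, t).

Definition sqnormSM := sqnorm vol SM.
Definition L2SM (f : plane * R -> C) := periodic f /\ L2 vol SM f.

(* For k >= 1, f_{k,+} = mode f k and f_{k,-} = mode f (- k). *)
Definition mode (f : plane * R -> C) (k : int) (z : plane) : C :=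
  ((2 * pi)^-1)%:C *
  Cintegral (@lebesgue_measure R) `[0, 2 * pi[%classic
    (fun t => f (z, t) * expi (- (k%:~R * t))).

Definition sqnormK (kappa : R) (f : plane * R -> C) : \bar R :=
  ((2 * pi)%:E * (sqnormM (mode f 0) +
    \sum_(1 <= k <oo) (kappa ^+ k)%:E *
      (sqnormM (mode f (k%:Z)%R) + sqnormM (mode f (- k%:Z)%R))))%E.

Definition L2K (kappa : R) (f : plane * R -> C) :=
  L2SM f /\ (sqnormK kappa f < +oo)%E.

Definition Hsol (k : nat) (u : plane * R -> C) :=
  exists fp fm : plane -> C,
    [/\ L2M fp /\ L2M fm, weakly delbar fp (fun=> 0), weakly del fm (fun=> 0) &
        forall z t, disc z ->
          u (z, t) = expi (k%:R * t) * fp z + expi (- (k%:R * t)) * fm z].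

(* X_perp u, for u with gradient (ux, uy) *)
Definition Xperp (ux uy : plane -> C) (p : plane * R) : C :=
  (sin p.2)%:C * ux p.1 - (cos p.2)%:C * uy p.1.

(* x + t v, for v of angle theta *)
Definition ray (x : plane) (theta t : R) : plane :=
  (x.1 + t * cos theta, x.2 + t * sin theta).

Definition exit_time (x : plane) (theta : R) : R :=
  sup [set t : R | 0 <= t /\ disc (ray x theta t)].

(* The defining integral, applied to representatives: for f in L^2(SM) it
   converges absolutely for almost every (x, theta) in the inward boundary. *)
Definition xray_at (a : plane -> C) (f : plane * R -> C) (x : plane) (theta : R)
    : C :=
  Cintegral (@lebesgue_measure R) `[0, exit_time x theta]%classic (fun t =>
    f (ray x theta t, theta) *
    cexp (Cintegral (@lebesgue_measure R) `[0, t]%classic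
            (fun s => a (ray x theta s)))).

(* fan-beam coordinates (beta, alpha) on the inward boundary *)
Definition inward : set plane :=
  `[0, 2 * pi[%classic `*` `[- (pi / 2), pi / 2]%classic.

Definition xray (a : plane -> C) (f : plane * R -> C) (p : plane) : C :=
  xray_at a f (cos p.1, sin p.1) (p.1 + pi + p.2).

End Disc.

(* Main.v *)
(* Let X = e^(i t) del + e^(-i t) delbar be the geodesic vector field. For w in
   H^1_0(M) the transform annihilates (X + a)(e^(i k t) w): on test functions this
   is the fundamental theorem of calculus along each chord, and the kernel of the
   transform is closed because an L^2(SM)-convergent sequence has a subsequence
   converging in L^2 on almost every chord. Since L^2(M) is the orthogonal sum of
   the kernel of delbar and of del H^1_0(M), the mode f_k, k >= 1, is the sum of a
   solenoidal mode and of some del w; subtracting (X + a)(e^(i (k-1) t) w) leaves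
   only the terms - a w and - delbar w at the frequencies k - 1 and k - 2. This is
   run from the top frequency of a truncation of f down to 1, and symmetrically for
   negative frequencies; what remains at the frequencies 1 and -1 is X_perp g_s. The
   Poincare inequality makes the norm weighted by C^k control the accumulated terms,
   uniformly in the truncation, which gives the limit, the estimate and, with the
   uniqueness that the estimate entails, linearity. *)

(* The constants come from the following bookkeeping. Put [B = 4 a^2 P], with [a] the supremum of
   the attenuation and [P] the Poincare constant, so that [C = 4 + 2 B]. On H^1_0 the cross term
   between [wx] and [i wy] vanishes, hence [|grad w|^2 = 4 |del w|^2 = 4 |delbar w|^2] and
   [|a w|^2 <= B |del w|^2]. What spills into frequency [k] from above is measured against the tail
   [T_k = sum_(j >= k) C^(j - k) |f_j|^2], and [C] is large enough for [spill_k^2 <= C T_(k+1)] to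
   reproduce itself downwards. Successive tails shrink at least by a factor 4, so summing them costs
   4/3; together with a factor 3 for the mode zero the total stays below 4. The obstacle to
   linearity is that vectors are functions known only up to null sets and that each decomposition is
   an arbitrary choice. The construction is therefore a relation between [f] and [g], shown to be
   linear and single-valued up to null sets. It is run in an abstract model of the transform, whose
   axioms are then verified: completeness of the trigonometric system, null sets in fan-beam
   coordinates, and calculus along chords. *)
From HB Require Import structures.
From mathcomp Require Import all_boot all_order all_algebra.
From mathcomp Require Import all_classical all_reals all_analysis.
From mathcomp Require Import measurable_realfun.
From mathcomp Require Import ring lra.
Import Order.TTheory GRing.Theory Num.Theory.
Import numFieldNormedType.Exports.
Require Import Defs.
Set Implicit Arguments.
Unset Strict Implicit.
Unset Printing Implicit Defensive.
Local Open Scope classical_set_scope.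
Local Open Scope ring_scope.
Local Open Scope complex_scope.

(** * Semi-Hilbert spaces *)

(* Elements at distance zero are not identified: vectors will be functions,
   and equality almost everywhere is [nm (x - y) = 0]. *)
HB.mixin Record isSemiHilbert (R : realType) (V : Type) of GRing.Lmodule R[i] V := {
  ip : V -> V -> R;
  ipC : forall x y, ip x y = ip y x;
  ipDl : forall x y z, ip (x + y) z = ip x z + ip y z;
  ipZl : forall (a : R) x y, ip (a%:C *: x) y = a * ip x y;
  ipI : forall x y, ip ('i%C *: x) ('i%C *: y) = ip x y;
  ip_ge0 : forall x, 0 <= ip x x;
  ip_complete : forall u : nat -> V,
    (forall e : R, 0 < e -> exists N, forall m n, (N <= m)%N -> (N <= n)%N ->
      ip (u m - u n) (u m - u n) < e) ->
    exists x, (fun n => ip (u n - x) (u n - x)) @ \oo --> (0 : R)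
}.
#[short(type="semiHilbertType")]
HB.structure Definition SemiHilbert (R : realType) :=
  {V of isSemiHilbert R V & GRing.Lmodule R[i] V}.

Section SemiHilbertTheory.
Variables (R : realType) (V : semiHilbertType R).
Implicit Types (x y z : V) (u : nat -> V).

Definition nm x : R := Num.sqrt (ip x x).

Lemma ipDr x y z : ip x (y + z) = ip x y + ip x z.
Proof. by rewrite ipC ipDl !(ipC x). Qed.

Lemma ipZr (a : R) x y : ip x (a%:C *: y) = a * ip x y.
Proof. by rewrite ipC ipZl ipC. Qed.

Lemma ipNl x y : ip (- x) y = - ip x y.
Proof.
have -> : - x = (-1)%:C *: x by rewrite rmorphN1 scaleN1r.
by rewrite ipZl mulN1r.
Qed.

Lemma ipNr x y : ip x (- y) = - ip x y.
Proof. by rewrite ipC ipNl ipC. Qed.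

Lemma ip0l x : ip 0 x = 0.
Proof. by rewrite -(scale0r 0) ipZl mul0r. Qed.

Lemma ip_suml I (r : seq I) (P : pred I) (F : I -> V) y :
  ip (\sum_(i <- r | P i) F i) y = \sum_(i <- r | P i) ip (F i) y.
Proof.
elim/big_rec2 : _ => [|i a b _ <-]; first by rewrite ip0l.
by rewrite ipDl.
Qed.

Lemma ip_sumr I (r : seq I) (P : pred I) (F : I -> V) y :
  ip y (\sum_(i <- r | P i) F i) = \sum_(i <- r | P i) ip y (F i).
Proof. by rewrite ipC ip_suml; apply: eq_bigr => i _; rewrite ipC. Qed.

Lemma ip_sqD x y : ip (x + y) (x + y) = ip x x + 2 * ip x y + ip y y.
Proof. rewrite ipDl !ipDr (ipC y x); ring. Qed.

Lemma nm_ge0 x : 0 <= nm x. Proof. exact: sqrtr_ge0. Qed.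

Lemma nm_sq x : nm x ^+ 2 = ip x x. Proof. by rewrite sqr_sqrtr// ip_ge0. Qed.

(** Cauchy-Schwarz, from the nonnegative quadratic [ip (x + t y) (x + t y)] in [t]. As [ip] is only
    semidefinite, [ip y y = 0] does not give [y = 0] and is a case of its own. *)
Lemma ip_sq_le x y : ip x y ^+ 2 <= ip x x * ip y y.
Proof.
have key t : 0 <= ip x x + 2 * t * ip x y + t ^+ 2 * ip y y.
  have := ip_ge0 (x + t%:C *: y); rewrite ip_sqD !ipZr ipZl expr2; congr (_ <= _); ring.
have [y0|y0] := eqVneq (ip y y) 0.
  have [xy0|xy0] := eqVneq (ip x y) 0; first by rewrite xy0 y0 mulr0 expr0n.
  (* When [ip y y = 0] the quadratic is affine in [t]; with a nonzero slope this [t] would give it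
     the value -1. *)
  have := key (- (ip x x + 1) / (2 * ip x y)).
  rewrite y0 mulr0 addr0.
  have -> : ip x x + 2 * (- (ip x x + 1) / (2 * ip x y)) * ip x y = -1 by field; rewrite xy0.
  by rewrite oppr_ge0 ler10.
have yp : 0 < ip y y by rewrite lt_neqAle eq_sym y0 ip_ge0.
have := key (- ip x y / ip y y).
have -> : ip x x + 2 * (- ip x y / ip y y) * ip x y + (- ip x y / ip y y) ^+ 2 * ip y y
  = (ip x x * ip y y - ip x y ^+ 2) / ip y y by field; rewrite y0.
by rewrite pmulr_lge0 ?invr_gt0// subr_ge0.
Qed.

Lemma ip_le x y : `|ip x y| <= nm x * nm y.
Proof.
rewrite -(@ler_pXn2r _ 2) ?nnegrE ?mulr_ge0 ?nm_ge0 ?normr_ge0//.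
by rewrite exprMn !nm_sq real_normK ?num_real// ip_sq_le.
Qed.

Lemma nmD x y : nm (x + y) <= nm x + nm y.
Proof.
rewrite -(@ler_pXn2r _ 2) ?nnegrE ?addr_ge0 ?nm_ge0//.
rewrite nm_sq ip_sqD sqrrD !nm_sq.
have := le_trans (ler_norm _) (ip_le x y); lra.
Qed.

Lemma nm0 : nm 0 = 0. Proof. by rewrite /nm ip0l sqrtr0. Qed.

(** [ip] behaves as the real part of a Hermitian product: its invariance under multiplication by [i]
    makes [i x] orthogonal to [x], so the real and imaginary parts of [c] contribute
    orthogonally. *)
Lemma nmZ (c : R[i]) x : nm (c *: x) = Normc.normc c * nm x.
Proof.
have xi z : ip z ('i%C *: z) = 0.
  apply/eqP; have := ipI z ('i%C *: z); rewrite scalerA -expr2 sqr_i scaleN1r ipNr ipC.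
  by move=> /eqP; rewrite eq_sym -addr_eq0 -mulr2n mulrn_eq0.
have -> : c *: x = (complex.Re c)%:C *: x + (complex.Im c)%:C *: ('i%C *: x).
  rewrite scalerA -scalerDl; congr (_ *: _); rewrite mulrC; exact: complexE.
rewrite {1}/nm ip_sqD !ipZl !ipZr xi ipI !mulr0 addr0.
have -> : complex.Re c * (complex.Re c * ip x x) + complex.Im c * (complex.Im c * ip x x) =
   (complex.Re c ^+ 2 + complex.Im c ^+ 2) * ip x x by ring.
rewrite sqrtrM ?addr_ge0 ?sqr_ge0//; congr (_ * _).
by case: c => a b.
Qed.

Lemma nmN x : nm (- x) = nm x.
Proof. by rewrite /nm ipNl ipNr opprK. Qed.

Lemma nmB x y : nm (x - y) <= nm x + nm y.
Proof. by rewrite -(nmN y) nmD. Qed.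

Lemma nmBC x y : nm (x - y) = nm (y - x).
Proof. by rewrite -opprB nmN. Qed.

Lemma nm_dist x y z : nm (x - z) <= nm (x - y) + nm (y - z).
Proof. by rewrite (le_trans _ (nmD _ _))// addrA subrK. Qed.

Lemma nm_dist_le x y : `|nm x - nm y| <= nm (x - y).
Proof.
rewrite ler_norml; apply/andP; split.
  by rewrite lerNl opprB lerBlDr nmBC -{1}(subrK x y) nmD.
by rewrite lerBlDr -{1}(subrK y x) nmD.
Qed.

Definition Hcvg u x := (fun n => nm (u n - x)) @ \oo --> (0 : R).

Lemma HcvgP u x : Hcvg u x <->
  forall e : R, 0 < e -> exists N, forall n, (N <= n)%N -> nm (u n - x) < e.
Proof.
split.
  move=> h e e0; have [N _ hN] := ((cvgr0Pnorm_lt _).1 h) e e0.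
  exists N => n Nn; have := hN n Nn; by rewrite /= ger0_norm ?nm_ge0.
move=> h; apply/cvgr0Pnorm_lt => e /h[N hN]; exists N => // n /= Nn.
by rewrite ger0_norm ?nm_ge0// hN.
Qed.

Definition Hcauchy u := forall e : R, 0 < e ->
  exists N, forall m n, (N <= m)%N -> (N <= n)%N -> nm (u m - u n) < e.

Lemma Hcauchy_cvg u : Hcauchy u -> exists x, Hcvg u x.
Proof.
move=> cu; have [|x hx] := @ip_complete _ _ u.
  move=> e e0; have [N hN] := cu (Num.sqrt e) (eq_ind_r is_true e0 (sqrtr_gt0 e)).
  exists N => m n Nm Nn; have := hN m n Nm Nn.
  by rewrite /nm ltr_sqrt.
exists x; rewrite /Hcvg /nm -(sqrtr0 R); apply: continuous_cvg => //.
exact: sqrt_continuous.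
Qed.

Lemma Hcvg_cauchy u x : Hcvg u x -> Hcauchy u.
Proof.
move=> /HcvgP h e e0; have [N hN] := h (e / 2) (divr_gt0 e0 (ltr0Sn _ _)).
exists N => m n /hN mx /hN nx; rewrite (le_lt_trans (nm_dist _ x _))//.
by rewrite (nmBC x) (splitr e) ltrD.
Qed.

Lemma HcvgD u v x y : Hcvg u x -> Hcvg v y -> Hcvg (fun n => u n + v n) (x + y).
Proof.
move=> hu hv; rewrite /Hcvg; apply: (@squeeze_cvgr _ _ _ _ (cst 0) (fun n => nm (u n - x) + nm (v n - y))).
- apply: nearW => n /=; rewrite nm_ge0 /= (le_trans _ (nmD _ _))//.
  by rewrite opprD addrACA.
- exact: cvg_cst.
- by rewrite -[X in _ --> X]addr0; apply: cvgD.
Qed.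

Lemma HcvgZ c u x : Hcvg u x -> Hcvg (fun n => c *: u n) (c *: x).
Proof.
move=> hu; rewrite /Hcvg; under eq_fun do rewrite -scalerBr nmZ.
by rewrite -(mulr0 (Normc.normc c)); apply: cvgMr.
Qed.

Lemma HcvgN u x : Hcvg u x -> Hcvg (fun n => - u n) (- x).
Proof. by rewrite /Hcvg; under [in X in _ -> X]eq_fun do rewrite -opprD nmN. Qed.

Lemma HcvgB u v x y : Hcvg u x -> Hcvg v y -> Hcvg (fun n => u n - v n) (x - y).
Proof. by move=> hu /HcvgN; exact: HcvgD. Qed.

Lemma Hcvg_cst x : Hcvg (fun=> x) x.
Proof. by rewrite /Hcvg subrr nm0; exact: cvg_cst. Qed.

Lemma Hcvg_nm u x : Hcvg u x -> (fun n => nm (u n)) @ \oo --> nm x.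
Proof.
move=> /HcvgP h; apply/cvgrPdist_lt => e /h[N hN]; exists N => // n /= Nn.
by rewrite (le_lt_trans (nm_dist_le _ _))// nmBC hN.
Qed.

Lemma Hcvg_ip u x y : Hcvg u x -> (fun n => ip (u n) y) @ \oo --> ip x y.
Proof.
move=> /HcvgP h; apply/cvgrPdist_lt => e e0.
have y1 : 0 < nm y + 1 by rewrite ltr_wpDl ?nm_ge0.
have [N hN] := h (e / (nm y + 1)) (divr_gt0 e0 y1).
exists N => // n /= /hN hn; rewrite distrC.
have -> : ip (u n) y - ip x y = ip (u n - x) y by rewrite ipDl ipNl.
rewrite (le_lt_trans (ip_le _ _))//.
rewrite (@le_lt_trans _ _ (nm (u n - x) * (nm y + 1)))//.
  by rewrite ler_wpM2l ?nm_ge0// lerDl.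
by rewrite -ltr_pdivlMr.
Qed.

Lemma Hcvg_unique u x y : Hcvg u x -> Hcvg u y -> nm (x - y) = 0.
Proof.
move=> hx hy; have := Hcvg_nm (HcvgB hx hy).
under eq_fun do rewrite subrr nm0.
by move=> h; apply/esym; apply: cvg_unique h; [exact: Rhausdorff|exact: cvg_cst].
Qed.

Definition aeq x y := nm (x - y) = 0.

Lemma aeq_refl x : aeq x x. Proof. by rewrite /aeq subrr nm0. Qed.
Lemma aeq_sym x y : aeq x y -> aeq y x. Proof. by rewrite /aeq nmBC. Qed.
Lemma aeq_trans y x z : aeq x y -> aeq y z -> aeq x z.
Proof.
rewrite /aeq => xy yz; apply/eqP; rewrite eq_le nm_ge0 andbT.
by rewrite (le_trans (nm_dist _ y _))// xy yz addr0.
Qed.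
Lemma aeqD x y x' y' : aeq x x' -> aeq y y' -> aeq (x + y) (x' + y').
Proof.
rewrite /aeq => xx yy; apply/eqP; rewrite eq_le nm_ge0 andbT.
by rewrite opprD addrACA (le_trans (nmD _ _))// xx yy addr0.
Qed.
Lemma aeqZ c x y : aeq x y -> aeq (c *: x) (c *: y).
Proof. by rewrite /aeq -scalerBr nmZ => ->; rewrite mulr0. Qed.
Lemma aeqN x y : aeq x y -> aeq (- x) (- y).
Proof. by rewrite /aeq -opprD nmN. Qed.
Lemma aeqB x y x' y' : aeq x x' -> aeq y y' -> aeq (x - y) (x' - y').
Proof. by move=> h1 /aeqN; exact: aeqD. Qed.
Lemma aeq_sum I (r : seq I) (F G : I -> V) : (forall i, aeq (F i) (G i)) ->
  aeq (\sum_(i <- r) F i) (\sum_(i <- r) G i).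
Proof.
move=> h; elim: r => [|i r IH]; first by rewrite !big_nil; exact: aeq_refl.
by rewrite !big_cons; apply: aeqD.
Qed.
Lemma aeq_nm x y : aeq x y -> nm x = nm y.
Proof.
rewrite /aeq => h; apply/eqP; rewrite -subr_eq0 -normr_eq0 eq_le normr_ge0 andbT.
by rewrite -h nm_dist_le.
Qed.
Lemma Hcvg_aeq u v x y : (forall n, aeq (u n) (v n)) -> aeq x y -> Hcvg u x -> Hcvg v y.
Proof.
move=> uv xy; rewrite /Hcvg.
suff -> : (fun n => nm (u n - x)) = (fun n => nm (v n - y)) by [].
by apply/funext => n; apply: aeq_nm; apply: aeqB.
Qed.
Lemma aeq_ip0 x : (forall y, ip x y = 0) -> aeq x 0.
Proof. by move=> h; rewrite /aeq subr0 /nm h sqrtr0. Qed.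

(* Minimizing sequences are Cauchy by the parallelogram identity. *)
Lemma projection (S : set V) f : S 0 ->
  (forall (c : R) x y, S x -> S y -> S (c%:C *: x + y)) ->
  exists (s : nat -> V) p, [/\ forall n, S (s n), Hcvg s p &
    forall y, S y -> ip (f - p) y = 0].
Proof.
move=> S0 SD.
pose D := [set nm (f - x) ^+ 2 | x in S].
have D0 : D !=set0 by exists (nm (f - 0) ^+ 2), 0.
have Dlb : has_lbound D by exists 0 => _ [x _ <-]; rewrite sqr_ge0.
have hD : has_inf D by split.
pose d := inf D.
have dle x : S x -> d <= nm (f - x) ^+ 2 by move=> Sx; apply: ge_inf => //; exists x.
have ex n : exists x, S x /\ nm (f - x) ^+ 2 < d + n.+1%:R^-1.
  have [|_ [x Sx <-] hx] := @inf_adherent _ D n.+1%:R^-1 _ hD; last by exists x.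
  by rewrite invr_gt0.
pose s n := projT1 (cid (ex n)).
have Ss n : S (s n) by rewrite /s; case: cid => x [].
have hs n : nm (f - s n) ^+ 2 < d + n.+1%:R^-1 by rewrite /s; case: cid => x [].
have SZ (c : R) x : S x -> S (c%:C *: x).
  by move=> Sx; rewrite -[X in S X]addr0; apply: SD.
(* The midpoint of [s m] and [s n] lies in [S], so its squared distance to [f] is at least [d]. *)
have par m n : nm (s m - s n) ^+ 2 <= 2 * m.+1%:R^-1 + 2 * n.+1%:R^-1.
  have Sh : S ((2^-1)%:C *: s m + (2^-1)%:C *: s n) by apply: SD => //; apply: SZ.
  have := dle _ Sh; have := hs m; have := hs n; rewrite !nm_sq.
  set X := f - s m; set Y := f - s n.
  have -> : f - ((2^-1)%:C *: s m + (2^-1)%:C *: s n) = (2^-1)%:C *: (X + Y).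
    have {1}-> : f = (2^-1)%:C *: f + (2^-1)%:C *: f.
      rewrite -scalerDl -rmorphD/= (_ : 2^-1 + 2^-1 = 1) ?scale1r//.
      by field.
    by rewrite /X /Y opprD addrACA !scalerDr !scalerN.
  have -> : s m - s n = Y - X by rewrite /X /Y opprB [RHS]addrC addrA subrK.
  clearbody X Y; rewrite ipZl ipZr !ip_sqD ipNl !ipNr (ipC Y X) opprK.
  move: m.+1%:R^-1 n.+1%:R^-1 => a b; lra.
have cs : Hcauchy s.
  move=> e e0; have e2 : 0 < e ^+ 2 / 4 by rewrite divr_gt0// exprn_gt0.
  have [N _ hN] := near_infty_natSinv_lt (PosNum e2).
  exists N => m n Nm Nn; rewrite -(@ltr_pXn2r _ 2) ?nnegrE ?nm_ge0 ?ltW//.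
  have := par m n; have := hN m Nm; have := hN n Nn => /=.
  move: m.+1%:R^-1 n.+1%:R^-1 (nm _ ^+ 2) (e ^+ 2) => a b c d'; lra.
have [p hp] := Hcauchy_cvg cs.
exists s, p; split => // y Sy.
have fp : nm (f - p) ^+ 2 <= d.
  have c1 : (fun n => nm (f - s n) ^+ 2) @ \oo --> nm (f - p) ^+ 2.
    by apply: cvgM; apply: Hcvg_nm; apply: HcvgB => //; exact: Hcvg_cst.
  have c2 : (fun n => d + n.+1%:R^-1 : R) @ \oo --> d.
    by rewrite -[X in _ --> X]addr0; apply: cvgD; [exact: cvg_cst|exact: cvg_harmonic].
  rewrite -(cvg_lim _ c1)// -(cvg_lim _ c2)//.
  apply: ler_lim; [exact: cvgP c1|exact: cvgP c2|].
  by apply: nearW => n; apply: ltW.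
(* The limit [p] need not lie in [S]; the comparison with [p + t y] is the limit of the one with
   [t y + s n], which does. *)
have key t : 0 <= - (2 * t * ip (f - p) y) + t ^+ 2 * ip y y.
  have lim : (fun n => nm (f - (t%:C *: y + s n)) ^+ 2) @ \oo -->
      nm (f - (t%:C *: y + p)) ^+ 2.
    apply: cvgM; apply: Hcvg_nm; apply: HcvgB; (try exact: Hcvg_cst);
    by apply: HcvgD => //; exact: Hcvg_cst.
  have : d <= nm (f - (t%:C *: y + p)) ^+ 2.
    rewrite -(cvg_lim _ lim)//; apply: limr_ge; first exact: cvgP lim.
    by apply: nearW => n; apply: dle; apply: SD.
  have -> : f - (t%:C *: y + p) = (f - p) + - (t%:C *: y).
    by rewrite opprD [- _ - _]addrC addrA.
  move=> h; have := le_trans fp h.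
  move: (f - p) => q; rewrite !nm_sq ip_sqD !ipNr !ipNl opprK !ipZl !ipZr.
  move: (ip q q) (ip q y) (ip y y) => a b c; nra.
have [y0|y0] := eqVneq (ip y y) 0.
  have := key (ip (f - p) y); rewrite y0 mulr0 addr0 oppr_ge0.
  rewrite -mulrA pmulr_rle0// -expr2 => h.
  by apply/eqP; rewrite -sqrf_eq0 eq_le h sqr_ge0.
have yp : 0 < ip y y by rewrite lt_neqAle eq_sym y0 ip_ge0.
have := key (ip (f - p) y / ip y y).
have -> : - (2 * (ip (f - p) y / ip y y) * ip (f - p) y) + (ip (f - p) y / ip y y) ^+ 2 * ip y y
  = - (ip (f - p) y ^+ 2 / ip y y) by field; rewrite y0.
rewrite oppr_ge0 pmulr_lle0 ?invr_gt0// => h.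
by apply/eqP; rewrite -sqrf_eq0 eq_le h sqr_ge0.
Qed.
End SemiHilbertTheory.

(** * Spaces of square integrable functions *)

Section ComplexNumbers.
Variable R : realType.
Implicit Types x y : R[i].

Lemma normc_sq x : Normc.normc x ^+ 2 = complex.Re x ^+ 2 + complex.Im x ^+ 2.
Proof. by case: x => a b /=; rewrite sqr_sqrtr// addr_ge0 ?sqr_ge0. Qed.

Lemma cReM x y : complex.Re (x * y) =
  complex.Re x * complex.Re y - complex.Im x * complex.Im y.
Proof. by case: x y => [? ?] [? ?]. Qed.

Lemma cImM x y : complex.Im (x * y) =
  complex.Re x * complex.Im y + complex.Im x * complex.Re y.
Proof. by case: x y => [? ?] [? ?]. Qed.

Lemma normc_sqM x y :
  Normc.normc (x * y) ^+ 2 = Normc.normc x ^+ 2 * Normc.normc y ^+ 2.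
Proof. by rewrite Normc.normcM exprMn. Qed.

Lemma complex_eq x y :
  complex.Re x = complex.Re y -> complex.Im x = complex.Im y -> x = y.
Proof. by case: x y => [? ?] [? ?] /= -> ->. Qed.

Lemma normc_sq_eq0 x : Normc.normc x ^+ 2 = 0 -> x = 0.
Proof.
rewrite normc_sq => h; have := sqr_ge0 (complex.Re x); have := sqr_ge0 (complex.Im x).
move=> i0 r0; have r : complex.Re x ^+ 2 == 0 by rewrite eq_le r0 andbT; lra.
have i : complex.Im x ^+ 2 == 0 by rewrite eq_le i0 andbT; lra.
by apply: complex_eq; apply/eqP; rewrite -sqrf_eq0.
Qed.

End ComplexNumbers.

(* [Re (f * conj g)] *)
Definition rprod (R : realType) (T : Type) (f g : T -> R[i]) x : R :=
  complex.Re (f x) * complex.Re (g x) + complex.Im (f x) * complex.Im (g x).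

(* Locked, since unification would otherwise unfold integrals. *)
HB.lock Definition rip d (T : measurableType d) (R : realType)
  (mu : {measure set T -> \bar R}) (D : set T) (f g : T -> R[i]) : R :=
  Rintegral mu D (rprod f g).
Canonical rip_unlockable := Unlockable rip.unlock.

Section L2.
Context d (T : measurableType d) (R : realType).
Variables (mu : {measure set T -> \bar R}) (D : set T).
Hypothesis mD : measurable D.
Implicit Types f g : T -> R[i].

Lemma cmeasurableD f g : cmeasurable D f -> cmeasurable D g ->
  cmeasurable D (fun x => f x + g x).
Proof.
move=> [f1 f2] [g1 g2]; split.
  by under eq_fun do rewrite raddfD; exact: measurable_funD.
by under eq_fun do rewrite raddfD; exact: measurable_funD.
Qed.

Lemma cmeasurableM f g : cmeasurable D f -> cmeasurable D g ->
  cmeasurable D (fun x => f x * g x).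
Proof.
move=> [f1 f2] [g1 g2]; split.
  under eq_fun do rewrite cReM.
  by apply: measurable_funB; exact: measurable_funM.
under eq_fun do rewrite cImM.
by apply: measurable_funD; exact: measurable_funM.
Qed.

Lemma cmeasurable_cst c : cmeasurable D (fun=> c : R[i]).
Proof. by split; exact: measurable_cst. Qed.

Lemma cmeasurable_sq f : cmeasurable D f ->
  measurable_fun D (fun x => Normc.normc (f x) ^+ 2).
Proof.
move=> [f1 f2]; under eq_fun do rewrite normc_sq.
by apply: measurable_funD; apply: measurable_funX.
Qed.

Lemma integrableDr (f g : T -> R) : mu.-integrable D (fun x => (f x)%:E) ->
  mu.-integrable D (fun x => (g x)%:E) -> mu.-integrable D (fun x => (f x + g x)%:E).
Proof. by move=> hf hg; exact: (integrableD mD hf hg). Qed.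

Lemma integrableZlr (c : R) (f : T -> R) : mu.-integrable D (fun x => (f x)%:E) ->
  mu.-integrable D (fun x => (c * f x)%:E).
Proof. by move=> hf; exact: (integrableZl mD c hf). Qed.

Lemma sqnorm_ge0 f : (0 <= sqnorm mu D f)%E.
Proof. by apply: integral_ge0 => x _; rewrite lee_fin sqr_ge0. Qed.

Lemma L2P f : L2 mu D f <-> cmeasurable D f /\
  mu.-integrable D (fun x => (Normc.normc (f x) ^+ 2)%:E).
Proof.
split=> [[mf fi]|[mf /integrableP[_ fi]]]; split => //.
  apply/integrableP; split; first exact/measurable_EFinP/cmeasurable_sq.
  by under eq_integral do rewrite /= ger0_norm ?sqr_ge0//.
by move: fi; under eq_integral do rewrite /= ger0_norm ?sqr_ge0//.
Qed.

Lemma L2_dominated f g h : L2 mu D f -> L2 mu D g -> cmeasurable D h ->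
  (forall x, D x -> Normc.normc (h x) ^+ 2 <=
     2 * Normc.normc (f x) ^+ 2 + 2 * Normc.normc (g x) ^+ 2) -> L2 mu D h.
Proof.
move=> /L2P[mf fi] /L2P[mg gi] mh le; apply/L2P; split => //.
apply: (@le_integrable _ _ _ mu D mD _
  (fun x => (2 * Normc.normc (f x) ^+ 2 + 2 * Normc.normc (g x) ^+ 2)%:E)).
- exact/measurable_EFinP/cmeasurable_sq.
- move=> x Dx /=; rewrite lee_fin ger0_norm ?sqr_ge0// ger0_norm ?le//.
  by rewrite addr_ge0// mulr_ge0// sqr_ge0.
- by apply: integrableDr => //; apply: integrableZlr.
Qed.

Lemma L2_add f g : L2 mu D f -> L2 mu D g -> L2 mu D (fun x => f x + g x).
Proof.
move=> hf hg; apply: (L2_dominated hf hg); first by apply: cmeasurableD; [case: hf|case: hg].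
move=> x _; rewrite !normc_sq !raddfD/=.
set a := complex.Re _; set b := complex.Re _; set c := complex.Im _; set e := complex.Im _.
have := sqr_ge0 (a - b); have := sqr_ge0 (c - e); nra.
Qed.

Lemma L2_mul (h : T -> R[i]) (M : R) f : cmeasurable D h ->
  (forall x, D x -> Normc.normc (h x) <= M) -> L2 mu D f ->
  L2 mu D (fun x => h x * f x).
Proof.
move=> mh hM /L2P[mf fi]; apply/L2P; split; first exact: cmeasurableM.
apply: (@le_integrable _ _ _ mu D mD _ (fun x => (M ^+ 2 * Normc.normc (f x) ^+ 2)%:E)).
- exact/measurable_EFinP/cmeasurable_sq/cmeasurableM.
- move=> x Dx /=; rewrite lee_fin ger0_norm ?sqr_ge0// ger0_norm; last first.
    by rewrite mulr_ge0// sqr_ge0.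
  rewrite normc_sqM ler_wpM2r ?sqr_ge0//.
  have n0 : 0 <= Normc.normc (h x) by case: (h x) => a b; exact: sqrtr_ge0.
  by rewrite ler_sqr ?nnegrE ?hM// (le_trans n0)// hM.
- exact: integrableZlr.
Qed.

Lemma L2_scale (c : R[i]) f : L2 mu D f -> L2 mu D (fun x => c * f x).
Proof.
by apply: (@L2_mul (fun=> c) (Normc.normc c)) => //; exact: cmeasurable_cst.
Qed.

Lemma L2_zero : L2 mu D (fun=> 0 : R[i]).
Proof.
apply/L2P; split; first exact: cmeasurable_cst.
have -> : (fun _ : T => (Normc.normc (0 : R[i]) ^+ 2)%:E) = cst 0%E.
  by apply/funext => x; rewrite normc_sq/= expr0n addr0.
exact: integrable0.
Qed.

Lemma L2_bounded (M : R) f : (mu D < +oo)%E -> cmeasurable D f ->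
  (forall x, D x -> Normc.normc (f x) <= M) -> L2 mu D f.
Proof.
move=> fin mf fM.
suff h1 : L2 mu D (fun=> 1 : R[i]).
  have := @L2_mul f M (fun=> 1) mf fM h1.
  by rewrite (_ : (fun x => f x * 1) = f)//; apply/funext => x; rewrite mulr1.
apply/L2P; split; first exact: cmeasurable_cst.
have -> : (fun _ : T => (Normc.normc (1 : R[i]) ^+ 2)%:E) = cst 1%E.
  by apply/funext => x; rewrite normc_sq/= expr0n expr1n addr0.
apply/integrableP; split; first exact: measurable_cst.
by under eq_integral do rewrite gee0_abs//; rewrite integral_cst// mul1e.
Qed.

Lemma rprod_integrable f g : L2 mu D f -> L2 mu D g ->
  mu.-integrable D (fun x => (rprod f g x)%:E).
Proof.
move=> /L2P[mf fi] /L2P[mg gi].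
apply: (@le_integrable _ _ _ mu D mD _
  (fun x => (Normc.normc (f x) ^+ 2 + Normc.normc (g x) ^+ 2)%:E)).
- apply/measurable_EFinP; case: mf => ? ?; case: mg => ? ?.
  by apply: measurable_funD; apply: measurable_funM.
- move=> x Dx /=; rewrite lee_fin [leRHS]ger0_norm ?addr_ge0 ?sqr_ge0// /rprod !normc_sq.
  set a := complex.Re _; set b := complex.Re _; set c := complex.Im _; set e := complex.Im _.
  have := sqr_ge0 (a - b); have := sqr_ge0 (c - e).
  have := sqr_ge0 (a + b); have := sqr_ge0 (c + e).
  rewrite ler_norml; move=> h1 h2 h3 h4; apply/andP; split; nra.
- exact: integrableDr.
Qed.

Lemma rip_sqnorm f : L2 mu D f -> sqnorm mu D f = (rip mu D f f)%:E.
Proof.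
move=> hf; have [mf fi] := hf; rewrite unlock /Rintegral fineK.
  by apply: eq_integral => x _; rewrite normc_sq /rprod !expr2.
exact/integrable_fin_num/rprod_integrable.
Qed.

Lemma sqnorm_eq0 f : cmeasurable D f -> sqnorm mu D f = 0%E ->
  ae_eq_in mu D f (fun=> 0).
Proof.
move=> mf h; have /(ae_eq_integral_abs mu mD) : measurable_fun D (EFin \o (fun x => Normc.normc (f x) ^+ 2)).
  exact/measurable_EFinP/cmeasurable_sq.
case=> + _; under eq_integral do rewrite /= ger0_norm ?sqr_ge0//.
move=> /(_ h); apply: filterS => x /= fx Dx; have := fx Dx.
by move=> [] /normc_sq_eq0.
Qed.

Lemma eq_sqnorm f g : cmeasurable D f -> cmeasurable D g ->
  ae_eq_in mu D f g -> sqnorm mu D f = sqnorm mu D g.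
Proof.
move=> mf mg fg; apply: ge0_ae_eq_integral => //.
- exact/measurable_EFinP/cmeasurable_sq.
- exact/measurable_EFinP/cmeasurable_sq.
- by move=> x _; rewrite lee_fin sqr_ge0.
- by move=> x _; rewrite lee_fin sqr_ge0.
- by move: fg; apply: filterS => x /= fg Dx; rewrite fg.
Qed.

Lemma ripC f g : rip mu D f g = rip mu D g f.
Proof.
by rewrite unlock; congr Rintegral; apply/funext => x; rewrite /rprod mulrC [X in _ + X]mulrC.
Qed.

Lemma ripDl f g h : L2 mu D f -> L2 mu D g -> L2 mu D h ->
  rip mu D (fun x => f x + g x) h = rip mu D f h + rip mu D g h.
Proof.
move=> hf hg hh; rewrite unlock -RintegralD//; [|exact: rprod_integrable..].
by congr Rintegral; apply/funext => x; rewrite /rprod !raddfD/=; ring.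
Qed.

Lemma ripZl (a : R) f h : L2 mu D f -> L2 mu D h ->
  rip mu D (fun x => a%:C * f x) h = a * rip mu D f h.
Proof.
move=> hf hh; rewrite unlock -RintegralZl//; last exact: rprod_integrable.
by congr Rintegral; apply/funext => x; rewrite /rprod !cReM !cImM /=; ring.
Qed.

Lemma ripI f h : rip mu D (fun x => 'i * f x) (fun x => 'i * h x) = rip mu D f h.
Proof.
rewrite unlock; congr Rintegral; apply/funext => x; rewrite /rprod !cReM !cImM /=; ring.
Qed.

(* If [\sum_j 4^j |u_(j+1) - u_j|^2] is finite at [x], then [u_j x] converges;
   weighting by [4^j] replaces the Minkowski inequality for infinite sums. *)
Lemma ae_cvg_fast (u : nat -> T -> R) : (forall n, measurable_fun D (u n)) ->
  (forall n, (\int[mu]_(x in D) ((u n.+1 x - u n x) ^+ 2)%:E <= (8^-1 ^+ n)%:E)%E) ->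
  {ae mu, forall x, D x -> cvgn (u ^~ x)}.
Proof.
move=> mu_ hu.
pose F j x := ((4 ^+ j * (u j.+1 x - u j x) ^+ 2)%:E : \bar R).
have F0 j x : D x -> (0 <= F j x)%E by move=> _; rewrite lee_fin mulr_ge0 ?sqr_ge0// exprn_ge0.
have mF j : measurable_fun D (F j).
  apply/measurable_EFinP/measurable_funM => //; apply/measurable_funX.
  by apply: measurable_funB.
(* The j-th term integrates to at most [4^j 8^-j = 2^-j]. *)
have iF : (\int[mu]_(x in D) (\sum_(j <oo) F j x) < +oo)%E.
  rewrite integral_nneseries//.
  apply: (@le_lt_trans _ _ (\sum_(j <oo) (2^-1 ^+ j)%:E)%E).
    apply: lee_nneseries => [j _ _|j _]; first by apply: integral_ge0 => x; exact: F0.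
    rewrite /F; under eq_integral do rewrite EFinM.
    rewrite ge0_integralZl//; last 2 first.
    - apply/measurable_EFinP/measurable_funX; exact: measurable_funB.
    - by move=> x _; rewrite lee_fin sqr_ge0.
    apply: le_trans (lee_wpmul2l _ (hu j)) _; first by rewrite lee_fin exprn_ge0.
    rewrite -EFinM lee_fin -exprMn_comm; last exact: mulrC.
    by rewrite (_ : 4 * 8^-1 = 2^-1)//; lra.
  rewrite (_ : (fun _ => _) = (fun n => (series (geometric 1 2^-1) n)%:E)).
    have h2 : `|2^-1| < 1 :> R by rewrite ger0_norm ?invr_ge0// invf_lt1 ?ltr1n.
    by rewrite EFin_lim ?ltry//; apply/cvg_ex; eexists; exact: cvg_geometric_series.
  apply/funext => n; rewrite -sumEFin; apply: eq_bigr => i _.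
  by rewrite /geometric /= mul1r.
have sF : mu.-integrable D (fun x => \sum_(j <oo) F j x)%E.
  apply/integrableP; split.
    by apply: ge0_emeasurable_sum => // j x Dx _; exact: F0.
  rewrite (@eq_integral _ _ _ mu D (fun x => \sum_(j <oo) F j x)%E)// => x xD.
  by rewrite gee0_abs// nneseries_ge0// => n _ _; apply: F0; rewrite inE in xD.
have := integrable_ae mD sF; apply: filterS => x /= h Dx; have {h}Sfin := h Dx.
set S := (\sum_(j <oo) F j x)%E in Sfin.
have Fle j : (F j x <= S)%E.
  apply: le_trans (nneseries_lim_ge j.+1 _) => [|k _ _]; last exact: F0.
  rewrite big_mkord big_ord_recr/= leeDr// sume_ge0// => i _; exact: F0.
have S0 : 0 <= fine S by rewrite fine_ge0// nneseries_ge0// => k _ _; exact: F0.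
(* A single term is at most the sum: [4^j |u_(j+1) - u_j|^2 <= S] gives a geometric bound of ratio
   1/2. *)
have dle j : `|u j.+1 x - u j x| <= geometric (Num.sqrt (fine S)) 2^-1 j.
  rewrite /geometric/= -(@ler_pXn2r _ 2) ?nnegrE ?mulr_ge0 ?exprn_ge0 ?invr_ge0 ?sqrtr_ge0//.
  rewrite real_normK ?num_real// exprMn sqr_sqrtr// -exprM mulnC exprM.
  have -> : 2^-1 ^+ 2 = 4^-1 :> R by rewrite exprVn; congr (_^-1); ring.
  rewrite exprVn ler_pdivlMr ?exprn_gt0// mulrC.
  by have := Fle j; rewrite -(fineK Sfin) lee_fin.
have : cvgn (series (fun k => u k.+1 x - u k x)).
  apply: normed_cvg; apply: series_le_cvg dle _ => [n|n|]; [exact: normr_ge0| |].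
    by rewrite /geometric/= mulr_ge0 ?sqrtr_ge0// exprn_ge0// invr_ge0.
  apply: is_cvg_geometric_series.
  by rewrite ger0_norm ?invr_ge0// invf_lt1 ?ltr1n.
have -> : series (fun k => u k.+1 x - u k x) = (fun n => u n x - u 0%N x).
  by apply/funext => n; rewrite /series/= telescope_sumr.
move=> h; have -> : u ^~ x = (fun n => (u n x - u 0%N x) + u 0%N x).
  by apply/funext => n; rewrite subrK.
by apply: is_cvgD => //; exact: is_cvg_cst.
Qed.

Lemma L2_sub f g : L2 mu D f -> L2 mu D g -> L2 mu D (fun x => f x - g x).
Proof.
move=> hf /(L2_scale (-1)) hg.
rewrite (_ : (fun x => _) = (fun x => f x + -1 * g x)); first exact: L2_add.
by apply/funext => x; rewrite mulN1r.
Qed.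

Lemma sqnorm_Re_le f : cmeasurable D f ->
  (\int[mu]_(x in D) (complex.Re (f x) ^+ 2)%:E <= sqnorm mu D f)%E.
Proof.
move=> mf; apply: ge0_le_integral => //.
- by move=> x _; rewrite lee_fin sqr_ge0.
- by apply/measurable_EFinP/measurable_funX; case: mf.
- exact/measurable_EFinP/cmeasurable_sq.
- by move=> x _; rewrite lee_fin normc_sq lerDl sqr_ge0.
Qed.

Lemma sqnorm_Im_le f : cmeasurable D f ->
  (\int[mu]_(x in D) (complex.Im (f x) ^+ 2)%:E <= sqnorm mu D f)%E.
Proof.
move=> mf; apply: ge0_le_integral => //.
- by move=> x _; rewrite lee_fin sqr_ge0.
- by apply/measurable_EFinP/measurable_funX; case: mf.
- exact/measurable_EFinP/cmeasurable_sq.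
- by move=> x _; rewrite lee_fin normc_sq lerDr sqr_ge0.
Qed.

(** Riesz-Fischer: a subsequence with squared increments at most [8^-n] converges almost everywhere,
    real and imaginary parts separately; Fatou's lemma then shows that the whole sequence tends to
    the limit in norm. *)
Lemma L2_complete (u : nat -> T -> R[i]) : (forall n, L2 mu D (u n)) ->
  (forall e : R, 0 < e -> exists N, forall m n, (N <= m)%N -> (N <= n)%N ->
     (sqnorm mu D (fun x => (u m x - u n x)%R) < e%:E)%E) ->
  exists2 f, L2 mu D f & forall e : R, 0 < e -> exists N, forall n, (N <= n)%N ->
     (sqnorm mu D (fun x => (u n x - f x)%R) <= e%:E)%E.
Proof.
move=> L2u cu.
have ex (n : nat) : exists N, forall p q, (N <= p)%N -> (N <= q)%N ->
    (sqnorm mu D (fun x => (u p x - u q x)%R) < (8^-1 ^+ n)%:E)%E.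
  by apply: cu; rewrite exprn_gt0// invr_gt0.
(* The maximum over all earlier thresholds makes [m] monotone; adding [n] makes it unbounded. *)
pose m n := (n + \max_(i < n.+1) projT1 (cid (ex i)))%N.
have m_ge n : (projT1 (cid (ex n)) <= m n)%N 
  by apply: leq_trans (leq_addl _ _); exact: (leq_bigmax (@ord_max n)).
have m_mono n : (m n <= m n.+1)%N.
  by rewrite /m [in leqRHS]big_ord_recr/= leq_add ?leq_maxl.
pose s n := u (m n).
have L2s n : L2 mu D (s n) by exact: L2u.
have Ds n : (sqnorm mu D (fun x => (s n.+1 x - s n x)%R) <= (8^-1 ^+ n)%:E)%E.
  have h := projT2 (cid (ex n)); apply/ltW/h => //.
  exact: leq_trans (m_mono n).
have ms n : cmeasurable D (s n) by case: (L2s n).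
have msub n : cmeasurable D (fun x => s n.+1 x - s n x).
  by case: (L2_sub (L2s n.+1) (L2s n)).
have aeR : {ae mu, forall x, D x -> cvgn (fun n => complex.Re (s n x))}.
  apply: ae_cvg_fast => n; first by case: (ms n).
  apply: le_trans (Ds n); apply: le_trans (sqnorm_Re_le (msub n)).
  by under [leRHS]eq_integral do rewrite raddfB.
have aeI : {ae mu, forall x, D x -> cvgn (fun n => complex.Im (s n x))}.
  apply: ae_cvg_fast => n; first by case: (ms n).
  apply: le_trans (Ds n); apply: le_trans (sqnorm_Im_le (msub n)).
  by under [leRHS]eq_integral do rewrite raddfB.
have : {ae mu, forall x, D x -> cvgn (fun n => complex.Re (s n x)) /\
    cvgn (fun n => complex.Im (s n x))}.
  by move: aeR aeI; apply: filterS2 => x h1 h2 Dx; split; [exact: h1|exact: h2].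
case=> N [mN N0 sub].
have cvgx x : D x -> ~ N x -> cvgn (fun n => complex.Re (s n x)) /\
    cvgn (fun n => complex.Im (s n x)).
  by move=> Dx Nx; apply: contrapT => h; apply: Nx; apply: sub => /(_ Dx).
(* Cutting off the null set [N] makes the sequence converge at every point of [D], from which the
   measurability of the limit is deduced. *)
pose sr n x := \1_(~` N) x * complex.Re (s n x).
pose si n x := \1_(~` N) x * complex.Im (s n x).
have mif (g : T -> R) : measurable_fun D g ->
    measurable_fun D (fun x => \1_(~` N) x * g x).
  by move=> mg; apply: measurable_funM => //; apply: measurable_indic; exact: measurableC.
have indN x : N x -> \1_(~` N) x = 0 :> R.
  by move=> Nx; rewrite indicE memNset//= => /(_ Nx).
have ind1 x : ~ N x -> \1_(~` N) x = 1 :> R by move=> Nx; rewrite indicE mem_set.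
have cr x : D x -> sr ^~ x @ \oo --> limn (sr ^~ x).
  move=> Dx; rewrite /sr; have [xN|xN] := pselect (N x).
    by rewrite indN//; under eq_fun do rewrite mul0r; rewrite lim_cst//; exact: cvg_cst.
  by rewrite ind1//; under eq_fun do rewrite mul1r; have [] := cvgx x Dx xN.
have ci x : D x -> si ^~ x @ \oo --> limn (si ^~ x).
  move=> Dx; rewrite /si; have [xN|xN] := pselect (N x).
    by rewrite indN//; under eq_fun do rewrite mul0r; rewrite lim_cst//; exact: cvg_cst.
  by rewrite ind1//; under eq_fun do rewrite mul1r; have [] := cvgx x Dx xN.
pose f x := limn (sr ^~ x) +i* limn (si ^~ x).
have mf : cmeasurable D f.
  split; [apply: (measurable_fun_cvg _ cr)|apply: (measurable_fun_cvg _ ci)] => n;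
  by apply: mif; case: (ms n).
have mun n : cmeasurable D (u n) by case: (L2u n).
have key e : 0 < e -> exists M, forall n, (M <= n)%N ->
    (sqnorm mu D (fun x => (u n x - f x)%R) <= e%:E)%E.
  move=> e0; have [M hM] := cu e e0; exists M => n Mn.
  have mun_s j : measurable_fun D (fun x => (Normc.normc (u n x - s j x) ^+ 2)%:E).
    by apply/measurable_EFinP/cmeasurable_sq; case: (L2_sub (L2u n) (L2s j)).
  have muf : measurable_fun D (fun x => (Normc.normc (u n x - f x) ^+ 2)%:E).
    apply/measurable_EFinP/cmeasurable_sq.
    rewrite (_ : (fun x => _) = (fun x => u n x + -1 * f x)).
      by apply: cmeasurableD => //; apply: cmeasurableM => //; exact: cmeasurable_cst.
    by apply/funext => x; rewrite mulN1r.
  have fat := fatou mu mD mun_s (fun j x _ => lee_tofin (sqr_ge0 _)).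
  have einf_ge0 x : (0 <= limn_einf (fun j => (Normc.normc (u n x - s j x) ^+ 2)%:E))%E.
    rewrite limn_einf_lim; apply: lime_ge; first exact: is_cvg_einfs.
    by apply: nearW => j; apply: le_ereal_inf_tmp => _ [i _ <-]; rewrite lee_fin sqr_ge0.
  have -> : sqnorm mu D (fun x => u n x - f x) =
      (\int[mu]_(x in D) limn_einf (fun j => (Normc.normc (u n x - s j x) ^+ 2)%:E))%E.
    apply: ge0_ae_eq_integral => //.
    - apply: (emeasurable_fun_cvg (fun k x => einfs (fun j =>
        (Normc.normc (u n x - s j x) ^+ 2)%:E) k)) => [k|x Dx].
        exact: measurable_fun_einfs.
      rewrite limn_einf_lim; exact: is_cvg_einfs.
    - by move=> x Dx; rewrite lee_fin sqr_ge0.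
    - exists N; split => // x /not_implyP[Dx h]; apply: contrapT => Nx; apply: h.
      have lim : (fun j => (Normc.normc (u n x - s j x) ^+ 2)%:E) @ \oo -->
          (Normc.normc (u n x - f x) ^+ 2)%:E.
        apply: cvg_EFin; first exact: nearW.
        rewrite [X in X @ _ --> _](_ : _ = fun j =>
          (complex.Re (u n x) - sr j x) ^+ 2 + (complex.Im (u n x) - si j x) ^+ 2); last first.
          by apply/funext => j; rewrite /= normc_sq !raddfB/= /sr /si ind1// !mul1r.
        rewrite normc_sq !raddfB/=.
        have sqB (v : nat -> R) (l c : R) : v @ \oo --> l ->
            (fun j => (c - v j) ^+ 2) @ \oo --> (c - l) ^+ 2.
          by move=> vl; apply: cvgM; apply: cvgB => //; exact: cvg_cst.
        by apply: cvgD; apply: sqB; [exact: cr|exact: ci].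
      by rewrite is_cvg_limn_einfE ?(cvg_lim _ lim)//; apply/cvg_ex; eexists; exact: lim.
  apply: le_trans fat _; rewrite limn_einf_lim; apply: lime_le; first exact: is_cvg_einfs.
  apply: nearW => j; apply: le_trans (ltW (hM n (m (maxn j M)) Mn _)); last first.
    by rewrite /m (leq_trans (leq_maxr j M))// leq_addr.
  by apply: ereal_inf_lbound; exists (maxn j M) => //=; exact: leq_maxl.
exists f => //.
have [M hM] := key 1 ltr01.
(* [f] is square integrable as the difference of [u M] and [u M - f], the latter of squared norm at
   most 1. *)
have hf : L2 mu D (fun x => u M x - f x).
  split; last by rewrite (le_lt_trans (hM M (leqnn M)))// ltry.
  rewrite (_ : (fun x => _) = (fun x => u M x + -1 * f x)).
    by apply: cmeasurableD => //; apply: cmeasurableM => //; exact: cmeasurable_cst.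
  by apply/funext => x; rewrite mulN1r.
have := L2_sub (L2u M) hf.
rewrite (_ : (fun x => _) = f)//; apply/funext => x.
by rewrite opprB addrC subrK.
Qed.

End L2.

(* The proof that [D] is measurable is a parameter of the type because the
   algebraic structure below depends on it. *)
Section L2Space.
Context d (T : measurableType d) (R : realType).
Variables (mu : {measure set T -> \bar R}) (D : set T).
Variable mD : measurable D.

Definition L2pred of measurable D : {pred (T -> R[i])} := mem [set f | L2 mu D f].

Record L2space (mD' : measurable D) :=
  MkL2 { L2fun :> T -> R[i]; _ : L2fun \in L2pred mD' }.

HB.instance Definition _ := [isSub of L2space mD for @L2fun mD].
HB.instance Definition _ := [Choice of L2space mD by <:].

Lemma L2pred_submod : GRing.submod_closed (L2pred mD).
Proof.
split; first by rewrite inE; exact: L2_zero.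
move=> c f g; rewrite !inE => hf hg.
exact: (L2_add mD (L2_scale mD c hf) hg).
Qed.

HB.instance Definition _ :=
  GRing.isSubmodClosed.Build R[i] (T -> R[i]) (L2pred mD) L2pred_submod.
HB.instance Definition _ := [SubChoice_isSubLmodule of L2space mD by <:].

Lemma L2funP (f : L2space mD) : L2 mu D f.
Proof. by case: f => f /=; rewrite inE. Qed.

Lemma L2space_ip_sub (f g : L2space mD) :
  sqnorm mu D (fun x => f x - g x) = (rip mu D (f - g : L2space mD) (f - g : L2space mD))%:E.
Proof. by rewrite -rip_sqnorm//; exact: L2funP. Qed.

Lemma L2space_complete (u : nat -> L2space mD) :
  (forall e : R, 0 < e -> exists N, forall m n, (N <= m)%N -> (N <= n)%N ->
    rip mu D (u m - u n : L2space mD) (u m - u n : L2space mD) < e) ->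
  exists x : L2space mD,
    (fun n => rip mu D (u n - x : L2space mD) (u n - x : L2space mD)) @ \oo --> (0 : R).
Proof.
move=> cu; have [n|e /cu[N hN]|f L2f hf] := @L2_complete _ T R mu D mD u.
- exact: L2funP.
- by exists N => m n Nm Nn; rewrite L2space_ip_sub lte_fin hN.
have mf : f \in L2pred mD by rewrite inE.
exists (MkL2 mf); apply/cvgr0Pnorm_le => e e0.
have [N hN] := hf e e0; exists N => // n /= /hN.
rewrite -[f]/(L2fun (MkL2 mf)) L2space_ip_sub lee_fin ger0_norm//.
by rewrite -lee_fin -L2space_ip_sub sqnorm_ge0.
Qed.

Lemma L2space_ipDl (f g h : L2space mD) :
  rip mu D (f + g : L2space mD) h = rip mu D f h + rip mu D g h.
Proof. by apply: ripDl => //; exact: L2funP. Qed.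

Lemma L2space_ipZl (a : R) (f g : L2space mD) :
  rip mu D (a%:C *: f : L2space mD) g = a * rip mu D f g.
Proof. by apply: ripZl => //; exact: L2funP. Qed.

Lemma L2space_ip_ge0 (f : L2space mD) : 0 <= rip mu D f f.
Proof. by rewrite -lee_fin -rip_sqnorm ?sqnorm_ge0//; exact: L2funP. Qed.

HB.instance Definition _ := isSemiHilbert.Build R (L2space mD)
  (fun f g => ripC mu D f g) L2space_ipDl L2space_ipZl
  (fun f g => ripI mu D f g) L2space_ip_ge0 L2space_complete.

Implicit Types f g : L2space mD.

Lemma L2spaceD f g x : (f + g : L2space mD) x = f x + g x.
Proof. by []. Qed.

Lemma L2spaceB f g x : (f - g : L2space mD) x = f x - g x.
Proof. by []. Qed.

Lemma L2spaceZ c f x : (c *: f : L2space mD) x = c * f x.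
Proof. by []. Qed.

Lemma L2space_sum I (r : seq I) (P : pred I) (F : I -> L2space mD) x :
  (\sum_(i <- r | P i) F i) x = \sum_(i <- r | P i) F i x.
Proof. by elim/big_rec2 : _ => // i a b _ <-. Qed.

Lemma ipE f g : ip f g = Rintegral mu D (rprod f g).
Proof. by rewrite -[LHS]/(rip mu D f g) unlock. Qed.

Lemma L2space_ext f g : (forall x, f x = g x) -> f = g.
Proof. by move=> fg; apply/val_inj/funext. Qed.

Lemma sqnorm_nm f : sqnorm mu D f = (nm f ^+ 2)%:E.
Proof. by rewrite nm_sq; apply: rip_sqnorm => //; exact: L2funP. Qed.

Lemma aeq_ae f g : aeq f g <-> ae_eq_in mu D f g.
Proof.
have [mf _] := L2funP (f - g).
split=> [fg|fg].
  have : sqnorm mu D (f - g) = 0%E by rewrite sqnorm_nm fg expr0n.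
  move=> /(sqnorm_eq0 mD mf); apply: filterS => x /= h Dx.
  by apply/eqP; rewrite -subr_eq0; apply/eqP/h.
have : sqnorm mu D (f - g) = sqnorm mu D (fun=> 0).
  apply: (eq_sqnorm mD mf (@cmeasurable_cst _ T R D 0)).
  by move: fg; apply: filterS => x /= h Dx; apply/eqP; rewrite subr_eq0; apply/eqP/h.
rewrite sqnorm_nm -[(fun=> 0)]/(L2fun (0 : L2space mD)) sqnorm_nm nm0 expr0n/=.
by move=> [] /eqP; rewrite sqrf_eq0 => /eqP.
Qed.

Lemma L2_cvgP (u : nat -> L2space mD) f : L2_cvg mu D u f <-> Hcvg u f.
Proof.
rewrite /L2_cvg /Hcvg.
have -> : (fun n => sqnorm mu D (fun x => u n x - f x)) = EFin \o (fun n => nm (u n - f) ^+ 2).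
  by apply/funext => n /=; rewrite -sqnorm_nm.
split => h.
  have /fine_cvg : (EFin \o (fun n => nm (u n - f) ^+ 2)) @ \oo --> (0%R)%:E by [].
  move=> {}h; apply/cvgr0Pnorm_lt => e e0.
  have [N _ hN] := (cvgr0Pnorm_lt _).1 h (e ^+ 2) (exprn_gt0 2 e0).
  exists N => // n /hN /=; rewrite ger0_norm ?sqr_ge0// ger0_norm ?nm_ge0//.
  by rewrite ltr_pXn2r// ?nnegrE ?nm_ge0// ltW.
apply: cvg_EFin; first exact: nearW.
rewrite (_ : fine \o _ = (fun n => nm (u n - f) * nm (u n - f)))//.
by rewrite -(mulr0 0); apply: cvgM.
Qed.

(* Junk value [0] when [f] is not square integrable. *)
Definition toL2 (F : T -> R[i]) : L2space mD :=
  if pselect (L2 mu D F) is left hF then MkL2 (mem_set hF : F \in L2pred mD) else 0.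

Lemma toL2E F : L2 mu D F -> toL2 F = F :> (T -> R[i]).
Proof. by rewrite /toL2; case: pselect. Qed.

Lemma toL2_val f : toL2 f = f.
Proof. by apply/val_inj => /=; rewrite toL2E//; exact: L2funP. Qed.

Lemma toL2_lin c F G : L2 mu D F -> L2 mu D G ->
  toL2 (fun x => c * F x + G x) = c *: toL2 F + toL2 G.
Proof.
move=> hF hG; apply/val_inj => /=; rewrite toL2E; last first.
  by apply: L2_add => //; exact: L2_scale.
by rewrite -[F in LHS](toL2E hF) -[G in LHS](toL2E hG).
Qed.

End L2Space.

(** * Test functions on the disc *)

Section Plane.
Variable R : realType.
Local Notation plane := (R * R)%type.
Local Notation mR := (measurableTypeR R).
Local Notation mplane := (mR * mR)%type.
Implicit Types (F G : plane -> R) (z w : plane).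

(** The plane carries the product sigma-algebra; an open set belongs to it as a union of boxes with
    rational centre and radius, of which there are countably many. *)
Lemma open_plane_measurable (U : set plane) : open U -> measurable (U : set mplane).
Proof.
move=> oU.
pose box (q : rat * rat * rat) : set plane :=
  ball (ratr q.1.1 : R) (ratr q.2 : R) `*` ball (ratr q.1.2 : R) (ratr q.2 : R).
have -> : U = \bigcup_q (if `[< box q `<=` U >] then box q else set0).
  apply/seteqP; split => [z Uz|z [q _]]; last by case: asboolP => // h; exact: h.
  have /nbhs_ballP[e /= e0 he] := open_nbhs_nbhs (conj oU Uz).
  have e3 : 0 < e / 3 by rewrite divr_gt0.
  have e2 : e / 3 < e / 2 by lra.
  have [r] := rat_in_itvoo e2; rewrite in_itv/= => /andP[r1 r2].
  have [p] := @rat_in_itvoo _ (z.1 - e / 3) (z.1 + e / 3) (ltac:(lra)).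
  rewrite in_itv/= => /andP[p1 p2].
  have [q] := @rat_in_itvoo _ (z.2 - e / 3) (z.2 + e / 3) (ltac:(lra)).
  rewrite in_itv/= => /andP[q1 q2].
  have bz : box ((p, q), r) z.
    by split; rewrite /ball/= ltr_norml; apply/andP; split; lra.
  exists ((p, q), r) => //; case: asboolP => // h; exfalso; apply: h.
  move=> w [w1 w2]; apply: he; move: w1 w2.
  rewrite /ball/= !ltr_norml => /andP[w1 w1'] /andP[w2 w2'].
  by split; rewrite /ball/= ltr_norml; apply/andP; split; lra.
apply: countable_bigcupT_measurable; first exact: countableP.
move=> q; case: asboolP => // _; apply: measurableX; exact: measurable_ball.
Qed.

Lemma continuous_plane_measurable F : continuous F ->
  measurable_fun setT (F : mplane -> mR).
Proof.
move=> cF; apply: (measurability _ (RGenOpens.measurableE R)).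
move=> _ [_ [a [b ->] <-]]; rewrite setTI.
apply: open_plane_measurable.
by move/continuousP: cF; apply; exact: interval_open.
Qed.

Lemma continuous_fst : continuous (fst : plane -> R).
Proof. by move=> z; exact: cvg_fst. Qed.

Lemma continuous_snd : continuous (snd : plane -> R).
Proof. by move=> z; exact: cvg_snd. Qed.

Lemma continuous_sqnorm : continuous (fun z : plane => z.1 ^+ 2 + z.2 ^+ 2).
Proof.
move=> z; apply: cvgD; apply: cvgM;
  (exact: continuous_fst || exact: continuous_snd).
Qed.

Lemma closed_disc : closed (@disc R).
Proof.
apply: (@preimage_closed _ _ (fun z : plane => z.1 ^+ 2 + z.2 ^+ 2) [set x | x <= 1]).
  by move=> z _; exact: continuous_sqnorm.
exact: closed_le.
Qed.

Lemma measurable_disc : measurable (@disc R : set mplane).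
Proof.
rewrite -(setCK (@disc R)); apply: measurableC; apply: open_plane_measurable.
by rewrite openC; exact: closed_disc.
Qed.

Lemma disc_square : @disc R `<=` `[-1, 1]%classic `*` `[-1, 1]%classic.
Proof.
move=> z /= h; rewrite !in_itv/= -!ler_norml -![_ <= 1](@ler_pXn2r _ 2) ?nnegrE//.
rewrite !real_normK ?num_real// expr1n.
by have := sqr_ge0 z.1; have := sqr_ge0 z.2; move: h; rewrite /disc/= => *; split; lra.
Qed.

Lemma compact_disc : compact (@disc R).
Proof.
apply: subclosed_compact disc_square; first exact: closed_disc.
by apply: compact_setX; exact: segment_compact.
Qed.

Lemma area_disc_lty : (area R (@disc R) < +oo)%E.
Proof.
pose I : set R := `[-1, 1]%classic.
apply: (@le_lt_trans _ _ (area R (I `*` I))).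
  apply: le_measure; rewrite ?inE; [exact: measurable_disc| |exact: disc_square].
  by apply: measurableX; exact: measurable_itv.
have -> : area R (I `*` I) = (lebesgue_measure I * lebesgue_measure I)%E.
  by apply: product_measure1E; exact: measurable_itv.
have : (lebesgue_measure I < +oo)%E.
  by rewrite /I lebesgue_measure_itv/=; case: ifP => _; rewrite -?EFinD ltry.
by move=> h; apply: lte_mul_pinfty; rewrite ?ge0_fin_numE.
Qed.

Lemma bounded_on_disc F : continuous F -> exists M, forall z, disc z -> `|F z| <= M.
Proof.
move=> cF; have : compact (F @` @disc R).
  by apply: continuous_compact compact_disc; exact: continuous_subspaceT.
move=> /compact_bounded[M [_ hM]]; exists (M + 1) => z dz.
by apply: (hM (M + 1)); [rewrite ltrDl|exists z].
Qed.

Lemma integrable_disc F : continuous F -> (area R).-integrable (@disc R) (EFin \o F).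
Proof.
move=> cF; have [M hM] := bounded_on_disc cF.
apply: measurable_bounded_integrable => //.
- exact: measurable_disc.
- exact: area_disc_lty.
- by apply: measurable_funS (continuous_plane_measurable cF).
- by exists M; split; [exact: num_real|move=> x Mx z dz; exact: (le_trans (hM z dz) (ltW Mx))].
Qed.

Lemma integrable_plane F : continuous F -> (forall z, ~ disc z -> F z = 0) ->
  (area R).-integrable setT (EFin \o F).
Proof.
move=> cF F0; have := integrable_disc cF.
move/(integrable_mkcond _ measurable_disc); congr (integrable _ _ _).
apply/funext => z; rewrite /patch; case: ifPn => // /negP zd.
by rewrite /= F0// => dz; apply: zd; rewrite inE.
Qed.

Lemma Rintegral_disc_plane F : (forall z, ~ disc z -> F z = 0) ->
  Rintegral (area R) (@disc R) F = Rintegral (area R) setT F.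
Proof.
move=> F0; rewrite Rintegral_mkcond; congr Rintegral.
apply/funext => z; rewrite /patch; case: ifPn => // /negP zd.
by rewrite F0// => dz; apply: zd; rewrite inE.
Qed.

Lemma derive_off_disc F v z : (forall z, ~ disc z -> F z = 0) -> ~ disc z -> 'D_v F z = 0.
Proof.
move=> F0 dz; rewrite -(derive_cst (0 : R) z v); apply: near_eq_derive.
have oC : open (~` @disc R) by rewrite openC; exact: closed_disc.
by apply: filterS (open_nbhs_nbhs (conj oC dz)) => w; exact: F0.
Qed.

Lemma derivable_fst_line F x y :
  differentiable F (x, y) -> is_derive x 1 (fun t => F (t, y)) ('D_(1, 0) F (x, y)).
Proof.
move=> dF; have dv : derivable F (x, y) (1, 0) by exact: diff_derivable.
have E : (fun h : R => h^-1 *: (F (h *: (1 : R) + x, y) - F (x, y))) =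
         (fun h : R => h^-1 *: (F (h *: ((1, 0) : plane) + (x, y)) - F (x, y))).
  by apply/funext => h; congr (_ *: (F _ - _)); congr pair; rewrite /= ?mulr0 ?scaler0 ?add0r.
split; first by rewrite /derivable /= E.
by rewrite /derive /= E.
Qed.

Lemma derivable_snd_line F x y :
  differentiable F (x, y) -> is_derive y 1 (fun t => F (x, t)) ('D_(0, 1) F (x, y)).
Proof.
move=> dF; have dv : derivable F (x, y) (0, 1) by exact: diff_derivable.
have E : (fun h : R => h^-1 *: (F (x, h *: (1 : R) + y) - F (x, y))) =
         (fun h : R => h^-1 *: (F (h *: ((0, 1) : plane) + (x, y)) - F (x, y))).
  by apply/funext => h; congr (_ *: (F _ - _)); congr pair; rewrite /= ?mulr0 ?scaler0 ?add0r.
split; first by rewrite /derivable /= E.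
by rewrite /derive /= E.
Qed.

Lemma integral_derive_line (f g : R -> R) : (forall x : R, is_derive x (1 : R) f (g x)) -> continuous g ->
  (forall x, 1 < `|x| -> f x = 0) -> (forall x, 1 < `|x| -> g x = 0) ->
  (\int[lebesgue_measure]_x (g x)%:E = 0)%E.
Proof.
move=> df cg f0 g0.
(* Vanishing is known only where [1 < |x|], not at 1 and -1 themselves, hence the larger interval
   from -2 to 2. *)
have -> : (\int[lebesgue_measure]_x (g x)%:E = \int[lebesgue_measure]_(x in `[(-2 : R)%R, 2%R]) (g x)%:E)%E.
  rewrite [RHS]integral_mkcond; apply: eq_integral => x _; rewrite /patch.
  case: ifPn => // /negP; rewrite inE/= in_itv/= -ler_norml => /negP; rewrite -ltNge => h.
  by rewrite g0//; lra.
have cf x : {for x, continuous f}.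
  by apply: differentiable_continuous; apply/derivable1_diffP; case: (df x).
rewrite (@continuous_FTC2 _ g f)//.
- by rewrite !f0 ?subee// ?normrN ger0_norm//; lra.
- by lra.
- exact: continuous_subspaceT.
- split.
  + by move=> x _; case: (df x).
  + by apply: cvg_at_right_filter; exact: cf.
  + by apply: cvg_at_left_filter; exact: cf.
- by move=> x _; rewrite derive1E; case: (df x).
Qed.

Lemma disc_fst_le z : disc z -> `|z.1| <= 1.
Proof. by move=> /disc_square[] /=; rewrite in_itv/= -ler_norml. Qed.

Lemma disc_snd_le z : disc z -> `|z.2| <= 1.
Proof. by move=> /disc_square[_] /=; rewrite in_itv/= -ler_norml. Qed.

Lemma continuous_line1 G y : continuous G -> continuous (fun x => G (x, y)).
Proof.
move=> cG x; apply: (@continuous_comp _ _ _ (fun x => (x, y)) G); last exact: cG.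
by apply: (@cvg_pair _ _ _ _ (nbhs x) (nbhs y)); [exact: cvg_id|exact: cvg_cst].
Qed.

Lemma continuous_line2 G x : continuous G -> continuous (fun y => G (x, y)).
Proof.
move=> cG y; apply: (@continuous_comp _ _ _ (fun y => (x, y)) G); last exact: cG.
by apply: (@cvg_pair _ _ _ _ (nbhs x) (nbhs y)); [exact: cvg_cst|exact: cvg_id].
Qed.

Lemma integral_dx F : (forall z, differentiable F z) ->
  continuous (fun z => 'D_(1, 0) F z) -> (forall z, ~ disc z -> F z = 0) ->
  Rintegral (area R) (@disc R) (fun z => 'D_(1, 0) F z) = 0.
Proof.
move=> dF cG F0; have G0 z : ~ disc z -> 'D_(1, 0) F z = 0 by exact: derive_off_disc.
rewrite Rintegral_disc_plane// /Rintegral /area.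
rewrite -integral21_prod_meas1; last exact: integrable_plane cG G0.
rewrite integral0_eq// => y _; apply: (@integral_derive_line (fun x => F (x, y))).
- by move=> x; exact: derivable_fst_line.
- exact: continuous_line1 cG.
- by move=> x x1; rewrite F0// => /disc_fst_le /=; lra.
- by move=> x x1; rewrite G0// => /disc_fst_le /=; lra.
Qed.

Lemma integral_dy F : (forall z, differentiable F z) ->
  continuous (fun z => 'D_(0, 1) F z) -> (forall z, ~ disc z -> F z = 0) ->
  Rintegral (area R) (@disc R) (fun z => 'D_(0, 1) F z) = 0.
Proof.
move=> dF cG F0; have G0 z : ~ disc z -> 'D_(0, 1) F z = 0 by exact: derive_off_disc.
rewrite Rintegral_disc_plane// /Rintegral /area.
rewrite -integral12_prod_meas1; last exact: integrable_plane cG G0.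
rewrite integral0_eq// => x _; apply: (@integral_derive_line (fun y => F (x, y))).
- by move=> y; exact: derivable_snd_line.
- exact: continuous_line2 cG.
- by move=> y y1; rewrite F0// => /disc_snd_le /=; lra.
- by move=> y y1; rewrite G0// => /disc_snd_le /=; lra.
Qed.

Lemma Rintegral_discD F G : continuous F -> continuous G ->
  Rintegral (area R) (@disc R) (fun z => F z + G z) =
  Rintegral (area R) (@disc R) F + Rintegral (area R) (@disc R) G.
Proof.
by move=> cF cG; rewrite -RintegralD//; [exact: measurable_disc|exact: integrable_disc..].
Qed.

Lemma Rintegral_discZ c F : continuous F ->
  Rintegral (area R) (@disc R) (fun z => c * F z) = c * Rintegral (area R) (@disc R) F.
Proof.
by move=> cF; rewrite -RintegralZl//; [exact: measurable_disc|exact: integrable_disc].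
Qed.

(** It suffices that one factor vanishes off the disc: then the product does, and its derivative
    integrates to zero. *)
Lemma integration_by_parts_x F G : (forall z, differentiable F z) -> (forall z, differentiable G z) ->
  continuous (fun z => 'D_(1, 0) F z) -> continuous (fun z => 'D_(1, 0) G z) ->
  (forall z, ~ disc z -> F z = 0) ->
  Rintegral (area R) (@disc R) (fun z => F z * 'D_(1, 0) G z) =
  - Rintegral (area R) (@disc R) (fun z => 'D_(1, 0) F z * G z).
Proof.
move=> dF dG cF' cG' F0.
have cF : continuous F by move=> z; exact: differentiable_continuous.
have cG : continuous G by move=> z; exact: differentiable_continuous.
have E : (fun z => 'D_(1, 0) (F * G) z) = (fun z => F z * 'D_(1, 0) G z + 'D_(1, 0) F z * G z).
  apply/funext => z; rewrite deriveM; [|exact: diff_derivable..].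
  by congr (_ + _); rewrite /GRing.scale/= mulrC.
have c1 : continuous (fun z => F z * 'D_(1, 0) G z) by move=> z; apply: cvgM; [exact: cF|exact: cG'].
have c2 : continuous (fun z => 'D_(1, 0) F z * G z) by move=> z; apply: cvgM; [exact: cF'|exact: cG].
apply/eqP; rewrite -addr_eq0 -Rintegral_discD// -E; apply/eqP; apply: integral_dx.
- by move=> z; exact: differentiableM.
- by rewrite E => z; apply: cvgD; [exact: c1|exact: c2].
- by move=> z dz; rewrite /GRing.mul/= F0// mul0r.
Qed.

Lemma integration_by_parts_y F G : (forall z, differentiable F z) -> (forall z, differentiable G z) ->
  continuous (fun z => 'D_(0, 1) F z) -> continuous (fun z => 'D_(0, 1) G z) ->
  (forall z, ~ disc z -> F z = 0) ->
  Rintegral (area R) (@disc R) (fun z => F z * 'D_(0, 1) G z) =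
  - Rintegral (area R) (@disc R) (fun z => 'D_(0, 1) F z * G z).
Proof.
move=> dF dG cF' cG' F0.
have cF : continuous F by move=> z; exact: differentiable_continuous.
have cG : continuous G by move=> z; exact: differentiable_continuous.
have E : (fun z => 'D_(0, 1) (F * G) z) = (fun z => F z * 'D_(0, 1) G z + 'D_(0, 1) F z * G z).
  apply/funext => z; rewrite deriveM; [|exact: diff_derivable..].
  by congr (_ + _); rewrite /GRing.scale/= mulrC.
have c1 : continuous (fun z => F z * 'D_(0, 1) G z) by move=> z; apply: cvgM; [exact: cF|exact: cG'].
have c2 : continuous (fun z => 'D_(0, 1) F z * G z) by move=> z; apply: cvgM; [exact: cF'|exact: cG].
apply/eqP; rewrite -addr_eq0 -Rintegral_discD// -E; apply/eqP; apply: integral_dy.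
- by move=> z; exact: differentiableM.
- by rewrite E => z; apply: cvgD; [exact: c1|exact: c2].
- by move=> z dz; rewrite /GRing.mul/= F0// mul0r.
Qed.

(** The common value [c] may change with [e]. For mixed derivatives it is a second difference
    quotient over a small square; for the orthogonality of weak derivatives it is 0. *)
Lemma eq_of_common_approx (a b : R) :
  (forall e, 0 < e -> exists c, `|a - c| < e / 2 /\ `|b - c| < e / 2) -> a = b.
Proof.
move=> h; apply/eqP; rewrite -subr_eq0 -normr_le0; apply/ler_addgt0Pr => e e0.
have [c [ac bc]] := h e e0; rewrite add0r -(subrK c a) -addrA.
rewrite (le_trans (ler_normD _ _))// (splitr e) lerD// ?ltW//.
by rewrite distrC.
Qed.

(* Both mixed derivatives are values of the second difference over small
   squares divided by the area of the square. *)
Lemma mixed_derivatives F z : (forall z, differentiable F z) ->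
  (forall z, differentiable (fun w => 'D_(1, 0) F w) z) ->
  (forall z, differentiable (fun w => 'D_(0, 1) F w) z) ->
  continuous (fun w => 'D_(0, 1) (fun w => 'D_(1, 0) F w) w) ->
  continuous (fun w => 'D_(1, 0) (fun w => 'D_(0, 1) F w) w) ->
  'D_(0, 1) (fun w => 'D_(1, 0) F w) z = 'D_(1, 0) (fun w => 'D_(0, 1) F w) z.
Proof.
move: z => [x y] dF dFx dFy cxy cyx.
set A := fun w => _ in cxy; set B := fun w => _ in cyx.
apply: eq_of_common_approx => e e0.
have e2 : 0 < e / 2 by rewrite divr_gt0.
have /cvgrPdist_lt/(_ _ e2)/nbhs_ballP[d1 /= d10 h1] := cxy (x, y).
have /cvgrPdist_lt/(_ _ e2)/nbhs_ballP[d2 /= d20 h2] := cyx (x, y).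
pose h := Num.min d1 d2 / 2.
have h0 : 0 < h by rewrite divr_gt0// lt_min d10.
have hd1 : h < d1.
  by rewrite ltr_pdivrMr// (le_lt_trans (_ : _ <= d1)) ?ge_min ?lexx// ltr_pMr// ltr1n.
have hd2 : h < d2.
  by rewrite ltr_pdivrMr// (le_lt_trans (_ : _ <= d2)) ?ge_min ?lexx ?orbT// ltr_pMr// ltr1n.
pose Q := F (x + h, y + h) - F (x + h, y) - F (x, y + h) + F (x, y).
have xh : x < x + h by rewrite ltrDl.
have yh : y < y + h by rewrite ltrDl.
(* The mean value theorem is applied in [x] to the increment of [F] in [y], then in [y]; for [B] the
   variables are exchanged. *)
have [c1 c1i [c2 c2i Q1]] : exists2 c1, c1 \in `]x, x + h[ & exists2 c2, c2 \in `]y, y + h[ & Q = A (c1, c2) * h * h.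
  have [| |c ci E] := @MVT R (fun t => F (t, y + h) - F (t, y)) (fun t => 'D_(1, 0) F (t, y + h) - 'D_(1, 0) F (t, y)) _ _ xh.
  - by move=> t _; apply: is_deriveB; exact: derivable_fst_line.
  - apply: continuous_subspaceT => t.
    by apply: cvgB; apply: continuous_line1 => w; exact: differentiable_continuous.
  have [| |c' c'i E'] := @MVT R (fun t => 'D_(1, 0) F (c, t)) (fun t => A (c, t)) _ _ yh.
  - by move=> t _; exact: derivable_snd_line.
  - apply: continuous_subspaceT; apply: (@continuous_line2 (fun w => 'D_(1, 0) F w)) => w.
    exact: differentiable_continuous.
  exists c; first exact: ci.
  exists c'; first exact: c'i.
  move: E; rewrite E' /Q => E.
  transitivity (F (x + h, y + h) - F (x + h, y) - (F (x, y + h) - F (x, y))); first by ring.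
  by rewrite E; ring.
have [k1 k1i [k2 k2i Q2]] : exists2 c1, c1 \in `]x, x + h[ & exists2 c2, c2 \in `]y, y + h[ & Q = B (c1, c2) * h * h.
  have [| |c ci E] := @MVT R (fun t => F (x + h, t) - F (x, t)) (fun t => 'D_(0, 1) F (x + h, t) - 'D_(0, 1) F (x, t)) _ _ yh.
  - by move=> t _; apply: is_deriveB; exact: derivable_snd_line.
  - apply: continuous_subspaceT => t.
    by apply: cvgB; apply: continuous_line2 => w; exact: differentiable_continuous.
  have [| |c' c'i E'] := @MVT R (fun t => 'D_(0, 1) F (t, c)) (fun t => B (t, c)) _ _ xh.
  - by move=> t _; exact: derivable_fst_line.
  - apply: continuous_subspaceT; apply: (@continuous_line1 (fun w => 'D_(0, 1) F w)) => w.
    exact: differentiable_continuous.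
  exists c'; first exact: c'i.
  exists c; first exact: ci.
  move: E; rewrite E' /Q => E.
  transitivity (F (x + h, y + h) - F (x, y + h) - (F (x + h, y) - F (x, y))); first by ring.
  by rewrite E; ring.
have quot (a b : R) : Q = a * h * h -> Q = b * h * h -> a = b.
  move=> -> E; have hn : h != 0 by rewrite gt_eqF.
  exact: (mulIf hn (mulIf hn E)).
have AB : A (c1, c2) = B (k1, k2) by exact: quot Q1 Q2.
have n1 : `|A (x, y) - A (c1, c2)| < e / 2.
  apply: h1; move: c1i c2i; rewrite !in_itv/= => /andP[? ?] /andP[? ?].
  by split; rewrite /ball/= ltr_norml; apply/andP; split; lra.
have n2 : `|B (x, y) - B (k1, k2)| < e / 2.
  apply: h2; move: k1i k2i; rewrite !in_itv/= => /andP[? ?] /andP[? ?].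
  by split; rewrite /ball/= ltr_norml; apply/andP; split; lra.
by exists (A (c1, c2)); split; [exact: n1|rewrite AB; exact: n2].
Qed.

End Plane.

Section TestFunctions.
Variable R : realType.
Local Notation plane := (R * R)%type.
Local Notation C := R[i].
Implicit Types (F G : plane -> R) (phi psi : plane -> C) (z : plane).

Lemma derive_lin_pt (a b : R) F G v z : derivable F z v -> derivable G z v ->
  'D_v (fun z => a * F z + b * G z) z = a * 'D_v F z + b * 'D_v G z.
Proof.
move=> dF dG; change ('D_v ((a \*: F) + (b \*: G)) z = a * 'D_v F z + b * 'D_v G z).
by rewrite (deriveD (@derivableZ _ _ _ F a _ _ dF) (@derivableZ _ _ _ G b _ _ dG))
  (deriveZ _ dF) (deriveZ _ dG).
Qed.

Lemma Cn_lin n (a b : R) F G : Cn n F -> Cn n G -> Cn n (fun z => a * F z + b * G z).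
Proof.
elim: n F G => [|n IH] F G /=.
  move=> cF cG z; apply: cvgD; apply: cvgM; [exact: cvg_cst|exact: cF|exact: cvg_cst|exact: cG].
move=> [dF cF1 cF2] [dG cG1 cG2].
have D v : (fun z => 'D_v (fun z => a * F z + b * G z) z) = (fun z => a * 'D_v F z + b * 'D_v G z).
  by apply/funext => z; apply: derive_lin_pt; apply: diff_derivable; [exact: dF|exact: dG].
split; rewrite ?D; [|exact: (IH _ _ cF1 cG1)|exact: (IH _ _ cF2 cG2)].
move=> z; change (differentiable ((a \*: F) + (b \*: G)) z).
by apply: differentiableD; apply: differentiableZ; [exact: dF|exact: dG].
Qed.

Lemma Cn_cst0 n : Cn n (fun=> 0 : R).
Proof.
elim: n => [|n IH] /=; first by move=> z; exact: cvg_cst.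
have E v : (fun z : plane => 'D_v (fun=> 0 : R) z) = (fun=> 0).
  by apply/funext => z; exact: derive_cst.
by rewrite !E; split => // z; exact: differentiable_cst.
Qed.

Definition rsmooth F := forall n, Cn n F.

Lemma rsmooth_diff F z : rsmooth F -> differentiable F z.
Proof. by move=> h; case: (h 1%N). Qed.

Lemma rsmooth_cont F : rsmooth F -> continuous F.
Proof. by move=> h; exact: (h 0%N). Qed.

Lemma rsmooth_dx F : rsmooth F -> rsmooth (fun z => 'D_(1, 0) F z).
Proof. by move=> h n; case: (h n.+1). Qed.

Lemma rsmooth_dy F : rsmooth F -> rsmooth (fun z => 'D_(0, 1) F z).
Proof. by move=> h n; case: (h n.+1). Qed.

Definition supported (K : set plane) phi := forall z, ~ K z -> phi z = 0.

(** An arbitrary compact set inside the disc in place of the closure of the set where [phi] is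
    nonzero makes the stability of test functions under sums, conjugation and derivatives
    immediate. *)
Lemma test_functionP phi : test_function phi <-> smooth phi /\
  exists K, [/\ compact K, K `<=` interior (@disc R) & supported K phi].
Proof.
split=> [[sm cK Kd]|[sm [K [cK Kd K0]]]].
  split => //; exists (closure [set z | phi z != 0]); split => // z zK.
  by apply: contrapT => /eqP h; apply: zK; exact: subset_closure.
have clK : closed K by apply: compact_closed => //; exact: norm_hausdorff.
have sub : closure [set z | phi z != 0] `<=` K.
  move/closure_id : clK => ->; apply: closure_subset => z /= /eqP h.
  by apply: contrapT => /K0.
split => //; last exact: subset_trans sub Kd.
by apply: subclosed_compact sub => //; exact: closed_closure.
Qed.

Lemma test_off_disc phi z : test_function phi -> ~ disc z -> phi z = 0.
Proof.
move=> /test_functionP[_ [K [_ Kd K0]]] dz; apply: K0 => Kz; apply: dz.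
exact: (interior_subset (Kd _ Kz)).
Qed.

Lemma smooth_Re phi : smooth phi -> rsmooth (fun z => complex.Re (phi z)).
Proof. by move=> h n; case: (h n). Qed.

Lemma smooth_Im phi : smooth phi -> rsmooth (fun z => complex.Im (phi z)).
Proof. by move=> h n; case: (h n). Qed.

Lemma test_smooth phi : test_function phi -> smooth phi.
Proof. by case. Qed.

Lemma test_Re phi : test_function phi -> rsmooth (fun z => complex.Re (phi z)).
Proof. by case => /smooth_Re. Qed.

Lemma test_Im phi : test_function phi -> rsmooth (fun z => complex.Im (phi z)).
Proof. by case => /smooth_Im. Qed.

Lemma smooth_lin c phi psi : smooth phi -> smooth psi -> smooth (fun z => c * phi z + psi z).
Proof.
move=> sp sq n; have [p1 p2] := sp n; have [q1 q2] := sq n.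
have E : (fun z => complex.Re (c * phi z + psi z)) = (fun z => 1 *
    (complex.Re c * complex.Re (phi z) + - complex.Im c * complex.Im (phi z)) + 1 * complex.Re (psi z)).
  by apply/funext => z; rewrite raddfD/= cReM; ring.
have E' : (fun z => complex.Im (c * phi z + psi z)) = (fun z => 1 *
    (complex.Re c * complex.Im (phi z) + complex.Im c * complex.Re (phi z)) + 1 * complex.Im (psi z)).
  by apply/funext => z; rewrite raddfD/= cImM; ring.
by rewrite E E'; split; apply: Cn_lin => //; apply: Cn_lin.
Qed.

Lemma test_lin c phi psi : test_function phi -> test_function psi ->
  test_function (fun z => c * phi z + psi z).
Proof.
move=> /test_functionP[sp [K [cK Kd K0]]] /test_functionP[sq [K' [cK' Kd' K0']]].
apply/test_functionP; split; first exact: smooth_lin.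
exists (K `|` K'); split; first exact: compactU.
  by move=> z [/Kd|/Kd'].
by move=> z /not_orP[/K0 -> /K0' ->]; rewrite mulr0 addr0.
Qed.

Lemma test0 : test_function (fun=> 0 : C).
Proof.
apply/test_functionP; split; first by move=> n; split; exact: Cn_cst0.
exists set0; split => //; exact: compact0.
Qed.

Lemma test_conj phi : test_function phi -> test_function (fun z => conjc (phi z)).
Proof.
move=> /test_functionP[sp [K [cK Kd K0]]]; apply/test_functionP; split.
  move=> n; have [p1 p2] := sp n.
  have -> : (fun z => complex.Re (conjc (phi z))) = (fun z => complex.Re (phi z)).
    by apply/funext => z; case: (phi z).
  have -> : (fun z => complex.Im (conjc (phi z))) =
      (fun z => -1 * complex.Im (phi z) + 0 * complex.Im (phi z)).
    by apply/funext => z; case: (phi z) => a b /=; ring.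
  by split => //; exact: Cn_lin.
by exists K; split => // z /K0 ->; rewrite conjc0.
Qed.

Lemma derive_supported F (K : set plane) v z : closed K ->
  (forall z, ~ K z -> F z = 0) -> ~ K z -> 'D_v F z = 0.
Proof.
move=> cK F0 Kz; rewrite -(derive_cst (0 : R) z v); apply: near_eq_derive.
have oC : open (~` K) by rewrite openC.
by apply: filterS (open_nbhs_nbhs (conj oC Kz)) => w; exact: F0.
Qed.

Lemma test_dx phi : test_function phi -> test_function (dx phi).
Proof.
move=> /test_functionP[sp [K [cK Kd K0]]]; apply/test_functionP; split.
  by move=> n; split; [exact: (rsmooth_dx (smooth_Re sp))|exact: (rsmooth_dx (smooth_Im sp))].
exists K; split => // z Kz; rewrite /dx /pderiv.
have clK : closed K by apply: compact_closed => //; exact: norm_hausdorff.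
by rewrite !(@derive_supported _ K)// => w /K0 ->.
Qed.

Lemma test_dy phi : test_function phi -> test_function (dy phi).
Proof.
move=> /test_functionP[sp [K [cK Kd K0]]]; apply/test_functionP; split.
  by move=> n; split; [exact: (rsmooth_dy (smooth_Re sp))|exact: (rsmooth_dy (smooth_Im sp))].
exists K; split => // z Kz; rewrite /dy /pderiv.
have clK : closed K by apply: compact_closed => //; exact: norm_hausdorff.
by rewrite !(@derive_supported _ K)// => w /K0 ->.
Qed.

Lemma derive_lin (a b : R) F G v z : rsmooth F -> rsmooth G ->
  'D_v (fun z => a * F z + b * G z) z = a * 'D_v F z + b * 'D_v G z.
Proof.
by move=> sF sG; apply: derive_lin_pt; apply: diff_derivable; exact: rsmooth_diff.
Qed.

Lemma pderiv_lin v c phi psi z : smooth phi -> smooth psi ->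
  pderiv v (fun z => c * phi z + psi z) z = c * pderiv v phi z + pderiv v psi z.
Proof.
move=> sp sq; have p1 := smooth_Re sp; have p2 := smooth_Im sp.
have q1 := smooth_Re sq; have q2 := smooth_Im sq.
have E : (fun z => complex.Re (c * phi z + psi z)) = (fun z => 1 *
    (complex.Re c * complex.Re (phi z) + - complex.Im c * complex.Im (phi z)) + 1 * complex.Re (psi z)).
  by apply/funext => w; rewrite raddfD/= cReM; ring.
have E' : (fun z => complex.Im (c * phi z + psi z)) = (fun z => 1 *
    (complex.Re c * complex.Im (phi z) + complex.Im c * complex.Re (phi z)) + 1 * complex.Im (psi z)).
  by apply/funext => w; rewrite raddfD/= cImM; ring.
rewrite /pderiv E E' !derive_lin//; [|by move=> n; exact: Cn_lin..].
by apply: complex_eq; rewrite ?raddfD/= ?cReM ?cImM/=; ring.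
Qed.

Lemma pderiv_conj v phi z : smooth phi ->
  pderiv v (fun z => conjc (phi z)) z = conjc (pderiv v phi z).
Proof.
move=> sp; rewrite /pderiv.
have -> : (fun z => complex.Re (conjc (phi z))) = (fun z => complex.Re (phi z)).
  by apply/funext => w; case: (phi w).
have -> : (fun z => complex.Im (conjc (phi z))) =
    (fun z => -1 * complex.Im (phi z) + 0 * complex.Im (phi z)).
  by apply/funext => w; case: (phi w) => a b /=; ring.
rewrite derive_lin; [|exact: smooth_Im..].
by apply: complex_eq => //=; ring.
Qed.

Lemma dx_cst0 : dx (fun=> 0 : C) = fun=> 0.
Proof. by apply/funext => z; rewrite /dx /pderiv !derive_cst. Qed.

Lemma dy_cst0 : dy (fun=> 0 : C) = fun=> 0.
Proof. by apply/funext => z; rewrite /dy /pderiv !derive_cst. Qed.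

Lemma dx_lin c phi psi : smooth phi -> smooth psi ->
  dx (fun z => c * phi z + psi z) = (fun z => c * dx phi z + dx psi z).
Proof. by move=> sp sq; apply/funext => z; exact: pderiv_lin. Qed.

Lemma dy_lin c phi psi : smooth phi -> smooth psi ->
  dy (fun z => c * phi z + psi z) = (fun z => c * dy phi z + dy psi z).
Proof. by move=> sp sq; apply/funext => z; exact: pderiv_lin. Qed.

Lemma dx_conj phi : smooth phi -> dx (fun z => conjc (phi z)) = (fun z => conjc (dx phi z)).
Proof. by move=> sp; apply/funext => z; exact: pderiv_conj. Qed.

Lemma dy_conj phi : smooth phi -> dy (fun z => conjc (phi z)) = (fun z => conjc (dy phi z)).
Proof. by move=> sp; apply/funext => z; exact: pderiv_conj. Qed.

End TestFunctions.

(** Absorption of half of the left side; it produces the constant 4 of the Poincare inequality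
    below. *)
Lemma half_le (R : realType) (a b : R) : a <= 2^-1 * a + 2 * b -> a <= 4 * b.
Proof. lra. Qed.

Section RSmooth.
Variable R : realType.
Local Notation plane := (R * R)%type.
Implicit Types (F G : plane -> R) (z : plane).

Lemma mixed_rsmooth F z : rsmooth F ->
  'D_(0, 1) (fun w => 'D_(1, 0) F w) z = 'D_(1, 0) (fun w => 'D_(0, 1) F w) z.
Proof.
move=> sF; have sx := rsmooth_dx sF; have sy := rsmooth_dy sF.
exact: (@mixed_derivatives R F z (fun w => rsmooth_diff w sF) (fun w => rsmooth_diff w sx)
  (fun w => rsmooth_diff w sy) (rsmooth_cont (rsmooth_dy sx)) (rsmooth_cont (rsmooth_dx sy))).
Qed.

Lemma ibp_x F G : rsmooth F -> rsmooth G -> (forall z, ~ disc z -> F z = 0) ->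
  Rintegral (area R) (@disc R) (fun z => F z * 'D_(1, 0) G z) =
  - Rintegral (area R) (@disc R) (fun z => 'D_(1, 0) F z * G z).
Proof.
move=> sF sG; exact: (@integration_by_parts_x R F G (fun w => rsmooth_diff w sF)
  (fun w => rsmooth_diff w sG) (rsmooth_cont (rsmooth_dx sF)) (rsmooth_cont (rsmooth_dx sG))).
Qed.

Lemma ibp_y F G : rsmooth F -> rsmooth G -> (forall z, ~ disc z -> F z = 0) ->
  Rintegral (area R) (@disc R) (fun z => F z * 'D_(0, 1) G z) =
  - Rintegral (area R) (@disc R) (fun z => 'D_(0, 1) F z * G z).
Proof.
move=> sF sG; exact: (@integration_by_parts_y R F G (fun w => rsmooth_diff w sF)
  (fun w => rsmooth_diff w sG) (rsmooth_cont (rsmooth_dy sF)) (rsmooth_cont (rsmooth_dy sG))).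
Qed.

Lemma dx_dy_test (phi : plane -> R[i]) : test_function phi -> dy (dx phi) = dx (dy phi).
Proof.
move=> tp; apply/funext => z; apply: complex_eq.
  exact: (mixed_rsmooth z (test_Re tp)).
exact: (mixed_rsmooth z (test_Im tp)).
Qed.

End RSmooth.

Definition HM (R : realType) := L2space (area R) (@measurable_disc R).

HB.lock Definition toHM (R : realType) (f : R * R -> R[i]) : HM R :=
  toL2 (area R) (@measurable_disc R) f.

Section PlaneSpace.
Variable R : realType.
Local Notation plane := (R * R)%type.
Local Notation C := R[i].
Implicit Types (F G : plane -> R) (phi psi : plane -> C) (z : plane).

Local Notation HM := (HM R).

Lemma L2M_test phi : test_function phi -> L2M phi.
Proof.
move=> tp; have c1 := rsmooth_cont (test_Re tp); have c2 := rsmooth_cont (test_Im tp).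
have [M1 h1] := bounded_on_disc c1; have [M2 h2] := bounded_on_disc c2.
apply: (@L2_bounded _ _ R (area R) (@disc R) (@measurable_disc R) (Num.sqrt (M1 ^+ 2 + M2 ^+ 2))).
- exact: area_disc_lty.
- by split; apply: measurable_funTS; exact: continuous_plane_measurable.
- move=> z dz; rewrite -(@ler_pXn2r _ 2) ?nnegrE ?sqrtr_ge0//; last first.
    by case: (phi z) => a b; exact: sqrtr_ge0.
  rewrite normc_sq sqr_sqrtr ?addr_ge0 ?sqr_ge0//.
  have sqle (u M : R) : `|u| <= M -> u ^+ 2 <= M ^+ 2.
    by move=> uM; rewrite -real_normK ?num_real// ler_pXn2r ?nnegrE// (le_trans _ uM).
  by rewrite lerD// sqle ?h1 ?h2.
Qed.

Lemma toHME f : L2M f -> toHM f = f :> (plane -> C).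
Proof. by move=> hf; rewrite unlock (toL2E _ hf). Qed.

Lemma toHM_val (u : HM) : toHM u = u.
Proof. by rewrite unlock; exact: toL2_val. Qed.

Lemma toHM_test phi : test_function phi -> toHM phi = phi :> (plane -> C).
Proof. by move/L2M_test/toHME. Qed.

Lemma toHM_lin c phi psi : test_function phi -> test_function psi ->
  toHM (fun z => c * phi z + psi z) = c *: toHM phi + toHM psi.
Proof. by move=> tp tq; rewrite unlock; apply: toL2_lin; exact: L2M_test. Qed.

Lemma toHM_dx_lin c phi psi : test_function phi -> test_function psi ->
  toHM (dx (fun z => c * phi z + psi z)) = c *: toHM (dx phi) + toHM (dx psi).
Proof.
move=> tp tq; rewrite -toHM_lin; [|exact: test_dx..].
by rewrite dx_lin; [|exact: test_smooth..].
Qed.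

Lemma toHM_dy_lin c phi psi : test_function phi -> test_function psi ->
  toHM (dy (fun z => c * phi z + psi z)) = c *: toHM (dy phi) + toHM (dy psi).
Proof.
move=> tp tq; rewrite -toHM_lin; [|exact: test_dy..].
by rewrite dy_lin; [|exact: test_smooth..].
Qed.

Definition cj (u : HM) : HM := toHM (fun z => conjc (u z)).

Lemma cjE u z : cj u z = conjc (u z).
Proof.
rewrite /cj toHME//; have [mu_ iu] := L2funP u.
have E w : Normc.normc (conjc (u w)) = Normc.normc (u w).
  by case: (u w) => a b /=; rewrite sqrrN.
split; last by rewrite /sqnorm; under eq_integral do rewrite E.
case: mu_ => m1 m2; split.
  rewrite (_ : (fun x => _) = (fun x => complex.Re (u x)))//.
  by apply/funext => w; case: (u w).
rewrite (_ : (fun x => _) = (fun x => - complex.Im (u x))).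
  exact: measurableT_comp.
by apply/funext => w; case: (u w).
Qed.

Lemma cj_test phi : test_function phi -> cj (toHM phi) = toHM (fun z => conjc (phi z)).
Proof.
move=> tp; apply: L2space_ext => z.
by rewrite /= cjE !toHM_test//; exact: test_conj.
Qed.

(** [weakly] pairs functions without conjugation, whereas [ip] is the real part of a Hermitian
    product; the imaginary part is recovered by inserting a factor [i]. *)
Lemma Cintegral_ip (u v : HM) :
  Cintegral (area R) (@disc R) (fun z => u z * v z) = ip u (cj v) +i* ip u ('i%C *: cj v).
Proof.
rewrite !ipE; apply: complex_eq; congr Rintegral; apply/funext => z; rewrite /rprod ?L2spaceZ !cjE.
  by case: (u z) (v z) => a b [c d] /=; ring.
by case: (u z) (v z) => a b [c d] /=; ring.
Qed.

Lemma ip_test phi psi : test_function phi -> test_function psi ->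
  ip (toHM phi) (toHM psi) = Rintegral (area R) (@disc R) (rprod phi psi).
Proof.
move=> tp tq; rewrite /= !ipE; congr Rintegral; apply/funext => z; by rewrite /rprod !toHM_test.
Qed.

Lemma Rintegral_test_Re phi psi : test_function phi -> test_function psi ->
  Rintegral (area R) (@disc R) (rprod phi psi) =
  Rintegral (area R) (@disc R) (fun z => complex.Re (phi z) * complex.Re (psi z)) +
  Rintegral (area R) (@disc R) (fun z => complex.Im (phi z) * complex.Im (psi z)).
Proof.
move=> tp tq; rewrite -Rintegral_discD//.
  by move=> z; apply: cvgM; apply: rsmooth_cont; exact: test_Re.
by move=> z; apply: cvgM; apply: rsmooth_cont; exact: test_Im.
Qed.

Lemma ip_dx_test phi psi : test_function phi -> test_function psi ->
  ip (toHM phi) (toHM (dx psi)) = - ip (toHM (dx phi)) (toHM psi).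
Proof.
move=> tp tq; have tp' := test_dx tp; have tq' := test_dx tq.
rewrite (ip_test tp tq') (ip_test tp' tq) (Rintegral_test_Re tp tq') (Rintegral_test_Re tp' tq).
rewrite opprD; congr (_ + _).
  by apply: (ibp_x (test_Re tp) (test_Re tq)) => z dz; rewrite (test_off_disc tp dz).
by apply: (ibp_x (test_Im tp) (test_Im tq)) => z dz; rewrite (test_off_disc tp dz).
Qed.

Lemma ip_dy_test phi psi : test_function phi -> test_function psi ->
  ip (toHM phi) (toHM (dy psi)) = - ip (toHM (dy phi)) (toHM psi).
Proof.
move=> tp tq; have tp' := test_dy tp; have tq' := test_dy tq.
rewrite (ip_test tp tq') (ip_test tp' tq) (Rintegral_test_Re tp tq') (Rintegral_test_Re tp' tq).
rewrite opprD; congr (_ + _).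
  by apply: (ibp_y (test_Re tp) (test_Re tq)) => z dz; rewrite (test_off_disc tp dz).
by apply: (ibp_y (test_Im tp) (test_Im tq)) => z dz; rewrite (test_off_disc tp dz).
Qed.

(** Two integrations by parts and the equality of mixed derivatives make this product symmetric in
    the two derivatives, while [ip u (i v)] is antisymmetric in [u] and [v]. Its vanishing gives
    [del phi] and [delbar phi] the same norm. *)
Lemma ip_dx_dy_test phi : test_function phi ->
  ip (toHM (dx phi)) ('i%C *: toHM (dy phi)) = 0.
Proof.
move=> tp; have tx := test_dx tp; have ty := test_dy tp.
have t0 : test_function (fun=> 0 : C) by exact: test0.
pose psi := fun z => 'i%C * phi z + 0.
have tpsi : test_function psi by exact: test_lin.
have T0 : toHM (fun=> 0) = 0 :> HM.
  by apply/val_inj; exact: (toHM_test t0).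
have E : toHM (dy psi) = 'i%C *: toHM (dy phi).
  by rewrite (toHM_dy_lin _ tp t0) dy_cst0 T0 addr0.
have E' : toHM (dx psi) = 'i%C *: toHM (dx phi).
  by rewrite (toHM_dx_lin _ tp t0) dx_cst0 T0 addr0.
have sym : ip (toHM (dx phi)) (toHM (dy psi)) = ip (toHM (dy phi)) (toHM (dx psi)).
  by rewrite (ip_dy_test tx tpsi) (ip_dx_test ty tpsi) (dx_dy_test tp).
have anti (u v : HM) : ip u ('i%C *: v) = - ip v ('i%C *: u).
  by rewrite ipC -[in RHS]ipI scalerA -expr2 sqr_i scaleN1r ipNr opprK.
have opp0 (t : R) : t = - t -> t = 0.
  by move/eqP; rewrite -addr_eq0 -mulr2n mulrn_eq0 => /eqP.
by rewrite E E' in sym; apply: opp0; rewrite {1}anti -sym.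
Qed.

(* Integrate the derivative of [x |phi|^2]. *)
Lemma Rintegral_poincare F : rsmooth F -> (forall z, ~ disc z -> F z = 0) ->
  Rintegral (area R) (@disc R) (fun z => F z * F z) <=
  4 * Rintegral (area R) (@disc R) (fun z => 'D_(1, 0) F z * 'D_(1, 0) F z).
Proof.
move=> sF F0; have dF z := rsmooth_diff z sF; have cF := rsmooth_cont sF.
have cF' := rsmooth_cont (rsmooth_dx sF).
have cFF : continuous (fun z => F z * F z) by move=> z; apply: cvgM; exact: cF.
have cF'F' : continuous (fun z => 'D_(1, 0) F z * 'D_(1, 0) F z) by move=> z; apply: cvgM; exact: cF'.
have dFF z : differentiable (F * F) z by exact: differentiableM.
have DFF : (fun z => 'D_(1, 0) (F * F) z) = (fun z => 2 * F z * 'D_(1, 0) F z).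
  apply/funext => z; rewrite deriveM; [|exact: diff_derivable..].
  by rewrite /GRing.scale/=; ring.
have dfst z : differentiable (fst : plane -> R) z.
  by apply: linear_differentiable; exact: continuous_fst.
have Dfst z : 'D_(1, 0) (fst : plane -> R) z = 1.
  rewrite deriveE; last exact: dfst.
  by rewrite diff_lin//; exact: continuous_fst.
have ibp := @integration_by_parts_x R (F * F) fst dFF dfst.
have : continuous (fun z => 2 * F z * 'D_(1, 0) F z).
  by move=> z; apply: cvgM; [apply: cvgM; [exact: cvg_cst|exact: cF]|exact: cF'].
move=> cFF'; rewrite DFF in ibp.
have cD1 : continuous (fun z : plane => 'D_(1, 0) (fst : plane -> R) z).
  by rewrite (_ : (fun z => _) = fun=> 1); [move=> z; exact: cvg_cst|apply/funext].
have {ibp}ibp := ibp cFF' cD1.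
have E : Rintegral (area R) (@disc R) (fun z => F z * F z) =
    - Rintegral (area R) (@disc R) (fun z => 2 * F z * 'D_(1, 0) F z * z.1).
  transitivity (Rintegral (area R) (@disc R) (fun z => (F * F) z * 'D_(1, 0) fst z)).
    by congr Rintegral; apply/funext => z; rewrite Dfst mulr1.
  rewrite ibp; last by move=> z dz; rewrite /GRing.mul/= F0// mul0r.
  by congr (- Rintegral _ _ _); apply/funext => z; rewrite -[in RHS](congr1 (fun f => f z) DFF).
have cP : continuous (fun z => 2 * F z * 'D_(1, 0) F z * z.1).
  by move=> z; apply: cvgM; [exact: cFF'|exact: continuous_fst].
have cH : continuous (fun z => 2^-1 * (F z * F z) + 2 * ('D_(1, 0) F z * 'D_(1, 0) F z)).
  by move=> z; apply: cvgD; apply: cvgM; [exact: cvg_cst|exact: cFF|exact: cvg_cst|exact: cF'F'].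
have le : Rintegral (area R) (@disc R) (fun z => F z * F z) <=
    Rintegral (area R) (@disc R) (fun z => 2^-1 * (F z * F z) + 2 * ('D_(1, 0) F z * 'D_(1, 0) F z)).
  rewrite E -mulN1r -Rintegral_discZ//; apply: le_Rintegral => //.
  - exact: measurable_disc.
  - by apply: integrable_disc => z; apply: cvgM; [exact: cvg_cst|exact: cP].
  - exact: integrable_disc.
  move=> z dz; have : z.1 ^+ 2 <= 1.
    by move: dz; rewrite /disc/=; have := sqr_ge0 z.2; lra.
  move: (F z) ('D_(1, 0) F z) => f f' z1.
  (* Half of this square and twice the next term give [-2 f f' x <= f^2 / 2 + 2 f'^2], with [x] the
     first coordinate. *)
  have : 0 <= (f + 2 * f' * z.1) ^+ 2 by exact: sqr_ge0.
  have : 0 <= f' ^+ 2 * (1 - z.1 ^+ 2) by rewrite mulr_ge0 ?sqr_ge0 ?subr_ge0.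
  nra.
have : Rintegral (area R) (@disc R) (fun z => 2^-1 * (F z * F z) + 2 * ('D_(1, 0) F z * 'D_(1, 0) F z)) =
    2^-1 * Rintegral (area R) (@disc R) (fun z => F z * F z) +
    2 * Rintegral (area R) (@disc R) (fun z => 'D_(1, 0) F z * 'D_(1, 0) F z).
  rewrite Rintegral_discD ?Rintegral_discZ//.
    by move=> z; apply: cvgM; [exact: cvg_cst|exact: cFF].
  by move=> z; apply: cvgM; [exact: cvg_cst|exact: cF'F'].
move=> E2; rewrite E2 in le; move: le.
exact: half_le.
Qed.

(** The constant 4 is crude. It shows that admissible Poincare constants exist and that convergence
    of the gradients forces convergence of the functions; the sharp constant enters through
    [poincare_constant]. *)
Lemma poincare_test phi : test_function phi ->
  nm (toHM phi) ^+ 2 <= 4 * nm (toHM (dx phi)) ^+ 2.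
Proof.
move=> tp; have tx := test_dx tp; rewrite !nm_sq (ip_test tp tp) (ip_test tx tx).
rewrite (Rintegral_test_Re tp tp) (Rintegral_test_Re tx tx) mulrDr; apply: lerD.
  by apply: (Rintegral_poincare (test_Re tp)) => z dz; rewrite (test_off_disc tp dz).
by apply: (Rintegral_poincare (test_Im tp)) => z dz; rewrite (test_off_disc tp dz).
Qed.

End PlaneSpace.

(** * Decomposition of L^2(M) *)

(* [G u ux uy] is meant to hold of a test function and its two partial
   derivatives. Keeping the Hilbert space abstract prevents unification from
   unfolding its vectors to functions. *)
Record gradient_space (R : realType) (V : semiHilbertType R) (G : V -> V -> V -> Prop) : Prop := {
  grad0 : G 0 0 0;
  grad_lin : forall c u ux uy v vx vy, G u ux uy -> G v vx vy ->
    G (c *: u + v) (c *: ux + vx) (c *: uy + vy);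
  grad_ip : forall u ux uy, G u ux uy -> ip ux ('i%C *: uy) = 0;
  grad_poincare : forall u ux uy, G u ux uy -> nm u ^+ 2 <= 4 * nm ux ^+ 2
}.

Section Sobolev.
Variables (R : realType) (V : semiHilbertType R) (G : V -> V -> V -> Prop).
Hypothesis GG : gradient_space G.
Implicit Types (u v w h f : V) (s : bool).

(* With the complex derivatives [del] and [delbar] in mind,
   [Dsg true = del] and [Dsg false = delbar]. *)
Definition isg s : R[i] := if s then - 'i%C else 'i%C.
Definition Dsg s (wx wy : V) : V := 2%:R^-1 *: (wx + isg s *: wy).

(** The closure of the graph of the gradient, so that the weak derivatives travel with the function.
    With [e] in place of sequences, stability under limits is a triangle inequality. *)
Definition H10 w wx wy := forall e : R, 0 < e -> exists u ux uy,
  [/\ G u ux uy, nm (w - u) < e, nm (wx - ux) < e & nm (wy - uy) < e].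

(** The range of [Dsg s] on [G] is stable under multiplication by [i], so real orthogonality to it
    is complex orthogonality. On the disc, [Kso true] yields weak solutions of [delbar h = 0] and
    [Kso false] those of [del h = 0]. *)
Definition Kso s h := forall u ux uy, G u ux uy -> ip h (Dsg s ux uy) = 0.

Lemma Dsg_lin s c ux uy vx vy :
  Dsg s (c *: ux + vx) (c *: uy + vy) = c *: Dsg s ux uy + Dsg s vx vy.
Proof.
rewrite /Dsg scalerA [c * _]mulrC -scalerA -scalerDr; congr (_ *: _).
by rewrite !scalerDr !scalerA [isg s * c]mulrC addrACA.
Qed.

Lemma Dsg0 s : Dsg s 0 0 = 0.
Proof. by rewrite /Dsg scaler0 addr0 scaler0. Qed.

Lemma DsgZ s c ux uy : Dsg s (c *: ux) (c *: uy) = c *: Dsg s ux uy.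
Proof. by have := Dsg_lin s c ux uy 0 0; rewrite !addr0 Dsg0 addr0. Qed.

Lemma DsgD s ux uy vx vy : Dsg s (ux + vx) (uy + vy) = Dsg s ux uy + Dsg s vx vy.
Proof. by have := Dsg_lin s 1 ux uy vx vy; rewrite !scale1r. Qed.

Lemma DsgB s ux uy vx vy : Dsg s (ux - vx) (uy - vy) = Dsg s ux uy - Dsg s vx vy.
Proof. by rewrite DsgD -!(scaleN1r vx) -!(scaleN1r vy) DsgZ scaleN1r. Qed.

Lemma Hcvg_Dsg s ux uy wx wy : Hcvg ux wx -> Hcvg uy wy ->
  Hcvg (fun n => Dsg s (ux n) (uy n)) (Dsg s wx wy).
Proof. by move=> hx hy; apply: HcvgZ; apply: HcvgD => //; exact: HcvgZ. Qed.

Lemma gradZ c u ux uy : G u ux uy -> G (c *: u) (c *: ux) (c *: uy).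
Proof. by move=> hu; have := grad_lin GG c hu (grad0 GG); rewrite !addr0. Qed.

Lemma H10P w wx wy : H10 w wx wy <-> exists u ux uy : nat -> V,
  [/\ forall n, G (u n) (ux n) (uy n), Hcvg u w, Hcvg ux wx & Hcvg uy wy].
Proof.
split=> [h|[u [ux [uy [tp h0 hx hy]]]] e e0].
  have h' n : exists t : V * V * V, [/\ G t.1.1 t.1.2 t.2, nm (w - t.1.1) < n.+1%:R^-1,
      nm (wx - t.1.2) < n.+1%:R^-1 & nm (wy - t.2) < n.+1%:R^-1].
    have n0 : 0 < n.+1%:R^-1 :> R by rewrite invr_gt0.
    by have [u [ux [uy hu]]] := h _ n0; exists (u, ux, uy).
  have [t ht] := choice h'.
  have lim (v : V) (u : nat -> V) : (forall n, nm (v - u n) < n.+1%:R^-1) -> Hcvg u v.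
    move=> le; apply/HcvgP => e e0.
    have [N _ hN] := near_infty_natSinv_lt (PosNum e0).
    exists N => n Nn; rewrite nmBC (lt_trans (le n))//; exact: hN.
  exists (fun n => (t n).1.1), (fun n => (t n).1.2), (fun n => (t n).2); split => [n|||];
    [|apply: lim => n..]; by case: (ht n).
have [N0 hN0] := (HcvgP _ _).1 h0 e e0.
have [N1 hN1] := (HcvgP _ _).1 hx e e0.
have [N2 hN2] := (HcvgP _ _).1 hy e e0.
pose N := maxn N0 (maxn N1 N2); exists (u N), (ux N), (uy N).
rewrite nmBC (nmBC wx) (nmBC wy).
by split => //; [apply: hN0|apply: hN1|apply: hN2]; rewrite !leq_max leqnn ?orbT.
Qed.

Lemma H10_gen u ux uy : G u ux uy -> H10 u ux uy.
Proof. by move=> tp e e0; exists u, ux, uy; rewrite !subrr nm0. Qed.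

Lemma H10_lin c u ux uy v vx vy : H10 u ux uy -> H10 v vx vy ->
  H10 (c *: u + v) (c *: ux + vx) (c *: uy + vy).
Proof.
move=> /H10P[p [px [py [tp p0 hpx hpy]]]] /H10P[q [qx [qy [tq q0 hqx hqy]]]].
apply/H10P; exists (fun n => c *: p n + q n), (fun n => c *: px n + qx n), (fun n => c *: py n + qy n).
split; [|by apply: HcvgD => //; exact: HcvgZ..].
by move=> n; exact: grad_lin.
Qed.

Lemma H100 : H10 0 0 0.
Proof. exact/H10_gen/(grad0 GG). Qed.

Lemma H10D u ux uy v vx vy : H10 u ux uy -> H10 v vx vy -> H10 (u + v) (ux + vx) (uy + vy).
Proof. by move=> hu /(H10_lin 1 hu); rewrite !scale1r. Qed.

Lemma H10Z c u ux uy : H10 u ux uy -> H10 (c *: u) (c *: ux) (c *: uy).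
Proof. by move=> hu; have := H10_lin c hu H100; rewrite !addr0. Qed.

Lemma H10B u ux uy v vx vy : H10 u ux uy -> H10 v vx vy -> H10 (u - v) (ux - vx) (uy - vy).
Proof. by move=> hu /(H10Z (-1)); rewrite !scaleN1r => hv; exact: H10D. Qed.

Lemma H10_lim (u ux uy : nat -> V) w wx wy : (forall n, H10 (u n) (ux n) (uy n)) ->
  Hcvg u w -> Hcvg ux wx -> Hcvg uy wy -> H10 w wx wy.
Proof.
move=> hu /HcvgP c0 /HcvgP cx /HcvgP cy e e0.
have e2 : 0 < e / 2 by rewrite divr_gt0.
have [N0 hN0] := c0 _ e2; have [N1 hN1] := cx _ e2; have [N2 hN2] := cy _ e2.
pose N := maxn N0 (maxn N1 N2).
have [p [px [py [tp h0 hx hy]]]] := hu N _ e2.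
exists p, px, py; split => //; rewrite (splitr e).
- by rewrite (le_lt_trans (nm_dist _ (u N) _))// ltrD// nmBC hN0// /N !leq_max leqnn.
- by rewrite (le_lt_trans (nm_dist _ (ux N) _))// ltrD// nmBC hN1// /N !leq_max leqnn ?orbT.
- by rewrite (le_lt_trans (nm_dist _ (uy N) _))// ltrD// nmBC hN2// /N !leq_max leqnn ?orbT.
Qed.

Lemma nmI u : nm ('i%C *: u) = nm u.
Proof. by rewrite nmZ /= expr0n expr1n add0r sqrtr1 mul1r. Qed.

Lemma H10_ip_dx_dy w wx wy : H10 w wx wy -> ip wx ('i%C *: wy) = 0.
Proof.
move=> hw; apply: eq_of_common_approx => e e0.
have e4 : 0 < e / 4 by rewrite divr_gt0.
have M0 : 0 < nm wy + 1 by rewrite ltr_wpDl ?nm_ge0.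
have P0 : 0 < nm wx + 1 by rewrite ltr_wpDl ?nm_ge0.
(* Small enough for each of two Cauchy-Schwarz error terms to stay below [e / 4]; the 1 bounds the
   norm of the approximation [a] by [nm wx + 1]. *)
have d0 : 0 < Num.min 1 (Num.min (e / 4 / (nm wy + 1)) (e / 4 / (nm wx + 1))).
  by rewrite !lt_min ltr01 !divr_gt0.
have [u [a [b [ht _]]]] := hw _ d0.
rewrite !lt_min nmBC (nmBC wy) => /and3P[n0 n1 _] /and3P[_ _ n2].
have ab := grad_ip GG ht.
exists 0; rewrite subr0 subrr normr0 divr_gt0//; split => //.
have -> : ip wx ('i%C *: wy) = - (ip (a - wx) ('i%C *: wy) + ip a ('i%C *: (b - wy))).
  by rewrite scalerBr ipDr ipNr ab ipDl ipNl; ring.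
rewrite normrN (le_lt_trans (ler_normD _ _))// (_ : e / 2 = e / 4 + e / 4); last by field.
rewrite ltrD// (le_lt_trans (ip_le _ _))// nmI.
  rewrite (@le_lt_trans _ _ (nm (a - wx) * (nm wy + 1)))//.
    by rewrite ler_wpM2l ?nm_ge0// lerDl.
  by rewrite -ltr_pdivlMr.
have na : nm a <= nm wx + 1.
  by rewrite -(subrK wx a) addrC (le_trans (nmD _ _))// lerD2l ltW.
rewrite (@le_lt_trans _ _ ((nm wx + 1) * nm (b - wy)))//.
  by rewrite ler_wpM2r ?nm_ge0.
by rewrite mulrC -ltr_pdivlMr.
Qed.

(** The cross term vanishes on [H10], so either complex derivative alone carries the norm of the
    whole gradient. This exchange of [del] and [delbar] is what lets the descent be estimated. *)
Lemma nm_Dsg s w wx wy : H10 w wx wy ->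
  nm (Dsg s wx wy) ^+ 2 = 4^-1 * (nm wx ^+ 2 + nm wy ^+ 2).
Proof.
move=> /H10_ip_dx_dy h; rewrite /Dsg nmZ exprMn.
have -> : Normc.normc (2%:R^-1 : R[i]) ^+ 2 = 4^-1.
  have -> : (2%:R^-1 : R[i]) = (2^-1)%:C by rewrite fmorphV rmorph_nat.
  by rewrite /= expr0n addr0 sqrtr_sqr ger0_norm ?invr_ge0//; field.
congr (_ * _); rewrite !nm_sq ip_sqD.
have -> : ip wx (isg s *: wy) = 0.
  by rewrite /isg; case: s => //; rewrite scaleNr ipNr h oppr0.
have -> : ip (isg s *: wy) (isg s *: wy) = ip wy wy.
  by rewrite /isg; case: s; rewrite ?scaleNr ?ipNl ?ipNr ?opprK ipI.
by rewrite mulr0 addr0.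
Qed.

Lemma H10_poincare4 w wx wy : H10 w wx wy -> nm w ^+ 2 <= 4 * nm wx ^+ 2.
Proof.
move=> /H10P[u [ux [uy [tp h0 hx _]]]].
have l0 : (fun n => nm (u n) ^+ 2) @ \oo --> nm w ^+ 2.
  by apply: cvgM; exact: Hcvg_nm.
have l1 : (fun n => 4 * nm (ux n) ^+ 2) @ \oo --> 4 * nm wx ^+ 2.
  by apply: cvgM; [exact: cvg_cst|apply: cvgM; exact: Hcvg_nm].
rewrite -(cvg_lim _ l0)// -(cvg_lim _ l1)//.
apply: ler_lim; [exact: cvgP l0|exact: cvgP l1|].
by apply: nearW => n; apply: grad_poincare (tp n).
Qed.

(** Complex linearity of a condition stated with a real product: the factor [i] is moved to the test
    vector, where [gradZ] absorbs it. *)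
Lemma Kso_lin s c u v : Kso s u -> Kso s v -> Kso s (c *: u + v).
Proof.
move=> ku kv p px py tp; rewrite ipDl (kv _ _ _ tp) addr0.
have -> : c *: u = (complex.Re c)%:C *: u + (complex.Im c)%:C *: ('i%C *: u).
  by rewrite scalerA -scalerDl; congr (_ *: _); rewrite mulrC; exact: complexE.
rewrite ipDl !ipZl (ku _ _ _ tp) mulr0 add0r -[X in _ * X]ipI scalerA -expr2 sqr_i scaleN1r.
by rewrite ipNl -DsgZ (ku _ _ _ (gradZ 'i%C tp)) oppr0 mulr0.
Qed.

Lemma Kso0 s : Kso s 0. Proof. by move=> u ux uy _; rewrite ip0l. Qed.

Lemma KsoZ s c u : Kso s u -> Kso s (c *: u).
Proof. by move=> ku; rewrite -[_ *: _]addr0; apply: Kso_lin => //; exact: Kso0. Qed.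

Lemma KsoD s u v : Kso s u -> Kso s v -> Kso s (u + v).
Proof. by move=> ku kv; rewrite -[u]scale1r; exact: Kso_lin. Qed.

Lemma KsoB s u v : Kso s u -> Kso s v -> Kso s (u - v).
Proof. by move=> ku /(KsoZ (-1)); rewrite scaleN1r; exact: KsoD. Qed.

Lemma Kso_lim s (u : nat -> V) v : (forall n, Kso s (u n)) -> Hcvg u v -> Kso s v.
Proof.
move=> ku hu p px py tp.
have := Hcvg_ip hu (y := Dsg s px py).
rewrite (_ : (fun n => ip _ _) = fun=> 0); last first.
  by apply/funext => n; rewrite (ku _ _ _ _ tp).
by move=> l; apply/esym; apply: cvg_unique l; [exact: Rhausdorff|exact: cvg_cst].
Qed.

Lemma Kso_aeq s u v : aeq u v -> Kso s u -> Kso s v.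
Proof.
move=> uv ku; apply: (@Kso_lim s (fun=> u)) => //; rewrite /Hcvg uv; exact: cvg_cst.
Qed.

Lemma H10_Kso_orth s h w wx wy : Kso s h -> H10 w wx wy -> ip h (Dsg s wx wy) = 0.
Proof.
move=> hk /H10P[u [ux [uy [tp _ hx hy]]]].
have := Hcvg_ip (Hcvg_Dsg s hx hy) (y := h).
rewrite (_ : (fun n => ip _ _) = fun=> 0); last first.
  by apply/funext => n; rewrite ipC (hk _ _ _ (tp n)).
by rewrite ipC => l; apply/esym; apply: cvg_unique l; [exact: Rhausdorff|exact: cvg_cst].
Qed.

Lemma nm_Kso_Dsg s h w wx wy : Kso s h -> H10 w wx wy ->
  nm (h + Dsg s wx wy) ^+ 2 = nm h ^+ 2 + nm (Dsg s wx wy) ^+ 2.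
Proof.
move=> hk hw; rewrite nm_sq ip_sqD (H10_Kso_orth hk hw) mulr0 addr0.
by rewrite -!nm_sq.
Qed.

Lemma bounded_cauchy (x v : nat -> V) (c : R) : 0 < c ->
  (forall m n, nm (v m - v n) ^+ 2 <= c ^+ 2 * nm (x m - x n) ^+ 2) -> Hcauchy x -> Hcauchy v.
Proof.
move=> c0 le cx e e0; have [N hN] := cx (e / c) (divr_gt0 e0 c0).
exists N => m n Nm Nn; rewrite -(@ltr_pXn2r _ 2) ?nnegrE ?nm_ge0 ?ltW//.
apply: le_lt_trans (le m n) _; rewrite -exprMn ltr_pXn2r ?nnegrE ?mulr_ge0 ?nm_ge0 ?ltW//.
by rewrite mulrC -ltr_pdivlMr// hN.
Qed.

(** Closed range: if one complex derivative is Cauchy, the gradients are so by [nm_Dsg], and then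
    the functions by the Poincare inequality. *)
Lemma H10_cauchy s (u ux uy : nat -> V) : (forall n, H10 (u n) (ux n) (uy n)) ->
  Hcauchy (fun n => Dsg s (ux n) (uy n)) ->
  exists w wx wy, [/\ H10 w wx wy, Hcvg u w, Hcvg ux wx & Hcvg uy wy].
Proof.
move=> hu cD.
have hd m n : H10 (u m - u n) (ux m - ux n) (uy m - uy n) by exact: H10B.
have c4 : (0 : R) < 4 by [].
have q0 (t : R) : 0 <= t ^+ 2 by exact: sqr_ge0.
have bd m n : nm (ux m - ux n) ^+ 2 + nm (uy m - uy n) ^+ 2 =
    4 * nm (Dsg s (ux m) (uy m) - Dsg s (ux n) (uy n)) ^+ 2.
  by rewrite -DsgB (nm_Dsg s (hd m n)) mulrA mulfV// mul1r.
have [wx hx] : exists wx, Hcvg ux wx.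
  apply: Hcauchy_cvg; apply: bounded_cauchy c4 _ cD => m n; have := bd m n.
  have := q0 (nm (uy m - uy n)); have := q0 (nm (Dsg s (ux m) (uy m) - Dsg s (ux n) (uy n))).
  clear; move: (nm _ ^+ 2) (nm _ ^+ 2) (nm _ ^+ 2) => a b c; lra.
have [wy hy] : exists wy, Hcvg uy wy.
  apply: Hcauchy_cvg; apply: bounded_cauchy c4 _ cD => m n; have := bd m n.
  have := q0 (nm (ux m - ux n)); have := q0 (nm (Dsg s (ux m) (uy m) - Dsg s (ux n) (uy n))).
  clear; move: (nm _ ^+ 2) (nm _ ^+ 2) (nm _ ^+ 2) => a b c; lra.
have [w hw] : exists w, Hcvg u w.
  apply: Hcauchy_cvg; apply: bounded_cauchy c4 _ cD => m n; have := bd m n.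
  have := H10_poincare4 (hd m n); have := q0 (nm (uy m - uy n)).
  clear; move: (nm _ ^+ 2) (nm _ ^+ 2) (nm _ ^+ 2) (nm _ ^+ 2) => a b c d; lra.
by exists w, wx, wy; split => //; exact: H10_lim hu hw hx hy.
Qed.

(** The projection of [f] onto the closure of the range of [Dsg s] is a limit of derivatives; by the
    closed range it is, up to distance zero, itself the derivative of an element of [H10]. *)
Lemma decomposition s f : exists w wx wy, H10 w wx wy /\ Kso s (f - Dsg s wx wy).
Proof.
pose S := [set x | exists u ux uy, G u ux uy /\ x = Dsg s ux uy].
have S0 : S 0 by exists 0, 0, 0; rewrite Dsg0; split => //; exact: grad0.
have Slin (c : R) x y : S x -> S y -> S (c%:C *: x + y).
  move=> [u [ux [uy [hu ->]]]] [v [vx [vy [hv ->]]]].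
  exists (c%:C *: u + v), (c%:C *: ux + vx), (c%:C *: uy + vy).
  by rewrite Dsg_lin; split => //; exact: grad_lin.
have [t [p [St tp ort]]] := projection f S0 Slin.
have ex n : exists q : V * V * V, G q.1.1 q.1.2 q.2 /\ t n = Dsg s q.1.2 q.2.
  by have [u [ux [uy hu]]] := St n; exists (u, ux, uy).
have [q hq] := choice ex.
have E : t = (fun n => Dsg s (q n).1.2 (q n).2) by apply/funext => n; case: (hq n).
have Hq n : H10 (q n).1.1 (q n).1.2 (q n).2 by apply: H10_gen; case: (hq n).
have := Hcvg_cauchy tp; rewrite E => /(H10_cauchy Hq)[w [wx [wy [hw _ hx hy]]]].
exists w, wx, wy; split => //.
apply: (@Kso_aeq s (f - p)); last by move=> u ux uy hu; apply: ort; exists u, ux, uy.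
by apply: aeqB; [exact: aeq_refl|rewrite E in tp; exact: Hcvg_unique tp (Hcvg_Dsg s hx hy)].
Qed.

End Sobolev.

(** * The descent on frequencies *)

Section RealEstimates.
Variable R : realType.

(* The Lyapunov inequality of the descent: [2uv <= (2/C) u^2 + (C/2) v^2]. *)
Lemma descent_step (B C S S' u v : R) : 0 <= B -> C = 4 + 2 * B ->
  0 <= S' -> C * S' <= S -> u ^+ 2 <= B * (2 * S) -> v ^+ 2 <= 2 * S' ->
  (u + v) ^+ 2 <= C * S.
Proof.
move=> B0 CE S'0 SS hu hv; have C0 : 0 < C by rewrite CE; lra.
have S0 : 0 <= S by rewrite (le_trans _ SS)// mulr_ge0// ltW.
rewrite -(ler_pM2l C0).
(* The weights are unequal because [u] is bounded through [S] and [v] through [S'], which is smaller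
   by the factor [C]. *)
have amgm : 2 * C * u * v <= 2 * u ^+ 2 + C ^+ 2 * v ^+ 2 / 2.
  rewrite -subr_ge0; have -> : 2 * u ^+ 2 + C ^+ 2 * v ^+ 2 / 2 - 2 * C * u * v =
    2^-1 * (2 * u - C * v) ^+ 2 by field.
  by rewrite mulr_ge0 ?sqr_ge0// invr_ge0.
have h1 : (C + 2) * u ^+ 2 <= (C + 2) * (B * (2 * S)).
  by rewrite ler_wpM2l// addr_ge0// ltW.
have h2 : (C + C ^+ 2 / 2) * v ^+ 2 <= (C + C ^+ 2 / 2) * (2 * S').
  by rewrite ler_wpM2l// addr_ge0 ?divr_ge0 ?sqr_ge0 ?ltW.
have h3 : (2 + C) * (C * S') <= (2 + C) * S by rewrite ler_wpM2l// addr_ge0// ltW.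
have BE : 2 * B = C - 4 by rewrite CE; ring.
have h1' : (C + 2) * (B * (2 * S)) = (C ^+ 2 - 2 * C - 8) * S.
  transitivity ((C + 2) * (2 * B) * S); first by ring.
  by rewrite BE; ring.
(* The bounds add up to [(C^2 - 2 C - 8) S + (C + 2) S = (C^2 - C - 6) S], below [C^2 S]. *)
rewrite h1' in h1; clear -amgm h1 h2 h3 S0 C0.
have CS : 0 <= C * S by rewrite mulr_ge0// ltW.
nra.
Qed.

Lemma sqrD_le (x y : R) : (x + y) ^+ 2 <= 2 * x ^+ 2 + 2 * y ^+ 2.
Proof. by have := sqr_ge0 (x - y); nra. Qed.

Lemma sqrD3_le (x y z : R) : (x + y + z) ^+ 2 <= 3 * (x ^+ 2 + y ^+ 2 + z ^+ 2).
Proof.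
by have := sqr_ge0 (x - y); have := sqr_ge0 (y - z); have := sqr_ge0 (x - z); nra.
Qed.

Lemma le_of_sq (a b : R) : 0 <= a + 2 * - b + b -> b <= a.
Proof. lra. Qed.

Lemma tail_step (a t t' : R) : a <= 4 / 3 * t' -> 4 * t' <= t -> t + a <= 4 / 3 * t.
Proof. lra. Qed.

Lemma gmode0_step (m x d d1 d2 e a1 a2 : R) : m <= x + d -> d <= d1 + d2 -> e <= a1 + a2 ->
  0 <= a1 -> 0 <= a2 -> m + 2^-1 * e <= x + (a1 + d1) + (a2 + d2).
Proof. lra. Qed.

(** Origin of the factor 4 of the theorem: the mode zero costs [3 w], the other modes [8/3 (t + f)],
    which is at most [2/3 w] because [4 <= C]. The sum is [11/3 w]. *)
Lemma gsum_bound (a C t f w g s u v : R) : 0 <= a -> 4 <= C -> 0 <= t -> 0 <= f ->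
  w = a + C * (t + f) -> g <= 3 * w -> s <= 2 * (u + v) -> u <= 4 / 3 * t -> v <= 4 / 3 * f ->
  g + s <= 4 * w.
Proof.
move=> a0 C4 t0 f0 wE hg hs hu hv.
have : 4 * (t + f) <= C * (t + f) by rewrite ler_wpM2r// addr_ge0.
lra.
Qed.

End RealEstimates.

Lemma normc_half (R : realType) : Normc.normc (2%:R^-1 : R[i]) = 2^-1.
Proof.
have -> : (2%:R^-1 : R[i]) = (2^-1)%:C by rewrite fmorphV rmorph_nat.
by rewrite /= expr0n addr0 sqrtr_sqr ger0_norm ?invr_ge0.
Qed.

(* [V] and [W] stand for [L^2(M)] and [L^2(SM)], [E k u = e^(ik theta) u], [md k]
   is the k-th Fourier mode, [A] the multiplication by the attenuation and [Z] the
   kernel of the transform; [Zgen] says that [Z] contains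
   [(X + a) (e^(ik theta) w)]. *)
Record xray_model (R : realType) (V W : semiHilbertType R) (G : V -> V -> V -> Prop)
    (E : int -> V -> W) (md : int -> W -> V) (A : V -> V) (c0 al P : R) (Z : W -> Prop) : Prop := {
  model_grad : gradient_space G;
  c0_gt0 : 0 < c0;
  E_lin : forall k c u v, E k (c *: u + v) = c *: E k u + E k v;
  E_ip : forall j k u v, ip (E j u) (E k v) = if j == k then c0 * ip u v else 0;
  md_adj : forall k x u, ip x (E k u) = c0 * ip (md k x) u;
  md_total : forall x, (forall k, aeq (md k x) 0) -> aeq x 0;
  A_lin : forall c u v, A (c *: u + v) = c *: A u + A v;
  al_ge0 : 0 <= al;
  A_le : forall u, nm (A u) <= al * nm u;
  P_ge0 : 0 <= P;
  P_le : forall w wx wy, H10 G w wx wy -> nm w ^+ 2 <= P * (nm wx ^+ 2 + nm wy ^+ 2);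
  Z_lin : forall c x y, Z x -> Z y -> Z (c *: x + y);
  Z_lim : forall u x, (forall n : nat, Z (u n)) -> Hcvg u x -> Z x;
  Zgen : forall k w wx wy, H10 G w wx wy ->
    Z (E (k + 1) (Dsg true wx wy) + E (k - 1) (Dsg false wx wy) + E k (A w))
}.

Section Reduction.
Variables (R : realType) (V W : semiHilbertType R) (G : V -> V -> V -> Prop).
Variables (E : int -> V -> W) (md : int -> W -> V) (A : V -> V) (c0 al P : R) (Z : W -> Prop).
Hypothesis M : xray_model G E md A c0 al P Z.
Let GG := model_grad M.
Notation triple := (V * V * V)%type.
Implicit Types (s : bool) (i j : int) (u v : V) (X Y : W) (k : nat) (x : int -> V) (w : bool -> nat -> triple) (t : triple).

Let C := 4 + 8 * al ^+ 2 * P.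
(** The factor 4 converts the squared gradient of the Poincare inequality into that of one complex
    derivative. *)
Let B := 4 * al ^+ 2 * P.

Let B_ge0 : 0 <= B.
Proof. by rewrite /B mulr_ge0 ?(P_ge0 M)// mulr_ge0 ?sqr_ge0. Qed.

Let CE : C = 4 + 2 * B. Proof. by rewrite /C /B; ring. Qed.

Let C_ge4 : 4 <= C. Proof. by rewrite CE lerDl mulr_ge0// B_ge0. Qed.

Let C_gt0 : 0 < C. Proof. exact: lt_le_trans C_ge4. Qed.

Lemma E0 i : E i 0 = 0.
Proof. by have := E_lin M i (-1) 0 0; rewrite !scaleN1r !addNr. Qed.

Lemma ED i u v : E i (u + v) = E i u + E i v.
Proof. by have := E_lin M i 1 u v; rewrite !scale1r. Qed.

Lemma EZ i c u : E i (c *: u) = c *: E i u.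
Proof. by have := E_lin M i c u 0; rewrite !addr0 E0 addr0. Qed.

Lemma EB i u v : E i (u - v) = E i u - E i v.
Proof. by rewrite ED -scaleN1r EZ scaleN1r. Qed.

Lemma A0 : A 0 = 0.
Proof. by have := A_lin M (-1) 0 0; rewrite !scaleN1r !addNr. Qed.

Lemma AD u v : A (u + v) = A u + A v.
Proof. by have := A_lin M 1 u v; rewrite !scale1r. Qed.

Lemma AZ c u : A (c *: u) = c *: A u.
Proof. by have := A_lin M c u 0; rewrite !addr0 A0 addr0. Qed.

Lemma Z0 : Z 0.
Proof. by have := Zgen M 0 (H100 GG); rewrite !Dsg0 A0 !E0 !addr0. Qed.

Lemma ZD X Y : Z X -> Z Y -> Z (X + Y).
Proof. by move=> hX hY; rewrite -[X]scale1r; exact: (Z_lin M). Qed.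

Lemma Z_sum (F : nat -> W) m n : (forall k, Z (F k)) -> Z (\sum_(m <= k < n) F k).
Proof. by move=> h; elim/big_ind : _ => //; [exact: Z0|exact: ZD]. Qed.

(** The model knows [md] through its adjoint relation, which determines it up to distance zero;
    linearity is therefore an [aeq]. *)
Lemma md_lin i c X Y : aeq (md i (c *: X + Y)) (c *: md i X + md i Y).
Proof.
have n0 : c0 != 0 by rewrite gt_eqF// (c0_gt0 M).
have cZ (U : semiHilbertType R) (p q : U) : ip (c *: p) q = ip p (conjc c *: q).
  have dec (b : R[i]) (r : U) : b *: r = (complex.Re b)%:C *: r + (complex.Im b)%:C *: ('i%C *: r).
    by rewrite scalerA -scalerDl; congr (_ *: _); rewrite mulrC; exact: complexE.
  have iN (p' q' : U) : ip ('i%C *: p') q' = - ip p' ('i%C *: q').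
    by rewrite -[in RHS]ipI scalerA -expr2 sqr_i scaleN1r ipNr opprK.
  rewrite (dec c) (dec (conjc c)) ipDl ipDr !ipZl !ipZr iN.
  by case: c => a b /=; ring.
rewrite -[X in aeq X](subrK (c *: md i X + md i Y)) -[X in aeq _ X]add0r.
apply: aeqD; last exact: aeq_refl.
apply: aeq_ip0 => u; apply: (mulfI n0); rewrite mulr0 ipDl ipNl mulrBr -(md_adj M).
by rewrite !ipDl mulrDr !cZ -!(md_adj M) EZ subrr.
Qed.

Lemma md_E i j u : aeq (md i (E j u)) (if i == j then u else 0).
Proof.
have n0 : c0 != 0 by rewrite gt_eqF// (c0_gt0 M).
rewrite -[X in aeq X](subrK (if i == j then u else 0)) -[X in aeq _ X]add0r.
apply: aeqD; last exact: aeq_refl.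
apply: aeq_ip0 => v; apply: (mulfI n0); rewrite mulr0 ipDl ipNl mulrBr -(md_adj M) (E_ip M).
by rewrite eq_sym; case: eqP => _; rewrite ?ip0l ?mulr0 subrr.
Qed.

Lemma nm_E i u : nm (E i u) ^+ 2 = c0 * nm u ^+ 2.
Proof. by rewrite !nm_sq (E_ip M) eqxx. Qed.

(** Bessel's inequality for one frequency, from the squared norm of [X - E i (md i X)]. *)
Lemma nm_md i X : c0 * nm (md i X) ^+ 2 <= nm X ^+ 2.
Proof.
have h : 0 <= nm (X - E i (md i X)) ^+ 2 by exact: sqr_ge0.
rewrite nm_sq ip_sqD ipNl !ipNr opprK (md_adj M) (E_ip M) eqxx -!nm_sq in h.
exact: le_of_sq h.
Qed.

Lemma Hcvg_md i (u : nat -> W) X : Hcvg u X -> Hcvg (fun n => md i (u n)) (md i X).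
Proof.
move=> /HcvgP h; apply/HcvgP => e e0.
have c1 : 0 < Num.sqrt c0 by rewrite sqrtr_gt0 (c0_gt0 M).
have [N hN] := h (Num.sqrt c0 * e) (mulr_gt0 c1 e0).
exists N => n /hN hn; rewrite -(ltr_pM2l c1); apply: le_lt_trans hn.
have E' : aeq (md i (u n) - md i X) (md i (u n - X)).
  apply: aeq_sym; have := md_lin i (-1) X (u n).
  by rewrite !scaleN1r [- X + _]addrC [- md i X + _]addrC.
rewrite (aeq_nm E') -(@ler_pXn2r _ 2) ?nnegrE ?mulr_ge0 ?nm_ge0 ?sqrtr_ge0//.
by rewrite exprMn sqr_sqrtr ?nm_md// ltW// (c0_gt0 M).
Qed.

Definition sg s k : int := if s then k%:Z else - k%:Z.

Definition Dt s t := Dsg s t.1.2 t.2.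
Definition Ht t := H10 G t.1.1 t.1.2 t.2.

Lemma Dt_lin s c t t' : Dt s (c *: t + t') = c *: Dt s t + Dt s t'.
Proof. exact: Dsg_lin. Qed.

Lemma DtZ s c t : Dt s (c *: t) = c *: Dt s t. Proof. exact: DsgZ. Qed.

Lemma DtD s t t' : Dt s (t + t') = Dt s t + Dt s t'. Proof. exact: DsgD. Qed.

Lemma half_sub (F : numFieldType) (U : lmodType F) (u v : U) :
  u - 2%:R^-1 *: (u - v) = 2%:R^-1 *: (u + v).
Proof.
have h : u = 2%:R^-1 *: u + 2%:R^-1 *: u :> U.
  rewrite -scalerDl (_ : _ + _ = 1) ?scale1r//; by rewrite [RHS]splitr mul1r.
by rewrite {1}h scalerBr opprB addrACA subrr addr0 scalerDr.
Qed.

Lemma Dt0 s : Dt s 0 = 0. Proof. exact: Dsg0. Qed.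

Lemma Ht_lin c t t' : Ht t -> Ht t' -> Ht (c *: t + t').
Proof. exact: (H10_lin GG). Qed.

Lemma Ht0 : Ht 0. Proof. exact: (H100 GG). Qed.

Lemma DtB s t t' : Dt s (t - t') = Dt s t - Dt s t'. Proof. exact: DsgB. Qed.

Lemma HtB t t' : Ht t -> Ht t' -> Ht (t - t').
Proof. exact: (H10B GG). Qed.

Lemma nm_Dt s s' t : Ht t -> nm (Dt s t) ^+ 2 = nm (Dt s' t) ^+ 2.
Proof. by move=> ht; rewrite /Dt !(nm_Dsg GG _ ht). Qed.

(** The bound on the attenuation, the Poincare inequality and [nm_Dsg] in turn; [s] is free as both
    complex derivatives have the same norm. *)
Lemma nm_A t s : Ht t -> nm (A t.1.1) ^+ 2 <= B * nm (Dt s t) ^+ 2.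
Proof.
move=> ht; rewrite /Dt (nm_Dsg GG _ ht).
have h1 : nm (A t.1.1) ^+ 2 <= al ^+ 2 * nm t.1.1 ^+ 2.
  by rewrite -exprMn ler_pXn2r ?nnegrE ?mulr_ge0 ?nm_ge0 ?(al_ge0 M)// (A_le M).
apply: (le_trans h1).
have h2 := ler_wpM2l (sqr_ge0 al) (P_le M ht); apply: (le_trans h2).
by rewrite le_eqVlt; apply/orP; left; apply/eqP; rewrite /B; field.
Qed.

(* [w s k] is the H^1_0 component found at the frequency [sg s k]; it contributes
   [- A w] and [- Dt (~~ s) w] to the two next lower frequencies. *)
Definition res x w s k := x (sg s k) - A (w s k.+1).1.1 - Dt (~~ s) (w s k.+2).
Definition sol x w s k := res x w s k - Dt s (w s k).

Definition Sol n x w := [/\ forall s k, Ht (w s k),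
  forall s k, (n < k)%N -> w s k = 0, forall s k, (n < k)%N -> x (sg s k) = 0 &
  forall s k, Kso G s (sol x w s k)].

(* At the frequencies 1 and -1 only the average of [w true 1] and [w false 1] lies
   in the kernel of the transform; their difference becomes [g_s]. *)
Definition gmode0 x w := x 0 - (Dt false (w true 2) + Dt true (w false 2))
  - 2%:R^-1 *: (A (w true 1).1.1 + A (w false 1).1.1).
Definition gmode x w s k := sol x w s k +
  (if k == 1%N then 2%:R^-1 *: Dt s (w s 1%N - w (~~ s) 1%N) else 0).

Definition Efam n (y0 : V) (y : bool -> nat -> V) := E 0 y0 +
  \sum_(1 <= k < n.+1) (E (sg true k) (y true k) + E (sg false k) (y false k)).
Definition gsum n x w := Efam n (gmode0 x w) (gmode x w).
Definition fsum n x := Efam n (x 0) (fun s k => x (sg s k)).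

(** Up to the factor [c0], the squared norm with weights [C^k], cut at the frequency [n]. *)
Definition weight n x : R := nm (x 0) ^+ 2 + \sum_(1 <= k < n.+1)
  C ^+ k * (nm (x (sg true k)) ^+ 2 + nm (x (sg false k)) ^+ 2).

Lemma res_lin c x w x' w' s k :
  res (fun j => c *: x j + x' j) (fun s k => c *: w s k + w' s k) s k =
  c *: res x w s k + res x' w' s k.
Proof.
rewrite /res Dt_lin /= (A_lin M) !scalerBr !opprD.
by rewrite (AC ((1*1)*(1*1)*(1*1)) ((1*3*5)*(2*4*6))).
Qed.

Lemma sol_lin c x w x' w' s k :
  sol (fun j => c *: x j + x' j) (fun s k => c *: w s k + w' s k) s k =
  c *: sol x w s k + sol x' w' s k.
Proof.
rewrite /sol res_lin Dt_lin [c *: (res _ _ _ _ - _)]scalerBr opprD.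
by rewrite (AC ((1*1)*(1*1)) ((1*3)*(2*4))).
Qed.

Lemma gmode0_lin c x w x' w' :
  gmode0 (fun j => c *: x j + x' j) (fun s k => c *: w s k + w' s k) =
  c *: gmode0 x w + gmode0 x' w'.
Proof.
rewrite /gmode0 !Dt_lin /= !(A_lin M) !scalerBr !scalerDr !scalerA [2%:R^-1 * c]mulrC !opprD.
by rewrite (AC ((1*1)*((1*1)*(1*1))*((1*1)*(1*1))) ((1*(3*5)*(7*9))*(2*(4*6)*(8*10)))).
Qed.

Lemma gmode_lin c x w x' w' s k :
  gmode (fun j => c *: x j + x' j) (fun s k => c *: w s k + w' s k) s k =
  c *: gmode x w s k + gmode x' w' s k.
Proof.
rewrite /gmode sol_lin; case: eqP => _; last by rewrite !addr0.
have E1 (p p' q q' : triple) : (c *: p + p') - (c *: q + q') = c *: (p - q) + (p' - q').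
  by rewrite scalerBr opprD (AC ((1*1)*(1*1)) ((1*3)*(2*4))).
rewrite E1 Dt_lin [c *: (sol _ _ _ _ + _)]scalerDr [RHS]addrACA; congr (_ + _).
by rewrite [in RHS]scalerA [c * _]mulrC -scalerA -scalerDr.
Qed.

Lemma gsum_lin c n x w x' w' :
  gsum n (fun j => c *: x j + x' j) (fun s k => c *: w s k + w' s k) =
  c *: gsum n x w + gsum n x' w'.
Proof.
rewrite /gsum /Efam gmode0_lin (E_lin M) scalerDr addrACA; congr (_ + _).
rewrite scaler_sumr -big_split/=; apply: eq_bigr => k _.
by rewrite !gmode_lin !(E_lin M) scalerDr addrACA.
Qed.

Lemma Sol_lin c n x w x' w' : Sol n x w -> Sol n x' w' ->
  Sol n (fun j => c *: x j + x' j) (fun s k => c *: w s k + w' s k).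
Proof.
move=> [h1 h2 h3 h4] [h1' h2' h3' h4']; split => s k; first exact: Ht_lin.
- by move=> nk; rewrite h2// h2'// scaler0 addr0.
- by move=> nk; rewrite h3// h3'// scaler0 addr0.
- by rewrite sol_lin; apply: (Kso_lin GG).
Qed.

(** Solutions for two truncations can be subtracted once both are regarded at the longer one. *)
Lemma Sol_le m n x w : (m <= n)%N -> Sol m x w -> Sol n x w.
Proof.
by move=> mn [h1 h2 h3 h4]; split => // s k nk; [apply: h2|apply: h3];
  exact: leq_ltn_trans nk.
Qed.

Lemma gsum_le m n x w : (m <= n)%N -> Sol m x w -> gsum n x w = gsum m x w.
Proof.
move=> mn [h1 h2 h3 h4]; rewrite /gsum /Efam; congr (_ + _).
rewrite (@big_cat_nat _ _ _ m.+1 1 n.+1)//= [X in _ + X]big_nat_cond [X in _ + X]big1 ?addr0//.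
move=> k; rewrite andbT => /andP[mk kn].
have gz s : gmode x w s k = 0.
  have wz s' l : (k <= l)%N -> w s' l = 0 by move=> kl; apply: h2; exact: leq_trans mk kl.
  rewrite /gmode /sol /res h3// (wz _ _ (leqnn k)) (wz _ _ (leqnSn k)) (wz _ k.+2) ?leqW//.
  rewrite !Dt0 A0 !subr0; case: eqP => k1; last by rewrite addr0.
  by rewrite !(wz _ 1%N) -?k1// subrr Dt0 scaler0 addr0.
by rewrite !gz !E0 addr0.
Qed.

(** A descending recursion: the value at [k] decomposes a vector made from those at [k + 1] and
    [k + 2], so pairs are iterated, starting with zeros above the top frequency. *)
Lemma Sol_exists x n : (forall s k, (n < k)%N -> x (sg s k) = 0) -> exists w, Sol n x w.
Proof.
move=> xn.
have dec s f : exists t, Ht t /\ Kso G s (f - Dt s t).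
  by have [u [ux [uy h]]] := decomposition GG s f; exists (u, ux, uy).
have [d hd] : exists d : bool -> V -> triple, forall s f, Ht (d s f) /\ Kso G s (f - Dt s (d s f)).
  have [d1 h1] := choice (dec true); have [d2 h2] := choice (dec false).
  by exists (fun s => if s then d1 else d2); case.
(* [U s m] holds the values at the frequencies [n + 1 - m] and [n + 2 - m]. *)
pose U s := fix U m : triple * triple := if m is m'.+1 then
  (d s (x (sg s (n - m')) - A (U m').1.1.1 - Dt (~~ s) (U m').2), (U m').1) else (0, 0).
pose w s k := if (k <= n)%N then (U s (n.+1 - k)%N).1 else 0.
have U1 s m : (m <= n.+1)%N -> (U s m).1 = w s (n.+1 - m)%N.
  case: m => [|m] mn; first by rewrite /w subn0 ltnn.
  by rewrite /w subSS leq_subr subSn ?leq_subr// subKn.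
have U2 s m : (m <= n.+1)%N -> (U s m).2 = w s (n.+1 - m).+1.
  case: m => [|m] mn; first by rewrite /w subn0 leqNgt ltnW.
  by rewrite -[LHS]/(U s m).1 U1 ?(ltnW mn)// subSS subSn.
have wE s k : (k <= n)%N -> w s k = d s (x (sg s k) - A (w s k.+1).1.1 - Dt (~~ s) (w s k.+2)).
  move=> kn; rewrite {1}/w kn subSn//=; rewrite U1 ?U2 ?leqW ?leq_subr//.
  by rewrite subKn// subSn ?leq_subr// subKn.
have w0 s k : (n < k)%N -> w s k = 0 by move=> nk; rewrite /w leqNgt nk.
exists w; split => // s k.
  have [kn|nk] := leqP k n; last by rewrite w0//; exact: Ht0.
  by rewrite wE//; case: (hd s (x (sg s k) - A (w s k.+1).1.1 - Dt (~~ s) (w s k.+2))).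
rewrite /sol; have [kn|nk] := leqP k n.
  by rewrite (wE _ _ kn); case: (hd s (res x w s k)).
rewrite /res xn// !w0 ?leqW// !Dt0 A0 !subr0; exact: Kso0.
Qed.

(** * Estimates of the descent *)

Section Bounds.
Variables (n : nat) (x : int -> V) (w : bool -> nat -> triple).
Hypothesis S : Sol n x w.

Let hH s k : Ht (w s k). Proof. by case: S. Qed.
Let w0 s k : (n < k)%N -> w s k = 0. Proof. by case: S => _ h _ _; exact: h. Qed.
Let x0 s k : (n < k)%N -> x (sg s k) = 0. Proof. by case: S => _ _ h _; exact: h. Qed.
Let hK s k : Kso G s (sol x w s k). Proof. by case: S. Qed.

Lemma nm_res s k : nm (res x w s k) ^+ 2 = nm (sol x w s k) ^+ 2 + nm (Dt s (w s k)) ^+ 2.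
Proof. by rewrite -(nm_Kso_Dsg (hK s k) (hH s k)) subrK. Qed.

(** The Lyapunov function of the descent. Normalizing the weight at [k] to 1 makes it satisfy the
    recursion [tailE]. *)
Definition tail s k : R := \sum_(k <= j < n.+1) C ^+ (j - k) * nm (x (sg s j)) ^+ 2.

Lemma tail_ge0 s k : 0 <= tail s k.
Proof. by apply: sumr_ge0 => j _; rewrite mulr_ge0 ?sqr_ge0// exprn_ge0// ltW. Qed.

Lemma tailE s k : (k <= n)%N -> tail s k = nm (x (sg s k)) ^+ 2 + C * tail s k.+1.
Proof.
move=> kn; rewrite /tail big_ltn// subnn mul1r; congr (_ + _).
rewrite mulr_sumr big_nat_cond [RHS]big_nat_cond; apply: eq_bigr => j.
by rewrite andbT => /andP[kj _]; rewrite mulrA -exprS subnSK.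
Qed.

Lemma tail_out s k : (n < k)%N -> tail s k = 0.
Proof. by move=> nk; rewrite /tail big_geq. Qed.

Lemma tail_le s k : C * tail s k.+1 <= tail s k.
Proof.
have [kn|nk] := leqP k n; first by rewrite (tailE _ kn) lerDr sqr_ge0.
by rewrite !tail_out ?leqW// mulr0.
Qed.

(* the contribution at frequency [sg s k] of the two higher frequencies *)
Definition spill s k : R := nm (A (w s k.+1).1.1) + nm (Dt (~~ s) (w s k.+2)).

Lemma nm_res_spill s k : nm (res x w s k) <= nm (x (sg s k)) + spill s k.
Proof. by rewrite /res /spill addrA !(le_trans (nmB _ _))// lerD2r nmB. Qed.

(** Induction from high to low frequencies with both bounds at once: the first one at [k + 1] and
    [k + 2] gives the second at [k] by [descent_step], and this gives the first at [k] by
    [(x + y)^2 <= 2 x^2 + 2 y^2]. *)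
Lemma descent s k : nm (res x w s k) ^+ 2 <= 2 * tail s k /\ spill s k ^+ 2 <= C * tail s k.+1.
Proof.
have [m] := ubnP (n.+1 - k)%N; elim: m k => // m IH k mk.
have [nk|kn] := ltnP n k.
  rewrite /spill /res x0// !w0 ?leqW// !Dt0 A0 !subr0 !nm0 addr0 expr0n/=.
  by split; rewrite mulr_ge0 ?tail_ge0// ltW.
(* The derivative of [w s j] is one of the two orthogonal parts of the residual ([nm_res]), and
   [nm_Dt] permits the opposite derivative. *)
have D2 s' (j : nat) : (k < j)%N -> nm (Dt s' (w s j)) ^+ 2 <= 2 * tail s j.
  move=> kj; have [|h _] := IH j.
    apply: (leq_trans _ (mk : (n.+1 - k <= m)%N)); exact: ltn_sub2l.
  by rewrite (nm_Dt s' s (hH s j)) (le_trans _ h)// nm_res lerDr sqr_ge0.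
have sp : spill s k ^+ 2 <= C * tail s k.+1.
  apply: (descent_step B_ge0 CE (tail_ge0 s k.+2) (tail_le s k.+1)).
    by apply: le_trans (nm_A s (hH s k.+1)) _; rewrite ler_wpM2l ?B_ge0// D2.
  exact: D2.
split => //; apply: (@le_trans _ _ ((nm (x (sg s k)) + spill s k) ^+ 2)).
  by rewrite ler_pXn2r ?nnegrE ?nm_ge0 ?addr_ge0 ?nm_ge0 ?nm_res_spill.
by rewrite (le_trans (sqrD_le _ _))// (tailE _ kn) mulrDr lerD2l ler_pM2l.
Qed.

(** A geometric series: since [4 <= C], each tail is at most a quarter of the preceding one. *)
Lemma tail_sum s k : \sum_(k <= j < n.+1) tail s j <= 4 / 3 * tail s k.
Proof.
have [m] := ubnP (n.+1 - k)%N; elim: m k => // m IH k mk.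
have [nk|kn] := ltnP n k.
  by rewrite big_geq// mulr_ge0 ?tail_ge0// divr_ge0.
rewrite big_ltn//.
have h1 : \sum_(k.+1 <= j < n.+1) tail s j <= 4 / 3 * tail s k.+1.
  apply: IH; apply: (leq_trans _ (mk : (n.+1 - k <= m)%N)); exact: ltn_sub2l.
have h2 : 4 * tail s k.+1 <= tail s k.
  by apply: le_trans (tail_le s k); rewrite ler_wpM2r ?tail_ge0.
exact: tail_step h1 h2.
Qed.

Lemma weightE : weight n x = nm (x 0) ^+ 2 + C * (tail true 1 + tail false 1).
Proof.
rewrite /weight /tail -big_split/= mulr_sumr; congr (_ + _).
rewrite big_nat_cond [RHS]big_nat_cond; apply: eq_bigr => j.
rewrite andbT => /andP[j1 _]; rewrite -mulrDr mulrA -exprS.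
by rewrite -subSn// subn1.
Qed.

(** The mode zero receives a spill from either sign. A sum of three terms costs the factor 3, and
    the two bounds [C * tail s 1] are what [weight] contains besides the mode zero. *)
Lemma nm_gmode0 : nm (gmode0 x w) ^+ 2 <= 3 * weight n x.
Proof.
apply: (@le_trans _ _ ((nm (x 0) + spill true 0 + spill false 0) ^+ 2)).
  rewrite ler_pXn2r ?nnegrE ?nm_ge0 ?addr_ge0 ?nm_ge0//.
  rewrite /gmode0 (le_trans (nmB _ _))//.
  have h1 := nmB (x 0) (Dt false (w true 2) + Dt true (w false 2)).
  have h2 := nmD (Dt false (w true 2)) (Dt true (w false 2)).
  have h3 := nmD (A (w true 1%N).1.1) (A (w false 1%N).1.1).
  rewrite nmZ normc_half.
  exact: gmode0_step h1 h2 h3 (nm_ge0 _) (nm_ge0 _).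
rewrite (le_trans (sqrD3_le _ _ _))// ler_pM2l// weightE -addrA lerD2l mulrDr.
by apply: lerD; [case: (descent true 0)|case: (descent false 0)].
Qed.

(** Each of the frequencies 1 and -1 receives at most half of the sum of the two squared
    derivatives; together this is at most what the decomposition took out of [res] there. *)
Lemma nm_gmode1 : nm (gmode x w true 1) ^+ 2 + nm (gmode x w false 1) ^+ 2 <=
  nm (res x w true 1) ^+ 2 + nm (res x w false 1) ^+ 2.
Proof.
have h s : nm (gmode x w s 1) ^+ 2 <= nm (sol x w s 1) ^+ 2 +
    2^-1 * (nm (Dt true (w true 1%N)) ^+ 2 + nm (Dt false (w false 1%N)) ^+ 2).
  set t := w s 1%N - w (~~ s) 1%N.
  have ht : Ht t by exact: HtB.
  have E1 : gmode x w s 1 = sol x w s 1 + Dsg s (2%:R^-1 *: t.1.2) (2%:R^-1 *: t.2).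
    by rewrite /gmode eqxx DsgZ.
  rewrite E1 (nm_Kso_Dsg (hK s 1) (H10Z GG _ ht)) lerD2l DsgZ nmZ normc_half exprMn.
  have -> : Dsg s t.1.2 t.2 = Dt s (w s 1%N) - Dt s (w (~~ s) 1%N) by exact: DtB.
  have h2 : nm (Dt s (w s 1%N) - Dt s (w (~~ s) 1%N)) ^+ 2 <=
      2 * nm (Dt s (w s 1%N)) ^+ 2 + 2 * nm (Dt s (w (~~ s) 1%N)) ^+ 2.
    apply: le_trans (sqrD_le _ _); rewrite ler_pXn2r ?nnegrE ?addr_ge0 ?nm_ge0//.
    exact: nmB.
  rewrite (nm_Dt s (~~ s) (hH (~~ s) 1%N)) in h2.
  apply: le_trans (ler_wpM2l (sqr_ge0 2^-1) h2) _.
  rewrite le_eqVlt; apply/orP; left; apply/eqP.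
  by case: (s) => /=; field.
rewrite !nm_res; have ht := h true; have hf := h false.
apply: le_trans (lerD ht hf) _.
by rewrite le_eqVlt; apply/orP; left; apply/eqP; field.
Qed.

Lemma nm_gmode_sum k : (0 < k)%N ->
  nm (gmode x w true k) ^+ 2 + nm (gmode x w false k) ^+ 2 <= 2 * (tail true k + tail false k).
Proof.
move=> k0; rewrite mulrDr.
have r s : nm (res x w s k) ^+ 2 <= 2 * tail s k by case: (descent s k).
apply: le_trans (lerD (r true) (r false)).
have [->|k1] := eqVneq k 1%N; first exact: nm_gmode1.
have E1 s : gmode x w s k = sol x w s k by rewrite /gmode (negbTE k1) addr0.
by rewrite !E1; apply: lerD; rewrite nm_res lerDl sqr_ge0.
Qed.

End Bounds.

Lemma absz_sg s k : `|sg s k|%N = k.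
Proof. by rewrite /sg; case: s; rewrite ?abszN absz_nat. Qed.

Lemma sg_neq k : (0 < k)%N -> (sg true k == sg false k) = false.
Proof. by case: k. Qed.

Lemma ip_Efam_out n y0 y j v : (n < `|j|)%N -> ip (Efam n y0 y) (E j v) = 0.
Proof.
move=> nj; rewrite /Efam ipDl (E_ip M).
have -> : (0 == j) = false by apply/eqP => j0; rewrite -j0 in nj.
rewrite add0r ip_suml big_nat_cond big1// => k; rewrite andbT => /andP[_ kn].
have ne s : (sg s k == j) = false.
  by apply/eqP => skj; move: nj; rewrite -skj absz_sg ltnNge -ltnS kn.
by rewrite ipDl !(E_ip M) !ne addr0.
Qed.

Lemma nm_Efam n y0 y : nm (Efam n y0 y) ^+ 2 =
  c0 * (nm y0 ^+ 2 + \sum_(1 <= k < n.+1) (nm (y true k) ^+ 2 + nm (y false k) ^+ 2)).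
Proof.
elim: n => [|n IH]; first by rewrite /Efam !big_geq// !addr0 nm_E.
have -> : Efam n.+1 y0 y = Efam n y0 y + (E (sg true n.+1) (y true n.+1) + E (sg false n.+1) (y false n.+1)).
  by rewrite /Efam big_nat_recr//= addrA.
rewrite nm_sq ip_sqD -nm_sq {}IH ipDr !ip_Efam_out ?absz_sg// addr0 mulr0 addr0.
rewrite ip_sqD [ip (E (sg true _) _) (E (sg false _) _)](E_ip M) sg_neq// mulr0 addr0 -!nm_sq !nm_E.
by rewrite [in RHS]big_nat_recr//= [in RHS]addrA [RHS]mulrDr [X in _ = _ + X]mulrDr.
Qed.

Lemma md_Efam n y0 y i : aeq (md i (Efam n y0 y))
  (if i == 0 then y0 else if (`|i| <= n)%N then y (0 < i) `|i|%N else 0).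
Proof.
have n0 : c0 != 0 by rewrite gt_eqF// (c0_gt0 M).
set r := (X in aeq _ X).
rewrite -[X in aeq X](subrK r) -[X in aeq _ X]add0r.
apply: aeqD; last exact: aeq_refl.
apply: aeq_ip0 => v; apply: (mulfI n0); rewrite mulr0 ipDl ipNl mulrBr -(md_adj M).
apply/eqP; rewrite subr_eq0; apply/eqP; rewrite /r {r}.
have [->|i0] := eqVneq i 0.
  rewrite /Efam ipDl (E_ip M) eqxx ip_suml big_nat_cond big1 ?addr0// => k.
  rewrite andbT => /andP[k1 _]; rewrite ipDl !(E_ip M).
  have ne s : (sg s k == 0) = false by apply/eqP => h; move: k1; rewrite -(absz_sg s k) h.
  by rewrite !ne addr0.
case: leqP => [iN|Ni]; last by rewrite ip_Efam_out// ip0l mulr0.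
have ai : (1 <= `|i| < n.+1)%N by rewrite absz_gt0 i0 ltnS.
rewrite /Efam ipDl (E_ip M) eq_sym (negbTE i0) add0r ip_suml.
rewrite (big_rem `|i|%N)/=; last by rewrite mem_index_iota.
rewrite big_seq_cond big1 ?addr0 => [|k]; last first.
  rewrite andbT rem_filter ?iota_uniq// mem_filter => /andP[/= ki _].
  have ne s : (sg s k == i) = false by apply/eqP => h; move: ki; rewrite -h absz_sg eqxx.
  have neT := ne true; have neF := ne false.
  by rewrite ipDl !(E_ip M) neT neF addr0.
rewrite ipDl !(E_ip M) /sg.
case: i i0 ai iN => [[|k]|k]//= _ _ _.
  by rewrite eqxx addr0.
by rewrite add0r NegzE eqxx.
Qed.

(** [(X + a)] applied to the function of frequency [sg s k] with coefficient [t], seen from the sign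
    [s]: [Dt s] leads away from zero and [Dt (~~ s)] towards it. The lower frequency is a difference
    of integers, which avoids a truncated predecessor. *)
Definition Zterm s k t := E (sg s k.+1) (Dt s t) + E (sg s k - sg s 1) (Dt (~~ s) t) + E (sg s k) (A t.1.1).

Lemma Z_Zterm s k t : Ht t -> Z (Zterm s k t).
Proof.
move=> ht; rewrite /Zterm /sg; case: s => /=.
  have -> : k.+1%:Z = k%:Z + 1 by rewrite -addn1 PoszD.
  exact: (Zgen M).
have -> : - k.+1%:Z = - k%:Z - 1 by rewrite -addn1 PoszD opprD.
by rewrite opprK [X in Z (X + _)]addrC; exact: (Zgen M).
Qed.

Lemma sgS s k : sg s k.+1 - sg s 1 = sg s k.
Proof. by rewrite /sg -addn1 PoszD; case: s; rewrite ?opprD ?opprK addrK. Qed.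

Lemma sub_sub2 (U : zmodType) (a b c : U) : a - (a - b - c) = b + c.
Proof. by rewrite -addrA -opprD subKr. Qed.

Lemma sub_sub3 (U : zmodType) (a b c d : U) : a - (a - b - c - d) = b + c + d.
Proof. by rewrite -2!addrA -!opprD subKr addrA. Qed.

(** The left side groups terms by frequency, the right side by the [w] they come from: [w s k.+1]
    appears at the frequencies [k + 1], [k] and [k - 1], which together form a [Zterm]. What does
    not match is [w s 1], the terms above the top frequency, and the contribution of [w s 2] at
    frequency 0, which lies outside the sum. *)
Lemma telescope_sol x w s m :
  \sum_(1 <= k < m.+2) E (sg s k) (x (sg s k) - sol x w s k) =
  \sum_(1 <= k < m.+1) Zterm s k (w s k.+1) + E (sg s 1) (Dt s (w s 1)) +
  (E (sg s m.+1) (A (w s m.+2).1.1) + E (sg s m.+1) (Dt (~~ s) (w s m.+3)) +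
   E (sg s m) (Dt (~~ s) (w s m.+2))) - E 0 (Dt (~~ s) (w s 2)).
Proof.
have xs k : x (sg s k) - sol x w s k = A (w s k.+1).1.1 + Dt (~~ s) (w s k.+2) + Dt s (w s k).
  rewrite /sol /res; exact: sub_sub3.
elim: m => [|m IH].
  rewrite big_nat1 big_geq// add0r xs !ED /sg; case: s {xs} => /=; rewrite ?oppr0.
  1,2: by rewrite addrA addrK addrC.
rewrite big_nat_recr//= {}IH xs !ED [in RHS]big_nat_recr//= /Zterm sgS.
by rewrite (AC (((1*1)*(1*1*1)*1)*(1*1*1)) (((1*((9*5)*3))*2)*(7*8*4)*6)).
Qed.

Lemma zmod_id (U : zmodType) (b b' a z u d z' u' d' : U) :
  (b + b' + a) + ((z + u - b - d) + (z' + u' - b' - d')) = z + z' + (u - d + (u' - d') + a).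
Proof.
rewrite [LHS](AC ((3)*((4)*(4))) (((1*6)*(2*10))*((4*8)*((5*7)*(9*11)*3)))).
by rewrite /= !subrr !add0r.
Qed.

(** After telescoping, each sign leaves its derivative of [w s 1]. The half differences kept in
    [gmode] reduce both to derivatives of the single average [t]; with the term [A t] subtracted in
    [gmode0] they form one generator of the kernel at frequency 0. *)
Lemma Z_descent n x w : Sol n x w -> Z (fsum n x - gsum n x w).
Proof.
move=> S; have [hH w0 x0 hK] := S.
pose T s := \sum_(1 <= k < n.+1) Zterm s k (w s k.+1).
have TZ s : Z (T s) by apply: Z_sum => k; exact: Z_Zterm.
have TE s : \sum_(1 <= k < n.+1) E (sg s k) (x (sg s k) - sol x w s k) =
    T s + E (sg s 1) (Dt s (w s 1)) - E 0 (Dt (~~ s) (w s 2)).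
  (* The telescoping is used one frequency beyond [n], where all terms vanish. *)
  have := telescope_sol x w s n; rewrite big_nat_recr//= {2}/sol /res x0//.
  have l3 : (n < n.+3)%N by do 2 apply: leqW.
  rewrite (w0 s n.+1)// (w0 s n.+2)// (w0 s n.+3)//.
  by rewrite !Dt0 A0 !subr0 !E0 !addr0.
have GE s : \sum_(1 <= k < n.+1) E (sg s k) (x (sg s k) - gmode x w s k) =
    T s + E (sg s 1) (Dt s (w s 1)) - E 0 (Dt (~~ s) (w s 2))
    - E (sg s 1) (2%:R^-1 *: Dt s (w s 1%N - w (~~ s) 1%N)).
  rewrite -TE.
  (* For [n = 0] the sum lacks the frequency 1, but then [w s 1] vanishes as well. *)
  case: n {T TZ TE} S hH w0 x0 hK => [|n] S hH w0 x0 hK.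
    by rewrite !big_geq// !w0// subrr Dt0 scaler0 E0 subr0.
  rewrite big_ltn// [in RHS]big_ltn// [RHS]addrAC; congr (_ + _).
    rewrite -EB; congr (E _ _).
    by rewrite {1}/gmode eqxx opprD addrA.
  rewrite big_nat_cond [RHS]big_nat_cond; apply: eq_bigr => k.
  by rewrite andbT => /andP[k2 _]; rewrite /gmode (gtn_eqF k2) addr0.
pose t : triple := 2%:R^-1 *: (w true 1%N + w false 1%N).
have ht : Ht t by apply: (H10Z GG); apply: (H10D GG); exact: hH.
have -> : fsum n x - gsum n x w = T true + T false +
    (E (0 + 1) (Dsg true t.1.2 t.2) + E (0 - 1) (Dsg false t.1.2 t.2) + E 0 (A t.1.1)).
  rewrite /fsum /gsum /Efam opprD addrACA -sumrB.
  under eq_bigr do rewrite opprD addrACA -!EB.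
  have GT := GE true; have GF := GE false.
  rewrite -[~~ true]/false in GT; rewrite -[~~ false]/true in GF.
  rewrite big_split/= GT GF -EB /gmode0 sub_sub2 ED ED.
  rewrite zmod_id -[E (0 + 1) _]/(E (sg true 1) (Dt true t)) -[E (0 - 1) _]/(E (sg false 1) (Dt false t)).
  have half s : E (sg s 1) (Dt s (w s 1)) - E (sg s 1) (2%:R^-1 *: Dt s (w s 1%N - w (~~ s) 1%N)) =
      E (sg s 1) (Dt s t).
    rewrite -EB DtB /t DtZ DtD; congr (E _ _).
    by rewrite half_sub; congr (_ *: _); case: s => //=; rewrite addrC.
  have hT := half true; have hF := half false.
  rewrite -[~~ true]/false in hT; rewrite -[~~ false]/true in hF.
  rewrite hT hF; congr (_ + (_ + E 0 _)).
  by rewrite /t /= AZ AD.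
by apply: ZD; [apply: ZD|exact: (Zgen M)].
Qed.

Arguments sg : simpl never.

Lemma addDKB (U : zmodType) (a b c : U) : a + (b + c) - (a + b) = c.
Proof. by rewrite addrA [a + b + c]addrC addrK. Qed.

Lemma nm_gsum n x w : Sol n x w -> nm (gsum n x w) ^+ 2 <= 4 * c0 * weight n x.
Proof.
move=> S; rewrite nm_Efam [4 * c0]mulrC -mulrA ler_pM2l ?(c0_gt0 M)//.
have h0 := nm_gmode0 S.
have h1 : \sum_(1 <= k < n.+1) (nm (gmode x w true k) ^+ 2 + nm (gmode x w false k) ^+ 2) <=
    \sum_(1 <= k < n.+1) 2 * (tail n x true k + tail n x false k).
  rewrite big_nat_cond [X in _ <= X]big_nat_cond; apply: ler_sum => k.
  by rewrite andbT => /andP[k0 _]; exact: nm_gmode_sum.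
rewrite -mulr_sumr [X in _ <= 2 * X]big_split/= in h1.
have hT := tail_sum n x true 1; have hF := tail_sum n x false 1.
have t0 := tail_ge0 n x true 1; have f0 := tail_ge0 n x false 1.
have wE := weightE n x.
apply: gsum_bound (sqr_ge0 (nm (x 0))) C_ge4 t0 f0 wE h0 h1 hT hF.
Qed.

Definition trunc n x j := if (`|j| <= n)%N then x j else 0.

Lemma trunc_sg n x s k : trunc n x (sg s k) = if (k <= n)%N then x (sg s k) else 0.
Proof. by rewrite /trunc absz_sg. Qed.

Lemma trunc_lin n c x x' : trunc n (fun j => c *: x j + x' j) = fun j => c *: trunc n x j + trunc n x' j.
Proof. by apply/funext => j; rewrite /trunc; case: ifP; rewrite // scaler0 addr0. Qed.

Lemma weight_trunc n x : weight n (trunc n x) = weight n x.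
Proof.
rewrite /weight {1}/trunc leq0n; congr (_ + _).
rewrite big_nat_cond [RHS]big_nat_cond; apply: eq_bigr => k.
by rewrite andbT ltnS => /andP[_ kn]; rewrite !trunc_sg kn.
Qed.

Lemma weight_sub m n x : (m <= n)%N ->
  weight n (fun j => (-1) *: trunc m x j + trunc n x j) = weight n x - weight m x.
Proof.
move=> mn; rewrite /weight !(@big_cat_nat _ _ _ m.+1 1 n.+1)//= {1 2}/trunc !leq0n.
rewrite scaleN1r addNr nm0 expr0n add0r.
rewrite [X in X + _ = _]big_nat_cond [X in X + _ = _]big1 => [|k]; last first.
  rewrite andbT ltnS => /andP[_ km]; rewrite !trunc_sg km (leq_trans km mn).
  by rewrite !scaleN1r !addNr !nm0 expr0n addr0 mulr0.
rewrite add0r addDKB.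
rewrite big_nat_cond [RHS]big_nat_cond; apply: eq_bigr => k.
rewrite andbT ltnS => /andP[mk kn]; rewrite !trunc_sg kn leqNgt mk /=.
by rewrite !scaler0 !add0r.
Qed.

Lemma weight_aeq n x x' : (forall j, aeq (x j) (x' j)) -> weight n x = weight n x'.
Proof.
move=> h; rewrite /weight (aeq_nm (h 0)); congr (_ + _).
by apply: eq_bigr => k _; rewrite !(aeq_nm (h _)).
Qed.

(** The hypothesis forces [S] to be monotone, so being bounded it converges. It serves both the
    truncations of the descent and the Fourier sums. *)
Lemma nondecreasing_cauchy (u : nat -> W) (S : nat -> R) (c K : R) : 0 < c ->
  (forall m n, (m <= n)%N -> nm (u n - u m) ^+ 2 <= c * (S n - S m)) ->
  (forall n, S n <= K) -> Hcauchy u.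
Proof.
move=> c_gt0 h SK.
have Smono m n : (m <= n)%N -> S m <= S n.
  by move=> mn; rewrite -subr_ge0 -(pmulr_rge0 _ c_gt0) (le_trans (sqr_ge0 _) (h _ _ mn)).
have Scvg : cvgn S.
  apply: nondecreasing_is_cvgn; first by move=> m n; exact: Smono.
  by exists K => _ [n _ <-].
have Sle n : S n <= limn S by apply: nondecreasing_cvgn_le => // m k; exact: Smono.
move=> e e0; have d0 : 0 < e ^+ 2 / c by rewrite divr_gt0// exprn_gt0.
have [N _ hN] := (@cvgrPdist_lt _ _ _ _ _ S (limn S)).1 Scvg _ d0.
have key m n : (N <= m)%N -> (m <= n)%N -> nm (u n - u m) < e.
  move=> Nm mn; rewrite -(@ltr_pXn2r _ 2) ?nnegrE ?nm_ge0 ?ltW//.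
  apply: le_lt_trans (h _ _ mn) _; rewrite mulrC -ltr_pdivlMr//.
  apply: le_lt_trans (hN _ Nm); rewrite ger0_norm ?subr_ge0//.
  by rewrite lerD2r.
exists N => m n Nm Nn; have [mn|/ltnW nm] := leqP m n; last exact: key.
by rewrite nmBC; exact: key.
Qed.

(* [w] is determined only up to equality almost everywhere, hence a relation. *)
Definition Rel X Y := exists x (w : nat -> bool -> nat -> triple), [/\ forall j, aeq (x j) (md j X),
  forall n, Sol n (trunc n x) (w n) & Hcvg (fun n => gsum n (trunc n x) (w n)) Y].

(** The difference of the solutions for two truncations solves the descent for the frequencies in
    between, whose weight is [weight n - weight m]. The estimate, uniform in the truncation, thus
    makes the sums Cauchy. *)
Lemma Rel_exists X K : (forall n, weight n (md^~ X) <= K) -> exists Y, Rel X Y.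
Proof.
move=> hK; set x := md^~ X.
have ex n : exists w, Sol n (trunc n x) w.
  by apply: Sol_exists => s k nk; rewrite trunc_sg leqNgt nk.
have [w hw] := choice ex.
suff /Hcauchy_cvg[Y hY] : Hcauchy (fun n => gsum n (trunc n x) (w n)).
  by exists Y, x, w; split => // j; exact: aeq_refl.
have c4 : 0 < 4 * c0 by rewrite mulr_gt0// (c0_gt0 M).
apply: nondecreasing_cauchy c4 _ hK => m n mn.
rewrite -(gsum_le mn (hw m)) -weight_sub// -[- gsum _ _ _]scaleN1r addrC -gsum_lin.
by apply: nm_gsum; apply: Sol_lin => //; exact: Sol_le mn (hw m).
Qed.

(** [Rel] admits every choice of [w], so a combination of two choices is again a choice and nothing
    has to be selected linearly. *)
Lemma Rel_lin c X X' Y Y' : Rel X Y -> Rel X' Y' -> Rel (c *: X + X') (c *: Y + Y').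
Proof.
move=> [x [w [h1 h2 h3]]] [x' [w' [h1' h2' h3']]].
exists (fun j => c *: x j + x' j), (fun n s k => c *: w n s k + w' n s k); split.
- move=> j; apply: aeq_trans (aeq_sym (md_lin _ _ _ _)).
  by apply: aeqD => //; exact: aeqZ.
- by move=> n; rewrite trunc_lin; exact: Sol_lin.
- by under eq_fun do rewrite trunc_lin gsum_lin; apply: HcvgD => //; exact: HcvgZ.
Qed.

Lemma Rel_bound X Y K : Rel X Y -> (forall n, weight n (md^~ X) <= K) -> nm Y ^+ 2 <= 4 * c0 * K.
Proof.
move=> [x [w [h1 h2 h3]]] hK; have h := Hcvg_nm h3.
have h' : (fun n => nm (gsum n (trunc n x) (w n)) ^+ 2) @ \oo --> nm Y ^+ 2.
  by under eq_fun do rewrite expr2; rewrite expr2; exact: cvgM.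
apply: ler_cvg_to h' (cvg_cst _) _; near=> n.
apply: le_trans (nm_gsum (h2 n)) _; rewrite ler_pM2l ?mulr_gt0 ?(c0_gt0 M)//.
by rewrite weight_trunc (weight_aeq n h1).
Unshelve. all: by end_near. Qed.

Lemma md0 j : aeq (md j 0) 0.
Proof. by have := md_E j j 0; rewrite E0 eqxx. Qed.

(** The difference [Y - Y'] is related to 0, whose weights vanish; the estimate then makes its norm
    zero. *)
Lemma Rel_unique X Y Y' : Rel X Y -> Rel X Y' -> aeq Y Y'.
Proof.
move=> h h'; have := Rel_lin (-1) h' h; rewrite !scaleN1r addNr addrC => h0.
have /(Rel_bound h0) : forall n, weight n (md^~ 0) <= 0.
  move=> n; rewrite (weight_aeq n md0) /weight nm0 expr0n add0r big1// => k _.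
  by rewrite /= addr0 mulr0.
rewrite mulr0 => le0; apply/eqP; rewrite -sqrf_eq0; apply/eqP/le_anti.
by rewrite le0 sqr_ge0.
Qed.

Lemma fsum_lin n c x x' : fsum n (fun j => c *: x j + x' j) = c *: fsum n x + fsum n x'.
Proof.
rewrite /fsum /Efam (E_lin M) scalerDr addrACA; congr (_ + _).
rewrite scaler_sumr -big_split/=; apply: eq_bigr => k _.
by rewrite !(E_lin M) scalerDr addrACA.
Qed.

Lemma fsum_trunc m n x : (m <= n)%N -> fsum n (trunc m x) = fsum m x.
Proof.
move=> mn; rewrite /fsum /Efam {1}/trunc leq0n; congr (_ + _).
rewrite (@big_cat_nat _ _ _ m.+1 1 n.+1)//= [X in _ + X]big_nat_cond [X in _ + X]big1 ?addr0.
  rewrite big_nat_cond [RHS]big_nat_cond; apply: eq_bigr => k.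
  by rewrite andbT ltnS => /andP[_ km]; rewrite !trunc_sg km.
by move=> k; rewrite andbT => /andP[mk _]; rewrite !trunc_sg leqNgt mk /= !E0 addr0.
Qed.

Lemma E_aeq i u v : aeq u v -> aeq (E i u) (E i v).
Proof.
rewrite /aeq -EB => uv; apply/eqP; rewrite -sqrf_eq0 nm_E uv expr0n mulr0.
exact: eqxx.
Qed.

Lemma Efam_aeq n y0 y0' y y' : aeq y0 y0' -> (forall s k, (0 < k)%N -> aeq (y s k) (y' s k)) ->
  aeq (Efam n y0 y) (Efam n y0' y').
Proof.
move=> h0 h; apply: aeqD; first exact: E_aeq.
rewrite big_nat_cond [X in aeq _ X]big_nat_cond big_mkcond [X in aeq _ X]big_mkcond/=.
apply: aeq_sum => k; case: ifP => [|_]; last exact: aeq_refl.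
by rewrite andbT => /andP[k0 _]; apply: aeqD; apply: E_aeq; exact: h.
Qed.

Lemma Hcvg_eventually (U : semiHilbertType R) (u v : nat -> U) (a : U) N :
  (forall n, (N <= n)%N -> aeq (u n) (v n)) -> Hcvg u a -> Hcvg v a.
Proof.
move=> uv /HcvgP h; apply/HcvgP => e /h[N' hN']; exists (maxn N N') => n.
rewrite geq_max => /andP[Nn /hN']; rewrite (aeq_nm (aeqB (uv _ Nn) (aeq_refl a))).
exact.
Qed.

(** Bessel's inequality bounds the partial sums, which makes them Cauchy. Their limit has the modes
    of [X], hence is at distance zero from [X] by [md_total]. *)
Lemma Fourier_cvg X : Hcvg (fun n => fsum n (md^~ X)) X.
Proof.
set x := md^~ X; pose S n := nm (x 0) ^+ 2 + \sum_(1 <= k < n.+1) (nm (x (sg true k)) ^+ 2 + nm (x (sg false k)) ^+ 2).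
have nS n : nm (fsum n x) ^+ 2 = c0 * S n by exact: nm_Efam.
have ipS n : ip X (fsum n x) = c0 * S n.
  rewrite /fsum /Efam ipDr (md_adj M) -nm_sq ip_sumr /S mulrDr mulr_sumr; congr (_ + _).
  by apply: eq_bigr => k _; rewrite ipDr !(md_adj M) -!nm_sq -mulrDr.
have SK n : S n <= nm X ^+ 2 / c0.
  rewrite ler_pdivlMr ?(c0_gt0 M)// mulrC; have : 0 <= nm (X - fsum n x) ^+ 2 by exact: sqr_ge0.
  rewrite nm_sq ip_sqD ipNl !ipNr opprK ipS -!nm_sq nS.
  exact: le_of_sq.
have /Hcauchy_cvg[Y hY] : Hcauchy (fun n => fsum n x).
  apply: nondecreasing_cauchy (c0_gt0 M) _ SK => m n mn.
  have -> : fsum n x - fsum m x = fsum n (fun j => (-1) *: trunc m x j + trunc n x j).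
    by rewrite fsum_lin !fsum_trunc// scaleN1r addrC.
  rewrite nm_Efam ler_pM2l ?(c0_gt0 M)// /S !(@big_cat_nat _ _ _ m.+1 1 n.+1)//= {1 2}/trunc !leq0n.
  rewrite scaleN1r addNr nm0 expr0n add0r.
  rewrite [X in X + _ <= _]big_nat_cond [X in X + _ <= _]big1 => [|k]; last first.
    rewrite andbT ltnS => /andP[_ km]; rewrite !trunc_sg km (leq_trans km mn).
    by rewrite !scaleN1r !addNr !nm0 expr0n addr0.
  rewrite add0r addDKB.
  rewrite big_nat_cond [X in _ <= X]big_nat_cond; apply: ler_sum => k.
  rewrite andbT ltnS => /andP[mk kn]; rewrite !trunc_sg kn leqNgt mk /=.
  by rewrite !scaler0 !add0r.
have XY : aeq (Y - X) 0.
  apply: (md_total M) => k.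
  have h1 := Hcvg_md k hY.
  have h2 : Hcvg (fun n => md k (fsum n x)) (x k).
    apply: (@Hcvg_eventually _ (fun=> x k) _ _ `|k|%N) (Hcvg_cst _) => n kn.
    apply: aeq_sym; apply: aeq_trans (md_Efam _ _ _ _) _; rewrite kn.
    case: eqP => [->|_]; first exact: aeq_refl.
    by rewrite /sg; case: k {h1} kn => [[|k]|k] _; exact: aeq_refl.
  have h3 : aeq (md k Y) (md k X) by exact: Hcvg_unique h1 h2.
  have := md_lin k (-1) X Y; rewrite !scaleN1r [- X + _]addrC [- md k X + _]addrC => h4.
  apply: aeq_trans h4 _; rewrite -[X in aeq _ X](subrr (md k X)).
  exact: aeqB (aeq_refl _).
apply: Hcvg_aeq hY => [n|]; first exact: aeq_refl.
by have := aeqD XY (aeq_refl X); rewrite subrK add0r.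
Qed.

Lemma Rel_Z X Y : Rel X Y -> Z (X - Y).
Proof.
move=> [x [w [h1 h2 h3]]].
apply: (Z_lim M (u := fun n => fsum n (trunc n x) - gsum n (trunc n x) (w n))).
  by move=> n; apply: Z_descent.
apply: HcvgB => //; apply: Hcvg_aeq (Fourier_cvg X); last exact: aeq_refl.
move=> n; rewrite fsum_trunc//; apply: aeq_sym; apply: Efam_aeq => // s k _; exact: h1.
Qed.

Lemma Hcauchy_eq (U : semiHilbertType R) (u v : nat -> U) :
  (forall m n, nm (v m - v n) <= nm (u m - u n)) -> Hcauchy u -> Hcauchy v.
Proof.
move=> h hu e /hu[N hN]; exists N => m n Nm Nn.
by apply: le_lt_trans (h _ _) _; exact: hN.
Qed.

(** The modes of [Y] are limits of those of the approximations, and [Kso] is closed under limits. At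
    the frequencies 1 and -1 the solenoidal part and the derivative of the half difference have to
    converge separately. *)
Lemma Rel_structure X Y : Rel X Y -> exists t (h : bool -> nat -> V),
  [/\ Ht t, forall s k, (0 < k)%N -> Kso G s (h s k) &
   Hcvg (fun n => E 0 (md 0 Y) + (E 1 (Dt true t) - E (-1) (Dt false t)) +
     \sum_(1 <= k < n.+1) (E (sg true k) (h true k) + E (sg false k) (h false k))) Y].
Proof.
move=> [x [w [_ hS hY]]].
pose p n s k := sol (trunc n x) (w n) s k.
pose t n : triple := 2%:R^-1 *: (w n true 1%N - w n false 1%N).
have hp n s k : Kso G s (p n s k) by case: (hS n) => _ _ _; exact.
have ht n : Ht (t n) by apply: (H10Z GG); apply: HtB; case: (hS n).
have limg s k : (0 < k)%N -> Hcvg (fun n => gmode (trunc n x) (w n) s k) (md (sg s k) Y).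
  move=> k0; apply: (@Hcvg_eventually _ _ _ _ k) (Hcvg_md (sg s k) hY) => n kn.
  apply: aeq_trans (md_Efam _ _ _ _) _; rewrite absz_sg kn.
  have -> : (sg s k == 0) = false by apply/eqP => h; move: k0; rewrite -(absz_sg s k) h.
  rewrite (_ : 0 < sg s k = s); first exact: aeq_refl.
  by rewrite /sg; case: (s); [rewrite ltz_nat|rewrite oppr_gt0 ltNge lez_nat leq0n].
have g1 n s : gmode (trunc n x) (w n) s 1 = p n s 1%N + (if s then 1 else -1) *: Dt s (t n).
  rewrite /gmode eqxx /t DtZ; congr (_ + _); case: s; first by rewrite scale1r.
  rewrite scaleN1r -[in RHS]scalerN; congr (_ *: _).
  by rewrite !DtB opprB.
(* The two parts of the mode are orthogonal, so the norm of a difference of modes dominates that of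
   the derivatives alone. *)
have cDt s : Hcauchy (fun n => Dt s (t n)).
  apply: Hcauchy_eq (Hcvg_cauchy (limg s 1%N isT)) => m n.
  set e : R[i] := if s then 1 else -1.
  have -> : gmode (trunc m x) (w m) s 1 - gmode (trunc n x) (w n) s 1 =
      (p m s 1%N - p n s 1%N) + Dt s (e *: (t m - t n)).
    by rewrite !g1 [Dt s (e *: _)]DtZ [Dt s (t m - t n)]DtB scalerBr opprD addrACA.
  rewrite -(@ler_pXn2r _ 2) ?nnegrE ?nm_ge0// -DtB.
  have hB : Ht (e *: (t m - t n)).
    by apply: (H10Z GG); apply: (H10B GG); exact: ht.
  have kB : Kso G s (p m s 1%N - p n s 1%N) by exact: (KsoB GG).
  rewrite (nm_Kso_Dsg kB hB) -[Dsg s _ _]/(Dt s (e *: (t m - t n))) DtZ [nm (e *: _)]nmZ.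
  have -> : Normc.normc e = 1.
    by rewrite /e; case: (s); rewrite /= ?oppr0 expr0n addr0 ?sqrrN expr1n sqrtr1.
  by rewrite mul1r lerDr sqr_ge0.
have [tw [tx [ty [tH _ hx hy]]]] := H10_cauchy GG ht (cDt true).
pose t0 : triple := (tw, tx, ty).
have cD s : Hcvg (fun n => Dt s (t n)) (Dt s t0) by exact: Hcvg_Dsg.
(* At frequency 1 the mode of [Y] still contains the derivative of [t0], with opposite signs for the
   two values of [s]; it is split off here to form [X_perp g_s]. *)
pose h s k := if k == 1%N then md (sg s 1) Y - (if s then 1 else -1) *: Dt s t0 else md (sg s k) Y.
exists t0, h; split => //.
  move=> s k k0; rewrite /h; case: eqP => [k1|/eqP k1].
    have lim1 : Hcvg (fun n => p n s 1%N) (md (sg s 1) Y - (if s then 1 else -1) *: Dt s t0).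
      have := HcvgB (limg s 1%N isT) (HcvgZ (if s then 1 else -1) (cD s)).
      by under eq_fun do rewrite g1 addrK.
    exact: Kso_lim (fun n => hp n s 1%N) lim1.
  apply: Kso_lim (fun n => hp n s k) _.
  by have := limg s k k0; under eq_fun do rewrite /gmode (negbTE k1) addr0.
apply: (@Hcvg_eventually _ _ _ _ 1%N) (Fourier_cvg Y) => n n1.
have eq_aeq (u v : W) : u = v -> aeq u v by move=> ->; exact: aeq_refl.
apply: eq_aeq.
rewrite /fsum /Efam -[RHS]addrA; congr (_ + _); rewrite big_ltn// [in RHS]big_ltn// addrA; congr (_ + _).
  rewrite {1 2}/h eqxx scale1r scaleN1r opprK EB ED addrACA.
  rewrite -[E 1 _]/(E (sg true 1) (Dt true t0)) -[E (-1) _]/(E (sg false 1) (Dt false t0)).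
  by congr (_ + _); [rewrite addrC subrK|rewrite addrC addrK].
rewrite big_nat_cond [RHS]big_nat_cond; apply: eq_bigr => k.
by rewrite andbT => /andP[k2 _]; rewrite /h (gtn_eqF k2).
Qed.

End Reduction.

(** * Fourier series in the angle *)

Section Steps.
Variable R : realType.
Implicit Types (x y : R) (m n : nat).

Lemma bernoulli_lower x m : 0 <= x -> x <= 1 -> 1 - m%:R * x <= (1 - x) ^+ m.
Proof.
move=> x0 x1; elim: m => [|m IH]; first by rewrite mul0r subr0 expr0.
have h : (1 - m%:R * x) * (1 - x) <= (1 - x) ^+ m * (1 - x) by rewrite ler_wpM2r// subr_ge0.
rewrite exprSr; apply: le_trans h; rewrite -natr1 -subr_ge0.
have -> : (1 - m%:R * x) * (1 - x) - (1 - (m%:R + 1) * x) = m%:R * x ^+ 2 by ring.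
by rewrite mulr_ge0 ?sqr_ge0.
Qed.

Lemma bernoulli_upper x m : 0 <= x -> x <= 1 -> (1 - x) ^+ m * (1 + m%:R * x) <= 1.
Proof.
move=> x0 x1; elim: m => [|m IH]; first by rewrite mul0r addr0 expr0 mulr1.
apply: le_trans IH; rewrite exprSr -mulrA ler_wpM2l ?exprn_ge0 ?subr_ge0//.
rewrite -natr1 -subr_ge0.
have -> : 1 + m%:R * x - (1 - x) * (1 + (m%:R + 1) * x) = (m%:R + 1) * x ^+ 2 by ring.
by rewrite mulr_ge0 ?sqr_ge0// addr_ge0.
Qed.

(* polynomials of values in [0, 1] which approach the Heaviside step at 1/2 *)
Definition step n y := 1 - (1 - y ^+ n) ^+ (2 ^ n).

Lemma step_01 n y : 0 <= y -> y <= 1 -> 0 <= step n y <= 1.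
Proof.
move=> y0 y1; have h : 0 <= 1 - y ^+ n by rewrite subr_ge0 exprn_ile1.
rewrite /step subr_ge0 exprn_ile1 ?gerBl ?exprn_ge0//=.
Qed.

(** Bernoulli's inequality with [x = y^n] and the exponent [2^n]: their product is [(2 y)^n], which
    places the step at 1/2. *)
Lemma step_le n y : 0 <= y -> y <= 1 -> step n y <= (2 * y) ^+ n.
Proof.
move=> y0 y1; rewrite /step lerBlDr -lerBlDl.
have := @bernoulli_lower (y ^+ n) (2 ^ n) (exprn_ge0 _ y0) (exprn_ile1 n y0 y1).
by rewrite natrX -exprMn.
Qed.

Lemma step_ge n y : 0 < y -> y <= 1 -> 1 - (2 * y)^-1 ^+ n <= step n y.
Proof.
move=> y0 y1; rewrite /step lerD2l lerN2.
have := @bernoulli_upper (y ^+ n) (2 ^ n) (exprn_ge0 _ (ltW y0)) (exprn_ile1 n (ltW y0) y1).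
rewrite natrX -exprMn => h.
have p0 : 0 < (2 * y) ^+ n by rewrite exprn_gt0// mulr_gt0.
rewrite exprVn -(ler_pM2r p0) mulVf ?gt_eqF//; apply: le_trans h.
rewrite ler_wpM2l ?lerDr//; first by rewrite exprn_ge0// subr_ge0 exprn_ile1// ltW.
Qed.

Lemma step_cvg0 y : 0 <= y -> y < 2^-1 -> (fun n => step n y) @ \oo --> (0 : R).
Proof.
move=> y0 y1; have y2 : y <= 1 by rewrite (le_trans (ltW y1))// invf_le1// ler1n.
apply: (@squeeze_cvgr _ _ _ _ (cst 0) (fun n => (2 * y) ^+ n)).
- by apply: nearW => n; rewrite step_le// andbT; case/andP: (step_01 n y0 y2).
- exact: cvg_cst.
- by apply: cvg_expr; rewrite ger0_norm ?mulr_ge0//; lra.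
Qed.

Lemma step_cvg1 y : 2^-1 < y -> y <= 1 -> (fun n => step n y) @ \oo --> (1 : R).
Proof.
move=> y1 y2; have y0 : 0 < y by rewrite (lt_trans _ y1)// invr_gt0.
apply: (@squeeze_cvgr _ _ _ _ (fun n => 1 - (2 * y)^-1 ^+ n) (cst 1)).
- by apply: nearW => n; rewrite step_ge//=; case/andP: (step_01 n (ltW y0) y2).
- rewrite -[X in _ --> X](subr0 1); apply: cvgB; first exact: cvg_cst.
  apply: cvg_expr; rewrite ger0_norm ?invr_ge0 ?mulr_ge0 ?(ltW y0)//.
  by rewrite invf_lt1 ?mulr_gt0//; lra.
- exact: cvg_cst.
Qed.

End Steps.

Lemma aeS d (T : ringOfSetsType d) (R : realFieldType) (m : {measure set T -> \bar R}) (P Q : T -> Prop) :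
  (forall x, P x -> Q x) -> {ae m, forall x, P x} -> {ae m, forall x, Q x}.
Proof. by move=> PQ; apply: filterS => //; exact: (ae_filter_ringOfSetsType m). Qed.

Lemma aeS2 d (T : ringOfSetsType d) (R : realFieldType) (m : {measure set T -> \bar R}) (P Q S : T -> Prop) :
  (forall x, P x -> Q x -> S x) ->
  {ae m, forall x, P x} -> {ae m, forall x, Q x} -> {ae m, forall x, S x}.
Proof. by move=> PQ; apply: filterS2 => //; exact: (ae_filter_ringOfSetsType m). Qed.

Lemma Rintegral_lin2 d (T : measurableType d) (R : realType) (nu : {measure set T -> \bar R})
    (D : set T) (a b : R) (f g : T -> R) : measurable D ->
  nu.-integrable D (EFin \o f) -> nu.-integrable D (EFin \o g) ->
  Rintegral nu D (fun t => a * f t + b * g t) = a * Rintegral nu D f + b * Rintegral nu D g.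
Proof.
by move=> mD fi gi; rewrite RintegralD// ?RintegralZl//; exact: integrableZlr.
Qed.

Section TrigTotal.
Variable R : realType.
Local Notation mu := (@lebesgue_measure R).
Definition circle : set R := `[0, 2 * pi[%classic.
Local Notation I := circle.

Lemma measurable_circle : measurable (I : set (measurableTypeR R)).
Proof. exact: measurable_itv. Qed.

Lemma integrableM d (T : measurableType d) (nu : {measure set T -> \bar R}) (D : set T)
    (g h : T -> R) (M : R) : measurable D ->
  nu.-integrable D (fun x => (g x)%:E) -> measurable_fun D h ->
  (forall x, D x -> `|h x| <= M) -> nu.-integrable D (fun x => (g x * h x)%:E).
Proof.
move=> mD ig mh hM.
apply: (@le_integrable _ _ _ nu D mD _ (fun x => (M * g x)%:E)).
- apply/measurable_EFinP; apply: measurable_funM => //.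
  by apply/measurable_EFinP; case/integrableP: ig.
- move=> x Dx; rewrite !abse_EFin lee_fin !normrM mulrC ler_wpM2r//.
  by rewrite (le_trans (hM _ Dx))// ler_norm.
- exact: integrableZlr.
Qed.

Variable g : R -> R.
Hypothesis ig : mu.-integrable I (EFin \o g).
Hypothesis trig0 : forall (k : int) (p : R), Rintegral mu I (fun t => g t * cos (k%:~R * t + p)) = 0.

Let mI := measurable_circle.

(** The multipliers that keep [g] orthogonal to the trigonometric system. The free phase [p] covers
    sines and cosines at once. Boundedness and continuity are carried along for the sake of
    integrability. *)
Definition orth (h : R -> R) := [/\ continuous h, exists M, forall t, `|h t| <= M &
  forall (k : int) (p : R), Rintegral mu I (fun t => g t * h t * cos (k%:~R * t + p)) = 0].

Lemma measurable_cts (h : R -> R) (D : set R) : continuous h -> measurable_fun (D : set (measurableTypeR R)) (h : measurableTypeR R -> measurableTypeR R).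
Proof. by move=> ch; apply: measurable_funTS; exact: continuous_measurable_fun. Qed.

Lemma continuous_cos_affine (a p : R) : continuous (fun t : R => cos (a * t + p)).
Proof.
move=> t; apply: continuous_comp; last exact: continuous_cos.
apply: cvgD; last exact: cvg_cst.
by apply: cvgMr; exact: cvg_id.
Qed.

Lemma orth_integrable h : continuous h -> (exists M, forall t, `|h t| <= M) ->
  mu.-integrable I (fun t => (g t * h t)%:E).
Proof.
move=> ch [M hM]; apply: (@integrableM _ _ _ _ _ _ M) => //; exact: measurable_cts.
Qed.

Lemma orth_integrable_cos h k p : continuous h -> (exists M, forall t, `|h t| <= M) ->
  mu.-integrable I (fun t => (g t * h t * cos (k * t + p))%:E).
Proof.
move=> ch hM; apply: (@integrableM _ _ _ _ _ _ 1) => //.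
- exact: orth_integrable.
- by apply: measurable_cts; exact: continuous_cos_affine.
- by move=> x _; exact: cos_max.
Qed.

Lemma orth1 : orth (fun=> 1).
Proof.
split; first by move=> x; exact: cvg_cst.
  by exists 1 => t; rewrite normr1.
by move=> k p; rewrite -[RHS](trig0 k p); apply: eq_Rintegral => t _; rewrite mulr1.
Qed.

Lemma orth_lin (a b : R) h h' : orth h -> orth h' -> orth (fun t => a * h t + b * h' t).
Proof.
move=> [c1 [M1 b1] i1] [c2 [M2 b2] i2]; split.
- by move=> t; apply: cvgD; apply: cvgMr; [exact: c1|exact: c2].
- exists (`|a| * M1 + `|b| * M2) => t; rewrite (le_trans (ler_normD _ _))//.
  by rewrite !normrM lerD// ler_wpM2l.
- move=> k p.
  transitivity (Rintegral mu I (fun t => a * (g t * h t * cos (k%:~R * t + p)) +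
                                    b * (g t * h' t * cos (k%:~R * t + p)))).
    by apply: eq_Rintegral => t _; ring.
  have j1 := @orth_integrable_cos h k%:~R p c1 (ex_intro _ M1 b1).
  have j2 := @orth_integrable_cos h' k%:~R p c2 (ex_intro _ M2 b2).
  by rewrite RintegralD// ?RintegralZl// ?i1 ?i2 ?mulr0 ?addr0//; exact: integrableZlr.
Qed.

(** By the product formula the new factor replaces the frequency [k] by [k + 1] and [k - 1], with
    shifted phases. *)
Lemma orth_cos (s : R) h : orth h -> orth (fun t => h t * cos (t - s)).
Proof.
move=> [ch [M hM] hi].
have cc : continuous (fun t : R => cos (t - s)).
  by move=> t; have := @continuous_cos_affine 1 (- s) t; under eq_fun do rewrite mul1r.
split.
- by move=> t; apply: cvgM; [exact: ch|exact: cc].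
- exists M => t; rewrite normrM (le_trans _ (hM t))// ler_piMr//; exact: cos_max.
- move=> k p.
  transitivity (Rintegral mu I (fun t =>
    2^-1 * (g t * h t * cos ((k + 1)%:~R * t + (p - s))) +
    2^-1 * (g t * h t * cos ((k - 1)%:~R * t + (p + s))))).
    apply: eq_Rintegral => t _.
    have -> : (k + 1)%:~R * t + (p - s) = (k%:~R * t + p) + (t - s) by rewrite intrD; ring.
    have -> : (k - 1)%:~R * t + (p + s) = (k%:~R * t + p) - (t - s) by rewrite intrB; ring.
    set u := k%:~R * t + p; set v := t - s.
    by rewrite [cos (u + v)]cosD [cos (u - v)]cosB; field.
  have j k' p' := @orth_integrable_cos h k' p' ch (ex_intro _ M hM).
  have j1 := j (k + 1)%:~R (p - s); have j2 := j (k - 1)%:~R (p + s).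
  by rewrite RintegralD// ?RintegralZl// ?hi ?mulr0 ?addr0//; exact: integrableZlr.
Qed.

Lemma orth_ext h h' : h =1 h' -> orth h -> orth h'.
Proof. by move=> /funext ->. Qed.

Section Threshold.
Variables (s c : R).

(** Equal to 1/2 exactly where [cos (t - s) = c]; the slope 1/4 keeps the values in [0, 1] when
    [|c| <= 1]. *)
Definition ramp t : R := 2^-1 + 4^-1 * (cos (t - s) - c).

Lemma orth_ramp h : orth h -> orth (fun t => h t * ramp t).
Proof.
move=> oh; apply: (orth_ext _ (orth_lin 4^-1 (2^-1 - 4^-1 * c) (orth_cos s oh) oh)).
by move=> t; rewrite /ramp; ring.
Qed.

Lemma orth_ramp_exp h n : orth h -> orth (fun t => h t * ramp t ^+ n).
Proof.
move=> oh; elim: n => [|n IH]; first by apply: orth_ext oh => t; rewrite mulr1.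
by apply: orth_ext (orth_ramp IH) => t; rewrite exprSr mulrA.
Qed.

Lemma orth_step n : orth (fun t => step n (ramp t)).
Proof.
have h m : orth (fun t => (1 - ramp t ^+ n) ^+ m).
  elim: m => [|m IH]; first exact: orth1.
  apply: (orth_ext _ (orth_lin 1 (-1) IH (orth_ramp_exp n IH))) => t.
  by rewrite exprSr; ring.
apply: (orth_ext _ (orth_lin 1 (-1) orth1 (h (2 ^ n)%N))) => t.
by rewrite /step; ring.
Qed.

Lemma step_integral0 n : Rintegral mu I (fun t => g t * step n (ramp t)) = 0.
Proof.
case: (orth_step n) => _ _ /(_ 0 0) <-; apply: eq_Rintegral => t _.
by rewrite mul0r addr0 cos0 mulr1.
Qed.

Lemma ramp_01 t : -1 <= c -> c <= 1 -> 0 <= ramp t <= 1.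
Proof.
move=> c1 c2; have h1 := cos_geN1 (t - s); have h2 := cos_le1 (t - s).
by rewrite /ramp; apply/andP; split; lra.
Qed.

End Threshold.

(** The arc from 0 to [b] is a superlevel set of the cosine centred at its midpoint. Away from the
    two end points equality is excluded, so [step] converges there. *)
Lemma cos_arc (b t : R) : 0 < b -> b < 2 * pi -> 0 <= t -> t < 2 * pi -> t != 0 -> t != b ->
  (cos (t - b / 2) > cos (b / 2)) = (t < b) /\ cos (t - b / 2) != cos (b / 2).
Proof.
move=> b0 b2 t0 t2 tn0 tnb; have p0 := pi_gt0 R.
have b4 : b / 2 \in `[0, pi] by rewrite in_itv/=; apply/andP; split; lra.
have t0' : 0 < t by rewrite lt_neqAle eq_sym tn0.
have [tb|tb] := ltP t b.
  have hn : `|t - b / 2| < b / 2 by rewrite ltr_norml; apply/andP; split; lra.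
  have h1 : cos (b / 2) < cos (t - b / 2).
    rewrite -[cos (t - _)]cos_norm ltr_cos// in_itv/= normr_ge0/=.
    by move: b4 hn; rewrite in_itv/= => /andP[_ bp] hn; lra.
  by rewrite h1 gt_eqF.
have tb' : b < t by rewrite lt_neqAle eq_sym tnb.
suff h1 : cos (t - b / 2) < cos (b / 2) by rewrite ltNge (ltW h1)/= lt_eqF.
have [tp|tp] := leP (t - b / 2) pi.
  by rewrite ltr_cos//; [lra|rewrite in_itv/=; apply/andP; split; lra].
(* Past [pi] the cosine increases; a reflection brings the argument back to the interval on which it
   decreases. *)
have -> : cos (t - b / 2) = cos (2 * pi - (t - b / 2)).
  rewrite -[LHS]cosN -cosD2pi; congr cos; rewrite mulr_natl; ring.
by rewrite ltr_cos//; [lra|rewrite in_itv/=; apply/andP; split; lra].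
Qed.

Lemma ae_neq (b : R) : {ae mu, forall t, t != b}.
Proof.
exists [set b]; split; [by []|exact: lebesgue_measure_set1|].
by move=> x /= /negP; rewrite negbK => /eqP.
Qed.

(* [step n] of a trigonometric polynomial tends to the indicator of an arc. *)
Lemma integral_interval0 (b : R) : 0 < b -> b < 2 * pi ->
  (\int[mu]_(t in I) (g t * \1_(`]-oo, b]%classic : set R) t)%:E = 0)%E.
Proof.
move=> b0 b2; set c := cos (b / 2); set s := b / 2.
have c1 : -1 <= c by exact: cos_geN1.
have c2 : c <= 1 by exact: cos_le1.
have mg : measurable_fun I g by apply/measurable_EFinP; case/integrableP: ig.
have mr n : measurable_fun I (fun t => step n (ramp s c t)).
  by case: (orth_step s c n) => ch _ _; exact: measurable_cts.
have mi : measurable_fun I (\1_(`]-oo, b]%classic : set R) : R -> R).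
  by apply: measurable_indic; exact: measurable_itv.
(* The values of [step] lie in [0, 1], so [|g|] dominates. *)
have [|||||_ _] := @dominated_convergence _ _ _ mu I mI
  (fun n t => (g t * step n (ramp s c t))%:E) (fun t => (g t * \1_(`]-oo, b]%classic : set R) t)%:E) (fun t => `|(g t)%:E|%E) _ _ _ _ _.
- by move=> n; apply/measurable_EFinP; exact: (measurable_funM mg (mr n)).
- by apply/measurable_EFinP; exact: (measurable_funM mg mi).
- have := ae_neq b; apply: filterS2 (ae_neq 0); first exact: (ae_filter_ringOfSetsType mu).
  move=> t t0 tb; rewrite /I/= in_itv/= => /andP[t0' t2].
  have [arc neq] := cos_arc b0 b2 t0' t2 t0 tb.
  have /andP[r0 r1] := ramp_01 s t c1 c2.
  apply: cvg_EFin; first exact: nearW.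
  rewrite /= indicE mem_setE in_itv/= le_eqVlt (negbTE tb)/= -arc.
  apply: cvgM; first exact: cvg_cst.
  have [h|h] := ltP; first by apply: step_cvg1 => //; rewrite /ramp ltrDl mulr_gt0 ?subr_gt0.
  apply: step_cvg0 => //; rewrite /ramp gtrDl pmulr_rlt0// subr_lt0.
  by rewrite lt_neqAle neq h.
- exact: integrable_abse.
- apply: aeW => t n It; rewrite !abse_EFin lee_fin normrM ler_piMr//.
  have /andP[r0 r1] := ramp_01 s t c1 c2; have /andP[s0 s1] := step_01 n r0 r1.
  by rewrite ger0_norm.
rewrite (_ : [sequence _]_n = fun=> 0%E) => [/cvg_lim <-//|]; first by rewrite lim_cst.
apply/funext => n /=.
have [cn bn _] := orth_step s c n.
rewrite -[LHS]fineK; first by congr EFin; exact: step_integral0.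
by apply: integrable_fin_num => //; exact: orth_integrable.
Qed.

(** The integral of [g] from 0 to any point of the period vanishes; Lebesgue's differentiation
    theorem recovers [g] from this primitive almost everywhere. *)
Lemma trig_total : {ae mu, forall t, I t -> g t = 0}.
Proof.
pose f : R -> R := g \_ I.
have f_int : mu.-integrable setT (EFin \o f).
  by rewrite /f -restrict_EFin; apply/(integrable_mkcond _ mI).
have locf : locally_integrable setT f by exact: integrable_locally_restrict.
pose F y := (\int[mu]_(t in [set` `[0, y]]) (f t))%R.
have F0 y : 0 < y -> y < 2 * pi -> F y = 0.
  move=> y0 y2; rewrite /F /Rintegral.
  transitivity (fine (\int[mu]_(t in I) (g t * \1_(`]-oo, y]%classic : set R) t)%:E)%E).
    rewrite integral_mkcond [in RHS]integral_mkcond; congr fine.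
    apply: eq_integral => x _; rewrite /f !patchE.
    rewrite indicE mem_setE in_itv/= /I mem_setE in_itv/= [in RHS]mem_setE in_itv/=.
    by case: (0 <= _) => //=; case: (_ <= y); case: (_ < 2 * pi); rewrite ?mulr1 ?mulr0.
  by rewrite integral_interval0.
have h := @lebesgue_differentiation R f locf.
apply: filterS2 h (ae_neq 0); first exact: (ae_filter_ringOfSetsType mu).
move=> x lx x0 Ix; move: (Ix); rewrite /I /= in_itv/= => /andP[x0' x2].
have xp : 0 < x by rewrite lt_neqAle eq_sym x0.
have [|||_] := @FTC1_lebesgue_pt R f (BLeft 0) x (x + 1) _ _ _ lx.
- by rewrite ltrDl.
- exact: integrableS f_int.
- by rewrite /= lte_fin.
rewrite -/F derive1E => dF.
have -> : g x = f x by rewrite /f patchE mem_set.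
rewrite -dF.
rewrite (@near_eq_derive _ _ _ F (cst 0)); first by rewrite derive_cst.
have : \forall y \near x, y \in `]0, (2 * pi)[ by apply: near_in_itvoo; rewrite in_itv/= xp.
by apply: filterS => y; rewrite in_itv/= => /andP[y0 y2]; rewrite F0.
Qed.

End TrigTotal.
Arguments circle R : clear implicits.
Arguments measurable_circle R : clear implicits.
Lemma pi_half_sq (F : numFieldType) (p A : F) : p != 0 ->
  p^-1 * A = (2 * p)^-1 ^+ 2 * (A * (2 * p) + A * (2 * p)).
Proof. by move=> p0; field. Qed.

Lemma fmode_algebra (F : numFieldType) (p a b x y : F) : p != 0 ->
  x * a + y * b = 2 * p * (((2 * p)^-1 * a - 0 * b) * x + ((2 * p)^-1 * b + 0 * a) * y).
Proof. by move=> p0; field. Qed.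

(** * Fubini and Tonelli on rectangles *)

Section Rectangle.
Context d1 d2 (T1 : measurableType d1) (T2 : measurableType d2) (R : realType).
Variables (m1 : {sigma_finite_measure set T1 -> \bar R}) (m2 : {sigma_finite_measure set T2 -> \bar R}).
Variables (D1 : set T1) (D2 : set T2).
Hypotheses (mD1 : measurable D1) (mD2 : measurable D2).
Let mD : measurable (D1 `*` D2). Proof. exact: measurableX. Qed.
Local Notation m12 := (m1 \x m2)%E.

Lemma patch_rect (U : pointedType) (f : T1 * T2 -> U) x :
  (fun y => (f \_ (D1 `*` D2)) (x, y)) =
  if x \in D1 then (fun y => f (x, y)) \_ D2 else fun=> point.
Proof.
apply/funext => y; rewrite patchE; case: (boolP (x \in D1)) => [xD|xD].
  rewrite patchE; congr (if _ then _ else _).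
  apply/idP/idP; rewrite !inE /=; first by case.
  by move=> yD; split => //; exact: set_mem.
case: ifPn => //; rewrite inE /= => -[xD' _].
by rewrite mem_set in xD.
Qed.

Lemma fubini_F_rect (f : T1 * T2 -> \bar R) :
  fubini_F m2 (f \_ (D1 `*` D2)) = (fun x => \int[m2]_(y in D2) f (x, y))%E \_ D1.
Proof.
apply/funext => x; rewrite /fubini_F patch_rect patchE.
by case: ifP => _; rewrite ?integral0// [RHS]integral_mkcond.
Qed.

Lemma measurable_section d3 (T3 : measurableType d3) (f : T1 * T2 -> T3) x :
  measurable_fun (D1 `*` D2) f -> D1 x -> measurable_fun D2 (fun y => f (x, y)).
Proof.
move=> mf Dx _ B mB.
have -> : D2 `&` (fun y => f (x, y)) @^-1` B = xsection ((D1 `*` D2) `&` f @^-1` B) x.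
  rewrite /xsection; apply/seteqP; split => y /=.
    by move=> [Dy By]; rewrite inE.
  by rewrite inE => -[[]].
by apply: measurable_xsection; exact: mf.
Qed.

Section Tonelli.
Variable f : T1 * T2 -> \bar R.
Hypothesis mf : measurable_fun (D1 `*` D2) f.
Hypothesis f0 : forall p, (D1 `*` D2) p -> (0 <= f p)%E.

Let mg : measurable_fun setT (f \_ (D1 `*` D2)). Proof. exact/(measurable_restrictT _ mD). Qed.

Let g0 p : (0 <= (f \_ (D1 `*` D2)) p)%E.
Proof. by rewrite patchE; case: ifP => //; rewrite inE => /f0. Qed.

Lemma tonelli_rect : (\int[m12]_(p in D1 `*` D2) f p = \int[m1]_(x in D1) \int[m2]_(y in D2) f (x, y))%E.
Proof. by rewrite integral_mkcond fubini_tonelli1// fubini_F_rect -integral_mkcond. Qed.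

Lemma measurable_tonelli_rect : measurable_fun D1 (fun x => \int[m2]_(y in D2) f (x, y))%E.
Proof.
apply/(measurable_restrictT _ mD1); rewrite -fubini_F_rect.
exact: measurable_fun_fubini_tonelli_F.
Qed.

Lemma ae_lty_rect : (\int[m12]_(p in D1 `*` D2) f p < +oo)%E ->
  {ae m1, forall x, D1 x -> (\int[m2]_(y in D2) f (x, y) < +oo)%E}.
Proof.
rewrite tonelli_rect => lt.
have h : m1.-integrable D1 (fun x => \int[m2]_(y in D2) f (x, y))%E.
  apply/integrableP; split; first exact: measurable_tonelli_rect.
  rewrite (eq_integral (fun x => \int[m2]_(y in D2) f (x, y))%E)// => x xD.
  rewrite gee0_abs// integral_ge0// => y Dy; apply: f0; split => //.
  exact: set_mem xD.
have := integrable_ae mD1 h; apply: aeS.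
by move=> x h' /h'; rewrite ltey fin_numE => /andP[].
Qed.

End Tonelli.

Section Fubini.
Variable f : T1 * T2 -> R.
Hypothesis fi : m12.-integrable (D1 `*` D2) (EFin \o f).

Let gi : m12.-integrable setT ((EFin \o f) \_ (D1 `*` D2)).
Proof. exact/(integrable_mkcond _ mD). Qed.

Lemma integrable_fubini_rect : m1.-integrable D1 (fun x => \int[m2]_(y in D2) (f (x, y))%:E)%E.
Proof.
apply/(integrable_mkcond _ mD1).
by have := integrable_fubini_F gi; rewrite fubini_F_rect.
Qed.

Lemma measurable_Rintegral_rect : measurable_fun D1 (fun x => Rintegral m2 D2 (fun y => f (x, y))).
Proof.
apply: (@measurableT_comp _ _ _ _ _ _ fine); first exact: fine_measurable.
by have /integrableP[] := integrable_fubini_rect.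
Qed.

Lemma fubini_rect : Rintegral m12 (D1 `*` D2) f =
  Rintegral m1 D1 (fun x => Rintegral m2 D2 (fun y => f (x, y))).
Proof.
rewrite /Rintegral; congr fine.
rewrite integral_mkcond -(integral12_prod_meas1 gi) fubini_F_rect -integral_mkcond.
apply: ae_eq_integral => //.
- by have /integrableP[] := integrable_fubini_rect.
- exact/measurable_EFinP/measurable_Rintegral_rect.
- have := integrable_ae mD1 integrable_fubini_rect.
  move=> h; rewrite /ae_eq; apply: aeS h.
  by move=> x h /h hx; rewrite /= /Rintegral fineK.
Qed.

End Fubini.

Lemma cmeasurable_section (f : T1 * T2 -> R[i]) x :
  cmeasurable (D1 `*` D2) f -> D1 x -> cmeasurable D2 (fun y => f (x, y)).
Proof.
by move=> [h1 h2] Dx; split;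
  [exact: (measurable_section h1 Dx)|exact: (measurable_section h2 Dx)].
Qed.

Lemma sqnorm_rect (f : T1 * T2 -> R[i]) : cmeasurable (D1 `*` D2) f ->
  sqnorm m12 (D1 `*` D2) f = (\int[m1]_(x in D1) sqnorm m2 D2 (fun y => f (x, y)))%E.
Proof.
move=> mf; apply: tonelli_rect; last by move=> p _; rewrite lee_fin sqr_ge0.
exact/measurable_EFinP/cmeasurable_sq.
Qed.

Lemma measurable_sqnorm_rect (f : T1 * T2 -> R[i]) : cmeasurable (D1 `*` D2) f ->
  measurable_fun D1 (fun x => sqnorm m2 D2 (fun y => f (x, y))).
Proof.
move=> mf; apply: (@measurable_tonelli_rect (fun p => (Normc.normc (f p) ^+ 2)%:E)); last by move=> p _; rewrite lee_fin sqr_ge0.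
exact/measurable_EFinP/cmeasurable_sq.
Qed.

Lemma L2_section (f : T1 * T2 -> R[i]) : L2 m12 (D1 `*` D2) f ->
  {ae m1, forall x, D1 x -> L2 m2 D2 (fun y => f (x, y))}.
Proof.
move=> [mf fi].
have h : {ae m1, forall x, D1 x -> (sqnorm m2 D2 (fun y => f (x, y)) < +oo)%E}.
  apply: (@ae_lty_rect (fun p => (Normc.normc (f p) ^+ 2)%:E)) => //; last by move=> p _; rewrite lee_fin sqr_ge0.
  exact/measurable_EFinP/cmeasurable_sq.
apply: aeS h.
by move=> x hx Dx; split; [exact: cmeasurable_section|exact: hx].
Qed.

End Rectangle.

(** * Fourier modes on a product with the circle *)

Section Fourier.
Context d (T : measurableType d) (R : realType).
Variables (m : {sigma_finite_measure set T -> \bar R}) (D : set T).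
Hypotheses (mD : measurable D) (fD : (m D < +oo)%E).
Local Notation mu := (@lebesgue_measure R).
Local Notation I := (circle R).
Local Notation SD := (D `*` I).
Local Notation nu := (m \x mu)%E.
Let mI := measurable_circle R.
Let mSD : measurable (SD : set (T * measurableTypeR R)%type). Proof. exact: measurableX. Qed.
Implicit Types (u : T -> R[i]) (f : T * R -> R[i]) (k : int).

Definition harmonic k u (p : T * R) : R[i] := expi (k%:~R * p.2) * u p.1.

Definition fmode k f (z : T) : R[i] :=
  ((2 * pi)^-1)%:C * Cintegral mu I (fun t => f (z, t) * expi (- (k%:~R * t))).

Lemma lebesgue_circle : mu I = (2 * pi)%:E.
Proof. by rewrite /circle lebesgue_measure_itv/= lte_fin mulr_gt0// ?pi_gt0// sube0. Qed.

Lemma normc_expi (t : R) : Normc.normc (expi t) = 1.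
Proof. by rewrite /expi /= cos2Dsin2 sqrtr1. Qed.

Lemma cmeasurable_expi k (E : set R) : cmeasurable (E : set (measurableTypeR R)) (fun t => expi (k%:~R * t)).
Proof.
have c (a : R) : continuous (fun t : R => a * t) by move=> t; apply: cvgMr; exact: cvg_id.
split; apply: measurable_cts => t; apply: continuous_comp => //.
- exact: c.
- exact: continuous_cos.
- exact: c.
- exact: continuous_sin.
Qed.

Lemma cmeasurable_snd (h : R -> R[i]) : cmeasurable (I : set (measurableTypeR R)) h -> cmeasurable SD (fun p => h p.2).
Proof.
have aux (r : R -> R) : measurable_fun (I : set (measurableTypeR R)) r -> measurable_fun SD (fun p => r p.2).
  move=> mr _ B mB.
  have -> : SD `&` (fun p => r p.2) @^-1` B = D `*` (I `&` r @^-1` B).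
    by apply/seteqP; split => -[z t] /=; [move=> [[? ?] ?]|move=> [? [? ?]]].
  by apply: measurableX => //; exact: mr.
by move=> [h1 h2]; split; [exact: (aux _ h1)|exact: (aux _ h2)].
Qed.

Lemma cmeasurable_fst u : cmeasurable D u -> cmeasurable SD (fun p => u p.1).
Proof.
have aux (r : T -> R) : measurable_fun D r -> measurable_fun SD (fun p => r p.1).
  move=> mr _ B mB.
  have -> : SD `&` (fun p => r p.1) @^-1` B = (D `&` r @^-1` B) `*` I.
    by apply/seteqP; split => -[z t] /=; [move=> [[? ?] ?]|move=> [[? ?] ?]].
  by apply: measurableX => //; exact: mr.
by move=> [h1 h2]; split; [exact: (aux _ h1)|exact: (aux _ h2)].
Qed.

Lemma L2_harmonic k u : L2 m D u -> L2 nu SD (harmonic k u).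
Proof.
move=> [mu' ui]; have mh : cmeasurable SD (harmonic k u).
  apply: cmeasurableM => //; last exact: cmeasurable_fst.
  by apply: (cmeasurable_snd (h := fun t => expi (k%:~R * t))); exact: cmeasurable_expi.
split => //; rewrite sqnorm_rect//.
rewrite (eq_integral (fun x => (2 * pi)%:E * (Normc.normc (u x) ^+ 2)%:E)%E) => [|x _].
  rewrite ge0_integralZl//; first by rewrite lte_mul_pinfty// lee_fin mulr_ge0// pi_ge0.
  - exact/measurable_EFinP/cmeasurable_sq.
  - by move=> x _; rewrite lee_fin sqr_ge0.
  - by rewrite lee_fin mulr_ge0// pi_ge0.
rewrite /sqnorm (eq_integral (fun=> (Normc.normc (u x) ^+ 2)%:E)) => [|t _]; last first.
  by rewrite /harmonic normc_sqM normc_expi expr1n mul1r.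
by rewrite integral_cst// muleC; congr (_ * _)%E; exact: lebesgue_circle.
Qed.

Lemma sqnorm_expi k : L2 mu I (fun t => expi (k%:~R * t)).
Proof.
have fI : (mu I < +oo)%E by rewrite lebesgue_circle ltry.
apply: (@L2_bounded _ _ _ mu I mI 1 _ fI).
  exact: cmeasurable_expi.
by move=> t _; rewrite normc_expi.
Qed.

Lemma rprod_expi (w : R[i]) t : w * expi (- t) = rprod (fun=> w) (fun=> expi t) tt +i*
  rprod (fun=> w) (fun=> 'i * expi t) tt.
Proof.
apply: complex_eq; rewrite /rprod /expi ?cReM ?cImM /= cosN sinN; ring.
Qed.

Lemma fmodeE k f z : fmode k f z = ((2 * pi)^-1)%:C *
  (Rintegral mu I (fun t => rprod f (harmonic k (fun=> 1)) (z, t)) +i*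
   Rintegral mu I (fun t => rprod f (harmonic k (fun=> 'i)) (z, t))).
Proof.
rewrite /fmode /Cintegral; congr (_ * (_ +i* _)); apply: eq_Rintegral => t _;
  rewrite rprod_expi /= /rprod /harmonic ?mulr1// [_ * 'i]mulrC//.
Qed.

Lemma L2_harmonic_cst k (c : R[i]) : L2 nu SD (harmonic k (fun=> c)).
Proof.
apply: L2_harmonic; apply: (@L2_bounded _ _ _ m D mD (Normc.normc c)) => //.
Qed.

Lemma cmeasurable_fmode k f : L2 nu SD f -> cmeasurable D (fmode k f).
Proof.
move=> hf; rewrite (funext (fmodeE k f)); apply: (cmeasurableM (cmeasurable_cst _ _)).
have h c := rprod_integrable mSD hf (L2_harmonic_cst k c).
by split; [exact: (measurable_Rintegral_rect mD mI (h 1))|exact: (measurable_Rintegral_rect mD mI (h 'i))].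
Qed.

Lemma rip_le (f g : R -> R[i]) : L2 mu I f -> L2 mu I g ->
  rip mu I f g ^+ 2 <= rip mu I f f * rip mu I g g.
Proof.
move=> hf hg; have := ip_sq_le (toL2 mu mI f) (toL2 mu mI g).
by rewrite /ip /= !toL2E.
Qed.

(** Cauchy-Schwarz for the real and the imaginary part separately. This doubles the sharp constant
    [(2 pi)^-1], which is harmless since the bound serves to prove square integrability of the
    mode. *)
Lemma normc_fmode_le k f z : L2 mu I (fun t => f (z, t)) ->
  Normc.normc (fmode k f z) ^+ 2 <= pi^-1 * rip mu I (fun t => f (z, t)) (fun t => f (z, t)).
Proof.
pose F : R -> R[i] := fun t => f (z, t); pose G c : R -> R[i] := fun t => expi (k%:~R * t) * c.
move=> hf; have p0 := pi_gt0 R.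
have he c : L2 mu I (G c).
  by have := L2_scale mI c (sqnorm_expi k); under eq_fun do rewrite mulrC.
have h c : Normc.normc c = 1 -> rip mu I F (G c) ^+ 2 <= rip mu I F F * (2 * pi).
  move=> c1; apply: (le_trans (rip_le hf (he c))); rewrite [X in _ * X <= _](_ : _ = 2 * pi)//.
  rewrite unlock; transitivity (Rintegral mu I (fun=> 1)).
    apply: eq_Rintegral => t _; rewrite /rprod -!expr2 -normc_sq normc_sqM normc_expi c1.
    by rewrite expr1n mulr1.
  by rewrite Rintegral_cst// [X in fine X]lebesgue_circle mul1r.
have h1 : rip mu I F (G 1) ^+ 2 <= rip mu I F F * (2 * pi).
  by apply: h; rewrite /= expr0n expr1n addr0 sqrtr1.
have h2 : rip mu I F (G 'i) ^+ 2 <= rip mu I F F * (2 * pi).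
  by apply: h; rewrite /= expr0n expr1n add0r sqrtr1.
have E : Normc.normc (fmode k f z) ^+ 2 = (2 * pi)^-1 ^+ 2 * (rip mu I F (G 1) ^+ 2 + rip mu I F (G 'i) ^+ 2).
  rewrite fmodeE normc_sqM [Normc.normc (_ +i* _) ^+ 2]normc_sq normc_sq /= expr0n addr0.
  by rewrite unlock.
rewrite E pi_half_sq ?gt_eqF//; apply: ler_wpM2l; first exact: sqr_ge0.
by apply: lerD; [exact: h1|exact: h2].
Qed.

Lemma L2_fmode k f : L2 nu SD f -> L2 m D (fmode k f).
Proof.
move=> hf; have [mf fi] := hf; split; first exact: cmeasurable_fmode.
have p0 := pi_gt0 R.
apply: (@le_lt_trans _ _ (\int[m]_(z in D) (pi^-1%:E * sqnorm mu I (fun t => f (z, t))))%E).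
  apply: ge0_le_integral => //.
  - by move=> z _; rewrite lee_fin sqr_ge0.
  - exact/measurable_EFinP/cmeasurable_sq/cmeasurable_fmode.
  - by apply: emeasurable_funM; [exact: measurable_cst|exact: measurable_sqnorm_rect].
  (* The pointwise inequality has to hold at every [z], including those whose section has infinite
     norm. *)
  - move=> z Dz; have [fin|inf] := ltP (sqnorm mu I (fun t => f (z, t))) +oo%E.
      have hz : L2 mu I (fun t => f (z, t)) by split => //; exact: (cmeasurable_section mD mI mf Dz).
      by rewrite rip_sqnorm// -EFinM lee_fin normc_fmode_le.
    move: inf; rewrite leye_eq => /eqP ->; rewrite gt0_muley ?leey//.
    by rewrite lte_fin invr_gt0.
rewrite ge0_integralZl//; last 3 first.
- exact: measurable_sqnorm_rect.
- by move=> z _; exact: sqnorm_ge0.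
- by rewrite lee_fin invr_ge0 ltW.
by rewrite -sqnorm_rect// lte_mul_pinfty// lee_fin invr_ge0 ltW.
Qed.

Lemma fmode_adjoint k f u : L2 nu SD f -> L2 m D u ->
  rip nu SD f (harmonic k u) = 2 * pi * rip m D (fmode k f) u.
Proof.
move=> hf hu; have p0 := pi_gt0 R.
have hi := rprod_integrable mSD hf (L2_harmonic k hu).
have hj := rprod_integrable mD (L2_fmode k hf) hu.
have p2 : 2 * pi != 0 :> R by rewrite mulf_neq0// gt_eqF.
rewrite unlock fubini_rect// -RintegralZl// /Rintegral; congr fine.
apply: ae_eq_integral => //.
- exact/measurable_EFinP/(measurable_Rintegral_rect mD mI hi).
- apply/measurable_EFinP/measurable_funM; first exact: measurable_cst.
  by apply/measurable_EFinP; case/integrableP: hj.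
rewrite /ae_eq; apply: aeS (L2_section mD mI hf) => z hz /hz {}hz.
have he c : L2 mu I (fun t => expi (k%:~R * t) * c).
  by have := L2_scale mI c (sqnorm_expi k); under eq_fun do rewrite mulrC.
have iA := rprod_integrable mI hz (he 1); have iB := rprod_integrable mI hz (he 'i).
congr EFin; rewrite fmodeE.
transitivity (complex.Re (u z) * Rintegral mu I (fun t => rprod f (harmonic k (fun=> 1)) (z, t)) +
  complex.Im (u z) * Rintegral mu I (fun t => rprod f (harmonic k (fun=> 'i)) (z, t))).
  rewrite -RintegralZl// -RintegralZl// -RintegralD//; first last.
  - exact: integrableZlr.
  - exact: integrableZlr.
  apply: eq_Rintegral => t _; rewrite /rprod /harmonic /= /expi.
  by case: (f (z, t)) => a b; case: (u z) => a' b' /=; ring.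
set a := Rintegral _ _ _; set b := Rintegral _ _ _; rewrite cReM cImM /=.
by apply: fmode_algebra; rewrite gt_eqF.
Qed.

Lemma continuous_mul_l (a : R) : continuous (fun t : R => a * t).
Proof. by move=> t; apply: cvgMr; exact: cvg_id. Qed.

Lemma circle_integrable (h : R -> R) : continuous h -> mu.-integrable I (EFin \o h).
Proof.
move=> ch; have := @continuous_compact_integrable R h `[0, 2 * pi]%classic (@segment_compact _ 0 (2 * pi)) (continuous_subspaceT ch).
apply: (@integrableS _ _ _ mu `[0, 2 * pi]%classic I) => //.
by apply: subset_itvl; rewrite bnd_simp.
Qed.

Lemma circle_integral_derive (F f : R -> R) : (forall x : R, is_derive x (1 : R) F (f x)) ->
  continuous f -> F (2 * pi) = F 0 -> Rintegral mu I f = 0.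
Proof.
move=> dF cf per; have p0 := pi_gt0 R.
have cF x : {for x, continuous F}.
  by apply: differentiable_continuous; apply/derivable1_diffP; case: (dF x).
rewrite /circle Rintegral_itv_bndo_bndc; last exact: circle_integrable.
rewrite /Rintegral (@continuous_FTC2 _ f F)//.
- by rewrite per subee.
- by rewrite mulr_gt0.
- exact: continuous_subspaceT.
- split.
  + by move=> x _; case: (dF x).
  + by apply: cvg_at_right_filter; exact: cF.
  + by apply: cvg_at_left_filter; exact: cF.
- by move=> x _; rewrite derive1E; case: (dF x).
Qed.

Lemma cos_int_2pi (k : int) : cos (k%:~R * (2 * pi)) = 1 :> R.
Proof.
have h n : cos (n%:R * (2 * pi)) = 1 :> R.
  rewrite -[RHS](@cos0 R) -(periodicn (@cosD2pi R) n 0) add0r; congr cos.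
  by rewrite !mulr_natl.
case: k => n; first by rewrite h.
by rewrite NegzE mulrNz mulNr cosN h.
Qed.

Lemma sin_int_2pi (k : int) : sin (k%:~R * (2 * pi)) = 0 :> R.
Proof.
have h n : sin (n%:R * (2 * pi)) = 0 :> R.
  rewrite -[RHS](@sin0 R) -(periodicn (@sinD2pi R) n 0) add0r; congr sin.
  by rewrite !mulr_natl.
case: k => n; first by rewrite h.
by rewrite NegzE mulrNz mulNr sinN h oppr0.
Qed.

Lemma continuous_cos_mul (a : R) : continuous (fun t : R => cos (a * t)).
Proof. by move=> t; apply: continuous_comp; [exact: continuous_mul_l|exact: continuous_cos]. Qed.

Lemma continuous_sin_mul (a : R) : continuous (fun t : R => sin (a * t)).
Proof. by move=> t; apply: continuous_comp; [exact: continuous_mul_l|exact: continuous_sin]. Qed.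

Lemma is_derive_trig_mul (F : R -> R) (a x dF : R) : is_derive (a * x) (1 : R) F dF ->
  is_derive x (1 : R) (fun t => F (a * t)) (dF * a).
Proof.
move=> h; have ha : is_derive x (1 : R) (fun t => a * t) a.
  by have := is_deriveZ a (is_derive_id x (1 : R)); rewrite /GRing.scale/= mulr1.
exact: (is_derive1_comp h ha).
Qed.

Lemma integral_cos_int (k : int) : k != 0 -> Rintegral mu I (fun t => cos (k%:~R * t)) = 0.
Proof.
move=> k0; have kR : k%:~R != 0 :> R by rewrite intr_eq0.
apply: (@circle_integral_derive (fun t => k%:~R^-1 * sin (k%:~R * t))) => [x||].
- have h := is_deriveZ (k%:~R^-1 : R) (is_derive_trig_mul (is_derive_sin (k%:~R * x))).
  by apply: is_derive_eq h _; rewrite /GRing.scale/= mulrCA mulVf// mulr1.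
- exact: continuous_cos_mul.
- by rewrite sin_int_2pi !mulr0 sin0 mulr0.
Qed.

Lemma integral_sin_int (k : int) : Rintegral mu I (fun t => sin (k%:~R * t)) = 0.
Proof.
have [->|k0] := eqVneq k 0.
  under eq_Rintegral do rewrite mul0r sin0.
  by rewrite Rintegral_cst ?mul0r.
have kR : k%:~R != 0 :> R by rewrite intr_eq0.
apply: (@circle_integral_derive (fun t => - k%:~R^-1 * cos (k%:~R * t))) => [x||].
- have h := is_deriveZ (- k%:~R^-1 : R) (is_derive_trig_mul (is_derive_cos (k%:~R * x))).
  by apply: is_derive_eq h _; rewrite /GRing.scale/= mulrCA [- _ * k%:~R]mulNr mulVf// mulrN1 opprK.
- exact: continuous_sin_mul.
- by rewrite cos_int_2pi mulr0 cos0.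
Qed.

Lemma fmode_harmonic j k u z : fmode k (harmonic j u) z = if j == k then u z else 0.
Proof.
have p0 := pi_gt0 R; have p2 : 2 * pi != 0 :> R by rewrite mulf_neq0// gt_eqF.
have cI (l : int) : mu.-integrable I (fun t => (cos (l%:~R * t))%:E) by apply: circle_integrable; exact: continuous_cos_mul.
have sI (l : int) : mu.-integrable I (fun t => (sin (l%:~R * t))%:E) by apply: circle_integrable; exact: continuous_sin_mul.
set l := j - k.
have eE (t : R) : expi (j%:~R * t) * u z * expi (- (k%:~R * t)) = expi (l%:~R * t) * u z.
  rewrite /l intrB mulrBl /expi cosN sinN cosB sinB.
  by case: (u z) => a b; apply: complex_eq => /=; ring.
have -> : fmode k (harmonic j u) z = ((2 * pi)^-1)%:C *
   ((complex.Re (u z) * Rintegral mu I (fun t => cos (l%:~R * t)) + (- complex.Im (u z)) * Rintegral mu I (fun t => sin (l%:~R * t))) +i*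
    (complex.Im (u z) * Rintegral mu I (fun t => cos (l%:~R * t)) + complex.Re (u z) * Rintegral mu I (fun t => sin (l%:~R * t)))).
  rewrite /fmode /Cintegral; congr (_ * (_ +i* _)).
    rewrite -(Rintegral_lin2 _ _ mI (cI l) (sI l)).
    by apply: eq_Rintegral => t _; rewrite /harmonic /= eE cReM /=; ring.
  rewrite -(Rintegral_lin2 _ _ mI (cI l) (sI l)).
  by apply: eq_Rintegral => t _; rewrite /harmonic /= eE cImM /=; ring.
rewrite integral_sin_int !mulr0 !addr0.
have [jk|jk] := eqVneq j k.
  rewrite /l jk subrr; under eq_Rintegral do rewrite mul0r cos0.
  rewrite Rintegral_cst// [X in fine X]lebesgue_circle mul1r.
  rewrite /=; case: (u z) => a b; apply: complex_eq => /=.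
    by rewrite mul0r subr0 mulrCA mulVf// mulr1.
  by rewrite mul0r addr0 mulrCA mulVf// mulr1.
rewrite integral_cos_int ?subr_eq0// !mulr0.
by apply: complex_eq => /=; ring.
Qed.

(** Countably many null sets are discarded; for almost every [z] there remains a function on the
    circle all of whose modes vanish, and [trig_total] applies to its real and imaginary parts. *)
Lemma fmode_total f : L2 nu SD f -> (forall k, ae_eq_in m D (fmode k f) (fun=> 0)) ->
  ae_eq_in nu SD f (fun=> 0).
Proof.
move=> hf h0; have [mf fi] := hf; apply: sqnorm_eq0 => //; rewrite sqnorm_rect//.
transitivity (\int[m]_(x in D) (0 : \bar R))%E; last exact: integral0.
apply: ae_eq_integral => //; first exact: measurable_sqnorm_rect.
have hall : {ae m, forall z, forall n : nat, D z -> fmode n%:Z f z = 0 /\ fmode (- n%:Z) f z = 0}.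
  apply/ae_foralln => n; apply: aeS2 (h0 n%:Z) (h0 (- n%:Z)) => z h1 h2 Dz.
  by split; [exact: h1|exact: h2].
rewrite /ae_eq; apply: aeS2 hall (L2_section mD mI hf) => z hz hL Dz; have {}hL := hL Dz.
have {}hz k : fmode k f z = 0.
  case: k => n; first by case: (hz n Dz).
  by rewrite NegzE; case: (hz n.+1 Dz).
have eL c : L2 mu I (fun=> c : R[i]).
  have fI : (mu I < +oo)%E by rewrite lebesgue_circle ltry.
  by apply: (@L2_bounded _ _ _ mu I mI (Normc.normc c) _ fI) => //; exact: cmeasurable_cst.
pose g1 t := complex.Re (f (z, t)); pose g2 t := complex.Im (f (z, t)).
have i1 : mu.-integrable I (EFin \o g1).
  have := rprod_integrable mI hL (eL 1).
  by under eq_fun do rewrite /rprod /= mulr1 mulr0 addr0.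
have i2 : mu.-integrable I (EFin \o g2).
  have := rprod_integrable mI hL (eL 'i).
  by under eq_fun do rewrite /rprod /= mulr1 mulr0 add0r.
have ic (g : R -> R) (a : R) : mu.-integrable I (EFin \o g) -> mu.-integrable I (fun t => (g t * cos (a * t))%:E).
  move=> ig; apply: (@integrableM _ _ _ _ _ _ _ 1) => //.
    by apply: measurable_cts; exact: continuous_cos_mul.
  by move=> t _; exact: cos_max.
have is_ (g : R -> R) (a : R) : mu.-integrable I (EFin \o g) -> mu.-integrable I (fun t => (g t * sin (a * t))%:E).
  move=> ig; apply: (@integrableM _ _ _ _ _ _ _ 1) => //.
    by apply: measurable_cts; exact: continuous_sin_mul.
  by move=> t _; exact: sin_max.
pose c (g : R -> R) (k : int) := Rintegral mu I (fun t => g t * cos (k%:~R * t)).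
pose s (g : R -> R) (k : int) := Rintegral mu I (fun t => g t * sin (k%:~R * t)).
have cN g k : c g (- k) = c g k by apply: eq_Rintegral => t _; rewrite mulrNz mulNr cosN.
have sN g k : mu.-integrable I (EFin \o g) -> s g (- k) = - s g k.
  move=> ig; have j := is_ g k%:~R ig; transitivity (-1 * s g k); last by rewrite mulN1r.
  rewrite /s -RintegralZl//; apply: eq_Rintegral => t _.
  by rewrite mulrNz mulNr sinN mulrN mulN1r.
(* One complex equation per frequency, which couples the coefficients of the real part with those of
   the imaginary part. *)
have AB k : c g1 k + s g2 k = 0 /\ c g2 k - s g1 k = 0.
  have p2 : ((2 * pi)^-1)%:C != 0 :> R[i].
    by rewrite eq_complex /= eqxx andbT invr_eq0 mulf_neq0// gt_eqF// pi_gt0.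
  have /eqP := hz k; rewrite fmodeE mulf_eq0 (negbTE p2)/= eq_complex/= => /andP[/eqP h1 /eqP h2].
  have c1 := ic g1 k%:~R i1; have s1 := is_ g1 k%:~R i1.
  have c2 := ic g2 k%:~R i2; have s2 := is_ g2 k%:~R i2.
  split; [rewrite -h1|rewrite -h2]; rewrite /c /s.
    rewrite -[RHS]addr0 -[X in X + _ = _]mul1r -[X in _ + X = _]mul1r -(Rintegral_lin2 _ _ mI c1 s2) addr0.
    by apply: eq_Rintegral => t _; rewrite /rprod /harmonic /= /expi /g1 /g2; case: (f (z, t)) => x y /=; ring.
  rewrite -[X in X - _ = _]mul1r -mulN1r -(Rintegral_lin2 _ _ mI c2 s1).
  by apply: eq_Rintegral => t _; rewrite /rprod /harmonic /= /expi /g1 /g2; case: (f (z, t)) => x y /=; ring.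
have A k := (AB k).1; have B k := (AB k).2.
(* The equations for [k] and [- k] decouple them, as cosine coefficients are even and sine
   coefficients odd in [k]. *)
have z1 k : c g1 k = 0 /\ s g1 k = 0.
  by have := A k; have := A (- k); have := B k; have := B (- k); rewrite !cN !(sN _ _ i1) !(sN _ _ i2); split; lra.
have z2 k : c g2 k = 0 /\ s g2 k = 0.
  by have := A k; have := A (- k); have := B k; have := B (- k); rewrite !cN !(sN _ _ i1) !(sN _ _ i2); split; lra.
have tr (g : R -> R) : mu.-integrable I (EFin \o g) -> (forall k, c g k = 0 /\ s g k = 0) ->
    {ae mu, forall t, I t -> g t = 0}.
  move=> ig h; apply: trig_total => // k p; have [hc hs] := h k.
  transitivity (cos p * c g k + (- sin p) * s g k); last by rewrite hc hs !mulr0 addr0.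
  have j1 := ic g k%:~R ig; have j2 := is_ g k%:~R ig.
  rewrite /c /s -(Rintegral_lin2 _ _ mI j1 j2).
  by apply: eq_Rintegral => t _; rewrite cosD; ring.
transitivity (sqnorm mu I (fun=> 0 : R[i])); last first.
  rewrite /sqnorm; under eq_integral do rewrite /= expr0n addr0 sqrtr0 expr0n.
  exact: integral0.
have [mz _] := hL; apply: eq_sqnorm => //.
apply: aeS2 (tr _ i1 z1) (tr _ i2 z2) => t h1 h2 It.
by apply: complex_eq; [exact: h1|exact: h2].
Qed.

End Fourier.

(** * Integration along lines *)

Section Elementary.
Variable R : realType.
Implicit Types d p u v a : R.

Lemma half_pi_gt d p : d <= 2^-1 -> 2 <= p -> d < p / 2. Proof. lra. Qed.

Lemma half_pi_sub d p : 0 < d -> d < p / 2 -> - (p / 2) < p / 2 - d < p / 2.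
Proof. by move=> ? ?; apply/andP; split; lra. Qed.

Lemma le_sub_of_lt u v a p : 0 + u < p - a -> v <= u -> a <= p - v. Proof. lra. Qed.

End Elementary.

Section OneDimensional.
Variable R : realType.
Local Notation mR := (measurableTypeR R).
Local Notation mu := (@lebesgue_measure R).
Implicit Types (N S : set mR).

Lemma interval_cover N (e : R) : mu N = 0%E -> 0 < e ->
  exists F : nat -> R * R, N `<=` \bigcup_k `](F k).1, (F k).2[%classic /\
    (\sum_(0 <= k <oo) mu `](F k).1, (F k).2[%classic <= e%:E)%E.
Proof.
move=> N0 e0; have l0 : ((@wlength R idfun)^* N)%mu = 0%E by exact: N0.
have fl : ((@wlength R idfun)^* N)%mu \is a fin_num by rewrite l0.
move: (fl); rewrite outer_measure_open_itv_cover.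
move=> /lb_ereal_inf_adherent-/(_ _ e0)[_/= [I [hI NI]] <- Ie].
have [F hF] := choice hI.
exists F; split.
  by move=> x /NI[k _ kx]; exists k => //; rewrite -hF.
move: Ie; rewrite -outer_measure_open_itv_cover l0 add0e => /ltW; apply: le_trans.
apply: lee_nneseries => // i _; rewrite hF.
by rewrite wlength_itv/= -(@lebesgue_measure_itv R `](F i).1, (F i).2[).
Qed.

(** Where [h] expands distances by at least [c], the part of [S] sent into an interval of length [l]
    fits into one of length [2 l / c]; a cover of [N] of small total length is pulled back in this
    way. *)
Lemma null_preimage (h : R -> R) S (c : R) N : measurable S -> measurable_fun (setT : set mR) (h : mR -> mR) ->
  0 < c -> (forall x y, S x -> S y -> c * `|x - y| <= `|h x - h y|) ->
  measurable N -> mu N = 0%E -> mu (S `&` h @^-1` N) = 0%E.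
Proof.
move=> mS mh c0 hc mN N0.
have mp (A : set mR) : measurable A -> measurable (S `&` h @^-1` A).
  by move=> mA; apply: measurableI => //; rewrite -[X in measurable X]setTI; exact: mh.
apply/eqP; rewrite eq_le measure_ge0 andbT; apply/lee_addgt0Pr => e e0; rewrite add0e.
have e2 : 0 < c / 2 * e by rewrite mulr_gt0// divr_gt0.
have [F [NF Fe]] := interval_cover N0 e2.
pose I k : set mR := `](F k).1, (F k).2[%classic.
have mI k : measurable (I k) by exact: measurable_itv.
have le1 : (mu (S `&` h @^-1` N) <= \sum_(0 <= k <oo) mu (S `&` h @^-1` (I k)))%E.
  apply: measure_sigma_subadditive => //; first by move=> k; exact: mp.
    exact: mp.
  by move=> x [Sx /NF[k _ kx]]; exists k.
apply: (le_trans le1).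
have le2 k : (mu (S `&` h @^-1` (I k)) <= (2 / c)%:E * mu (I k))%E.
  have [->|/set0P[x0 [Sx0 hx0]]] := eqVneq (S `&` h @^-1` (I k)) set0.
    by rewrite measure0 mule_ge0// lee_fin divr_ge0// ltW.
  move: hx0; rewrite /I/= in_itv/= => /andP[ax0 x0b].
  have ab : (F k).1 < (F k).2 by exact: lt_trans x0b.
  pose r := ((F k).2 - (F k).1) / c.
  apply: (@le_trans _ _ (mu `[x0 - r, x0 + r]%classic)).
    apply: le_measure; rewrite ?inE; [exact: mp|exact: measurable_itv|].
    move=> x [Sx]; rewrite /I/= !in_itv/= => /andP[ax xb].
    rewrite -ler_distl /r ler_pdivlMr// mulrC; apply: (le_trans (hc _ _ Sx Sx0)).
    by rewrite ler_norml; apply/andP; split; lra.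
  have r0 : 0 < r by rewrite divr_gt0// subr_gt0.
  rewrite !lebesgue_measure_itv/= !lte_fin ab.
  have -> : x0 - r < x0 + r by lra.
  rewrite -!EFinD -EFinM lee_fin le_eqVlt; apply/orP; left; apply/eqP.
  by rewrite /r; field; rewrite gt_eqF.
apply: le_trans (lee_nneseries _ (fun k _ => le2 k)) _ => //.
rewrite nneseriesZl//.
apply: le_trans (lee_wpmul2l _ Fe) _; first by rewrite lee_fin divr_ge0// ltW.
rewrite -EFinM lee_fin le_eqVlt; apply/orP; left; apply/eqP.
by field; rewrite gt_eqF.
Qed.

Lemma sin_expand (d x y : R) : 0 < d -> `|x| <= pi / 2 - d -> `|y| <= pi / 2 - d ->
  cos (pi / 2 - d) * `|x - y| <= `|sin x - sin y|.
Proof.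
move=> d0; wlog xy : x y / x < y => [wl hx hy|hx hy].
  have [xy|xy|->] := ltgtP x y; last by rewrite !subrr normr0 mulr0.
    exact: wl.
  by rewrite distrC [leRHS]distrC; exact: wl.
have [|c cxy] := @MVT R sin cos x y xy (fun z _ => is_derive_sin z).
  exact/continuous_subspaceT/continuous_sin.
rewrite distrC => sE; rewrite [leRHS]distrC sE normrM ler_wpM2r//.
move: cxy; rewrite in_itv/= => /andP[xc cy].
have cn : `|c| <= pi / 2 - d.
  by rewrite ler_norml; move: hx hy; rewrite !ler_norml => /andP[? ?] /andP[? ?]; apply/andP; split; lra.
have p0 := pi_gt0 R.
apply: le_trans (ler_norm _); rewrite -[leRHS]cos_norm leNgt ltr_cos -?leNgt//.
  by rewrite in_itv/=; have h := normr_ge0 c; apply/andP; split; lra.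
by rewrite in_itv/= normr_ge0/=; lra.
Qed.

(** The chord with fan-beam angle [alpha] has offset [sin alpha], so null sets of offsets must pull
    back to null sets of angles. The derivative vanishes at the two end points; they are removed,
    and the rest is exhausted by intervals on which [sin] expands. *)
Lemma sin_null_preimage N : measurable N -> mu N = 0%E ->
  mu (`[- (pi / 2), pi / 2]%classic `&` sin @^-1` N) = 0%E.
Proof.
move=> mN N0; have p0 := pi_gt0 R.
have ms : measurable_fun (setT : set mR) (sin : mR -> mR).
  by apply: continuous_measurable_fun; exact: continuous_sin.
(* The index [n + 2] keeps the margin at most 1/2, hence below [pi / 2]. *)
pose S (n : nat) : set mR := `[- (pi / 2 - n.+2%:R^-1), pi / 2 - n.+2%:R^-1]%classic.
have mS n : measurable (S n) by exact: measurable_itv.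
have nS n : mu (S n `&` sin @^-1` N) = 0%E.
  have d0 : 0 < n.+2%:R^-1 :> R by rewrite invr_gt0.
  have d1 : n.+2%:R^-1 < pi / 2 :> R.
    have : 2 <= pi :> R by exact: pi_ge2.
    have : n.+2%:R^-1 <= 2^-1 :> R by rewrite lef_pV2 ?posrE// ler_nat.
    by move=> h1 h2; exact: half_pi_gt h1 h2.
  apply: (@null_preimage _ _ (cos (pi / 2 - n.+2%:R^-1))) => //.
    exact: cos_gt0_pihalf (half_pi_sub d0 d1).
  move=> x y; rewrite /S/= !in_itv/= -!ler_norml => hx hy.
  exact: sin_expand.
have ng : mu.-negligible (`[- (pi / 2), pi / 2]%classic `&` sin @^-1` N).
  have sub : (`[- (pi / 2), pi / 2]%classic `&` sin @^-1` N : set mR) `<=`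
      (([set - (pi / 2)] `|` [set pi / 2]) `|` \bigcup_n (S n `&` sin @^-1` N) : set mR).
    move=> x [/= xI xN]; move: xI; rewrite in_itv/= -ler_norml => xI.
    have [->|xl] := eqVneq x (- (pi / 2)); first by left; left.
    have [->|xr] := eqVneq x (pi / 2); first by left; right.
    have xlt : 0 < pi / 2 - `|x|.
      rewrite subr_gt0 lt_neqAle xI andbT; apply/eqP => xE.
      by have [x0|x0] := leP 0 x; [rewrite ger0_norm// in xE; rewrite xE eqxx in xr|
        rewrite ltr0_norm// in xE; rewrite -xE opprK eqxx in xl].
    have [n hn] := ltr_add_invr xlt.
    right; exists n => //; split => //; rewrite /S/= in_itv/= -ler_norml.
    have : n.+2%:R^-1 <= n.+1%:R^-1 :> R by rewrite lef_pV2 ?posrE// ler_nat.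
    exact: le_sub_of_lt hn.
  apply: negligibleS sub _; apply: negligibleU.
    apply: negligibleU; apply/negligibleP => //; exact: lebesgue_measure_set1.
  apply: negligible_bigcup => n; apply/negligibleP; last exact: nS.
  by apply: measurableI => //; rewrite -[X in measurable X]setTI; exact: ms.
apply: measure_negligible ng.
apply: measurableI; first exact: measurable_itv.
by rewrite -[X in measurable X]setTI; exact: ms.
Qed.

(** Lebesgue measure equals [|p|] times its pushforward by the affine map: the two agree on
    half-open intervals, up to exchanged end points when [p < 0], and uniqueness concludes. *)
Lemma integral_affine (g : mR -> \bar R) (p q : R) : p != 0 -> measurable_fun setT g ->
  (forall x, (0 <= g x)%E) ->
  (\int[mu]_x g x = `|p|%:E * \int[mu]_x g (p * x + q)%R)%E.
Proof.
move=> p0 mg g0; pose phi : mR -> mR := fun x => p * x + q.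
have mphi : measurable_fun setT phi.
  apply: continuous_measurable_fun => x; apply: cvgD; last exact: cvg_cst.
  by apply: cvgMr; exact: cvg_id.
pose k : {nonneg R} := NngNum (normr_ge0 p).
pose nu : {measure set mR -> \bar R} := mscale k (pushforward mu phi).
have E A : measurable A -> mu A = nu mphi A.
  apply: lebesgue_measure_unique => _ [[a b] _ <-] /=.
  rewrite /mscale /= -[pushforward _ _ _]/(mu (phi @^-1` `]a, b]%classic)).
  have [ab|ba] := ltP a b; last first.
    rewrite set_itv_ge ?preimage_set0 ?measure0 ?mule0// bnd_simp -leNgt//.
  have [pp|pn] := ltP 0 p.
    have -> : phi @^-1` `]a, b] = `](a - q) / p, (b - q) / p]%classic.
      apply/seteqP; split => x /=; rewrite !in_itv/= /phi ltr_pdivrMr// ler_pdivlMr// [x * p]mulrC ltrBlDr lerBrDr//.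
    rewrite !lebesgue_measure_itv/= !lte_fin ab ltr_pM2r ?invr_gt0// ltrD2r ab.
    rewrite -!EFinD -EFinM gtr0_norm//; congr EFin; field; exact: p0.
  have pn' : p < 0 by rewrite lt_neqAle p0.
  have -> : phi @^-1` `]a, b] = `[(b - q) / p, (a - q) / p[%classic.
    by apply/seteqP; split => x /=; rewrite !in_itv/= /phi ler_ndivrMr// ltr_ndivlMr// [x * p]mulrC ltrBlDr lerBrDr// andbC.
  rewrite !lebesgue_measure_itv/= !lte_fin ab ltr_nM2r ?invr_lt0// ltrD2r ab.
  by rewrite -!EFinD -EFinM ltr0_norm//; congr EFin; field; exact: p0.
transitivity (\int[nu mphi]_x g x)%E.
  by apply: eq_measure_integral => A mA _; exact: E.
rewrite ge0_integral_mscale//; congr (_ * _)%E.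
by rewrite ge0_integral_pushforward// preimage_setT.
Qed.

End OneDimensional.

(** * Rotated coordinates and integrals over lines *)

Section Rotation.
Variable R : realType.
Local Notation mR := (measurableTypeR R).
Local Notation mplane := (mR * mR)%type.
Local Notation mu := (@lebesgue_measure R).
Local Notation mu2 := (mu \x mu)%E.
Implicit Types (A N : set mR) (y s t : R) (p : mplane).

(** A named copy of the product measure that carries a sigma-finite structure, so that Fubini can be
    applied once more to plane times angle. *)
Definition plane_measure : set (mR * mR)%type -> \bar R := (mu \x mu)%E.
HB.instance Definition _ := Measure.copy plane_measure (mu \x mu)%E.
Lemma plane_measure_sigma_finite : sigma_finite setT plane_measure.
Proof.
exists (fun n : nat => `[- n%:R, n%:R]%classic `*` `[- n%:R, n%:R]%classic).
  apply/seteqP; split => // -[x y] _.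
  have [n hn] : exists n : nat, Num.max `|x| `|y| <= n%:R.
    by exists (Num.bound (Num.max `|x| `|y|)); apply: ltW; rewrite archi_boundP// le_max normr_ge0.
  move: hn; rewrite ge_max => /andP[hx hy]; exists n => //=.
  by rewrite !in_itv/= -!ler_norml.
move=> n; split.
  by apply: measurableX; exact: measurable_itv.
rewrite /plane_measure product_measure1E; [|exact: measurable_itv|exact: measurable_itv].
have fin : (mu (`[(- n%:R)%R, n%:R%R]%classic : set mR) < +oo)%E.
  by apply: compact_finite_measure; exact: segment_compact.
apply: lte_mul_pinfty; [exact: (measure_ge0 mu)| |exact: fin].
by rewrite ge0_fin_numE; [exact: fin|exact: (measure_ge0 mu)].
Qed.
HB.instance Definition _ := Measure_isSigmaFinite.Build _ _ _ plane_measure plane_measure_sigma_finite.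
Definition area_sf : {sigma_finite_measure set (mR * mR)%type -> \bar R} := plane_measure.
Definition rot (th : R) (p : R * R) : R * R :=
  (p.1 * cos th - p.2 * sin th, p.1 * sin th + p.2 * cos th).

Lemma measurable_ctsT (h : R -> R) : continuous h -> measurable_fun setT (h : mR -> mR).
Proof. exact: continuous_measurable_fun. Qed.

Lemma measurable_rot d (T : measurableType d) (a b c : T -> mR) :
  measurable_fun setT a -> measurable_fun setT b -> measurable_fun setT c ->
  measurable_fun setT (fun x => rot (c x) (a x, b x) : mplane).
Proof.
move=> ma mb mc.
have mcos : measurable_fun setT (fun x => cos (c x) : mR).
  by apply: (measurableT_comp (measurable_ctsT (@continuous_cos R))).
have msin : measurable_fun setT (fun x => sin (c x) : mR).
  by apply: (measurableT_comp (measurable_ctsT (@continuous_sin R))).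
apply: measurable_fun_pair => /=.
- by apply: measurable_funB; apply: measurable_funM.
- by apply: measurable_funD; apply: measurable_funM.
Qed.

(* The two coordinates are replaced one after the other by affine substitutions. *)
Lemma rotation_integral (F : mplane -> \bar R) (th : R) : measurable_fun setT F ->
  (forall z, (0 <= F z)%E) -> sin th != 0 ->
  (\int[mu]_y \int[mu]_s F (rot th (s, y)) = \int[mu2]_z F z)%E.
Proof.
move=> mF F0 sn; set c := cos th; set g := sin th in sn *.
have gn : g^-1 != 0 by rewrite invr_eq0.
have c2 : c ^+ 2 = 1 - g ^+ 2 by rewrite -(cos2Dsin2 th) addrK.
have n0 (q : R) : (0 <= q%:E * 0)%E by rewrite mule0.
have mrot : measurable_fun setT (fun q : mplane => F (rot th q)).
  apply: (measurableT_comp mF).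
  have := @measurable_rot _ mplane fst snd (fun=> th) measurable_fst measurable_snd (measurable_cst _).
  by apply: eq_measurable_fun => -[].
have msh : measurable_fun setT (fun q : mplane => F (q.2, g^-1 * q.1 - c * q.2 / g)).
  apply: (measurableT_comp mF); apply: measurable_fun_pair => //.
  apply: measurable_funB; apply: measurable_funM => //.
  exact: measurable_funM.
transitivity (\int[mu]_s \int[mu]_y F (rot th (s, y)))%E.
  exact: (esym (@fubini_tonelli _ _ _ _ R mu mu (fun q => F (rot th q)) mrot (fun q => F0 _))).
transitivity (\int[mu]_s (`|g|^-1%:E * \int[mu]_x F (x, (g^-1 * s - c * x / g)%R)))%E.
  apply: eq_integral => s _.
  have mg : measurable_fun setT (fun x : mR => F (x, g^-1 * s - c * x / g)).
    exact: (measurableT_comp msh (pair1_measurable s)).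
  (* At fixed [s], the first coordinate [x = s c - y g] replaces [y]; the second one is then
     [(s - c x) / g]. *)
  rewrite (@integral_affine R (fun x => F (x, (g^-1 * s - c * x / g)%R)) (- g) (s * c))//.
    rewrite muleA normrN -EFinM mulVf ?normr_eq0// mul1e.
    apply: eq_integral => y _; congr F; rewrite /rot /= -/c -/g.
    congr pair; first by rewrite mulNr addrC mulrC [g * y]mulrC.
    have -> : g^-1 * s - c * (- g * y + s * c) / g = g^-1 * s * (1 - c ^+ 2) + c * y * (g / g) by ring.
    have -> : 1 - c ^+ 2 = g ^+ 2 by rewrite c2; ring.
    by field; exact: sn.
  by rewrite oppr_eq0.
have mK : measurable_fun setT (fun s : mR => \int[mu]_x F (x, (g^-1 * s - c * x / g)%R))%E.
  exact: (@measurable_fun_fubini_tonelli_F _ _ _ _ R mu _ msh (fun q => F0 _)).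
have gi0 : (0 <= `|g|^-1%:E)%E by rewrite lee_fin invr_ge0.
rewrite (ge0_integralZl mu measurableT mK _ gi0); last by move=> s _; exact: integral_ge0.
rewrite (@fubini_tonelli _ _ _ _ R mu mu (fun q : mplane => F (q.2, (g^-1 * q.1 - c * q.2 / g)%R)))//=.
rewrite (fubini_tonelli1 F)//.
transitivity (`|g|^-1%:E * \int[mu]_x (`|g|%:E * \int[mu]_y F (x, y)))%E.
  congr (_ * _)%E; apply: eq_integral => x _.
  (* At fixed [x], the second coordinate is affine in [s] with slope [1 / g]; the two Jacobian
     factors cancel. *)
  rewrite (@integral_affine R (fun y => F (x, y)) g^-1 (- (c * x / g)))//; last first.
    exact: (measurableT_comp mF (pair1_measurable x)).
  by rewrite muleA normfV -EFinM mulfV ?normr_eq0// mul1e.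
rewrite ge0_integralZl//; last 2 first.
- exact: (@measurable_fun_fubini_tonelli_F _ _ _ _ R mu F mF F0).
- by move=> s _; exact: integral_ge0.
by rewrite muleA -EFinM mulVf ?normr_eq0// mul1e.
Qed.

Lemma null_translate A (q : R) : measurable A -> mu A = 0%E -> mu [set x | A (x + q)] = 0%E.
Proof.
move=> mA A0.
have mB : measurable [set x | A (x + q)].
  rewrite -[X in measurable X]setTI; apply: (_ : measurable_fun setT (fun x : mR => x + q : mR)) => //.
  by apply: measurable_funD.
have h := @integral_affine R (EFin \o \1_A) 1 q (oner_neq0 _).
transitivity (mu ([set x | A (x + q)] `&` setT)); first by rewrite setIT.
rewrite -integral_indic//.
transitivity (\int[mu]_x (EFin \o \1_A) (1 * x + q)%R)%E.
  apply: eq_integral => x _ /=; rewrite !indicE mul1r.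
  by have -> : (x \in [set x | A (x + q)]) = (x + q \in A) by apply/idP/idP; rewrite !inE.
rewrite normr1 mul1e in h; rewrite -h//.
- by rewrite /comp integral_indic// setIT.
- exact/measurable_EFinP/measurable_indic.
- by move=> x; rewrite lee_fin.
Qed.

Lemma ae_sections_null (A : set mplane) : measurable A -> mu2 A = 0%E ->
  {ae mu, forall y, mu (xsection A y) = 0%E}.
Proof.
move=> mA A0; have mx := measurable_fun_xsection mu mA.
have h0 : (\int[mu]_y `|(mu \o xsection A) y| = 0)%E.
  by rewrite -A0; apply: eq_integral => y _; rewrite gee0_abs.
have := (ae_eq_integral_abs mu measurableT mx).1 h0.
by rewrite /ae_eq; apply: aeS => y /(_ Logic.I).
Qed.

Lemma null_of_ysections (A : set mplane) : measurable A ->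
  {ae mu, forall a, mu (ysection A a) = 0%E} -> mu2 A = 0%E.
Proof.
move=> mA h; rewrite (product_measure_unique (m' := (mu \x^ mu)%E))//; last first.
  by move=> B C mB mC; exact: product_measure2E.
transitivity (\int[mu]_a (0 : \bar R))%E; last exact: integral0.
apply: ae_eq_integral => //; first exact: measurable_fun_ysection.
by rewrite /ae_eq; apply: aeS h => a ha _; exact: ha.
Qed.

(* The line with direction [th] and offset [y] is [s |-> rot th (s, y)]. *)
Section LineFinite.
Variable F : mplane * mR -> \bar R.
Hypotheses (mF : measurable_fun setT F) (F_ge0 : forall q, (0 <= F q)%E).
Hypothesis F_circle : forall z th, ~ circle R th -> F (z, th) = 0%E.
Hypothesis F_fin : (\int[area_sf \x mu]_q F q < +oo)%E.

Definition line_integral (p : mplane) : \bar R := (\int[mu]_s F (rot p.2 (s, p.1), p.2))%E.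

Let mline : measurable_fun setT (fun q : mplane * mR => F (rot q.1.2 (q.2, q.1.1), q.1.2)).
Proof.
apply: (measurableT_comp mF); apply: measurable_fun_pair.
  apply: (@measurable_rot _ (mplane * mR)%type (fun q => q.2) (fun q => q.1.1) (fun q => q.1.2)).
  - exact: measurable_snd.
  - exact: (measurableT_comp measurable_fst).
  - exact: (measurableT_comp measurable_snd).
exact: (measurableT_comp measurable_snd).
Qed.

Lemma measurable_line_integral : measurable_fun setT line_integral.
Proof. exact: (@measurable_fun_fubini_tonelli_F _ _ _ _ R mu _ mline (fun q => F_ge0 _)). Qed.

Lemma line_integral_ge0 p : (0 <= line_integral p)%E.
Proof. exact: integral_ge0. Qed.

Lemma sin_neq0_circle th : circle R th -> th != 0 -> th != pi -> sin th != 0.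
Proof.
rewrite /circle /= in_itv/= => /andP[t0 t2] n0 np.
have t0' : 0 < th by rewrite lt_neqAle eq_sym n0.
have [tp|tp|tp] := ltgtP th pi; last by rewrite tp eqxx in np.
  by rewrite gt_eqF// sin_gt0_pi// t0'.
rewrite -[th](subrK pi) sinDpi oppr_eq0 gt_eqF// sin_gt0_pi//.
by apply/andP; split; lra.
Qed.

(** In each direction the change to rotated coordinates preserves area. The directions 0 and [pi],
    in which the sine vanishes, form a null set. *)
Lemma integral_line_integral : (\int[area_sf]_p line_integral p = \int[area_sf \x mu]_q F q)%E.
Proof.
have mL := measurable_line_integral; have L0 := line_integral_ge0.
transitivity (\int[mu]_th fubini_G mu line_integral th)%E.
  exact: (@fubini_tonelli2 _ _ _ _ R mu mu line_integral mL L0).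
transitivity (\int[mu]_th fubini_G area_sf F th)%E; last first.
  exact: (esym (@fubini_tonelli2 _ _ _ _ R area_sf mu F mF F_ge0)).
apply: ae_eq_integral => //.
- exact: (measurable_fun_fubini_tonelli_G line_integral mL L0).
- exact: (measurable_fun_fubini_tonelli_G F mF F_ge0).
rewrite /ae_eq; apply: aeS2 (ae_neq 0) (ae_neq pi) => th t0 tp _.
rewrite /fubini_G /line_integral /=.
have [ci|nci] := pselect (circle R th).
  rewrite (@rotation_integral (fun z => F (z, th)))//; last exact: sin_neq0_circle.
  by apply: (measurableT_comp mF); exact: pair2_measurable.
rewrite !integral0_eq// => x _; first by rewrite F_circle.
by rewrite integral0_eq// => s _; rewrite F_circle.
Qed.

Lemma line_integral_null : area_sf [set p | line_integral p = +oo%E] = 0%E.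
Proof.
have mL := measurable_line_integral; have L0 := line_integral_ge0.
have iL : area_sf.-integrable setT line_integral.
  apply/integrableP; split => //.
  under eq_integral do rewrite gee0_abs//.
  by rewrite integral_line_integral.
have /negligibleP : area_sf.-negligible [set p | line_integral p = +oo%E].
  have [N [mN N0 sN]] := integrable_ae measurableT iL.
  exists N; split => // p /= pL; apply: sN => /= h.
  by have := h Logic.I; rewrite pL.
apply.
have -> : [set p | line_integral p = +oo%E] = setT `&` line_integral @^-1` [set +oo%E] by rewrite setTI.
exact: mL.
Qed.

(** Transfers almost everywhere from offset and direction to [(beta, alpha)]. Two directions
    differing by a full turn occur because the angle of a chord may have to be brought back to the
    circle. *)
Lemma ae_line_integral : {ae area_sf, forall p, - (pi / 2) <= p.2 <= pi / 2 ->
  (line_integral (sin p.2, (p.1 + pi + p.2)%R) < +oo)%E /\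
  (line_integral (sin p.2, (p.1 + pi + p.2 - 2 * pi)%R) < +oo)%E}.
Proof.
pose B := [set p | line_integral p = +oo%E].
have mB : measurable B.
  have -> : B = setT `&` line_integral @^-1` [set +oo%E] by rewrite setTI.
  exact: measurable_line_integral.
have key (q : R) : {ae area_sf, forall p, - (pi / 2) <= p.2 <= pi / 2 ->
    (line_integral (sin p.2, (p.1 + (q + p.2))%R) < +oo)%E}.
  have mphi : measurable_fun setT (fun p : mplane => (sin p.2, p.1 + (q + p.2)) : mplane).
    apply: measurable_fun_pair.
      apply: (measurableT_comp (measurable_ctsT (@continuous_sin R))) => //.
    apply: measurable_funD => //; apply: measurable_funD => //.
  pose A : set mplane := [set p | - (pi / 2) <= p.2 <= pi / 2] `&` [set p | B (sin p.2, p.1 + (q + p.2))].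
  have mA : measurable A.
    apply: measurableI.
      have -> : [set p : mplane | - (pi / 2) <= p.2 <= pi / 2] = setT `*` `[- (pi / 2), pi / 2]%classic.
        by apply/seteqP; split => p /=; rewrite in_itv/= => // -[].
      exact: measurableX.
    by rewrite -[X in measurable X]setTI; exact: mphi.
  exists A; split => //; last first.
    move=> p /= /not_implyP[pI pL]; split => //; apply/eqP.
    by rewrite -leye_eq leNgt; apply/negP.
  apply: null_of_ysections => //.
  have hB := ae_sections_null mB line_integral_null.
  (* The bad offsets, whose set of bad directions is not null. They are null themselves, and so is
     their preimage under [sin]; for the other [alpha] the bad [beta] lie in a translate of a null
     set. *)
  pose N := [set y | mu (xsection B y) != 0%E].
  have mN : measurable N.
    have -> : N = ~` ((mu \o xsection B) @^-1` [set 0%E]).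
      by apply/seteqP; split => y /= /eqP.
    apply: measurableC; rewrite -[X in measurable X]setTI.
    exact: (measurable_fun_xsection mu mB).
  have N0 : mu N = 0%E.
    apply: measure_negligible => //.
    by case: hB => N' [mN' N'0 sN]; exists N'; split => // y /= yN; apply: sN => /= /eqP; apply/negP.
  have [M [mM M0 sM]] : mu.-negligible (`[- (pi / 2), pi / 2]%classic `&` sin @^-1` N).
    have h0 := sin_null_preimage mN N0.
    apply/negligibleP => //; apply: measurableI => //.
    rewrite -[X in measurable X]setTI; exact: (measurable_ctsT (@continuous_sin R)).
  exists M; split => // a /= na; apply: sM; split => /=.
    apply: contrapT => aI; apply: na.
    rewrite (_ : ysection A a = set0) ?measure0//; apply/seteqP; split => // x.
    by rewrite /ysection /= inE => -[aI' _]; apply: aI; rewrite in_itv.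
  apply/negP => /eqP aN; apply: na.
  apply/eqP; rewrite eq_le measure_ge0 andbT.
  have mX : measurable (xsection B (sin a)) by exact: measurable_xsection.
  rewrite -(null_translate (q + a) mX aN); apply: le_measure; rewrite ?inE.
  - exact: measurable_ysection.
  - rewrite -[X in measurable X]setTI; apply: (_ : measurable_fun setT (fun x : mR => x + (q + a) : mR)) => //.
    exact: measurable_funD.
  - by move=> x; rewrite /ysection /xsection /= !inE => -[_].
have h1 := key pi; have h2 := key (- pi).
apply: aeS2 h1 h2 => p k1 k2 pI; split.
  by have := k1 pI; rewrite addrA.
have := k2 pI; congr (line_integral (_, _) < _)%E.
by ring.
Qed.

End LineFinite.

End Rotation.

(** * The attenuated transform and its kernel *)

Section Rays.
Variable R : realType.
Local Notation C := R[i].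
Local Notation plane := (R * R)%type.
Local Notation mR := (measurableTypeR R).
Local Notation mplane := (mR * mR)%type.
Local Notation mu := (@lebesgue_measure R).
Implicit Types (p z : plane) (t th : R) (k : int).

Definition wrap th : R := th - 2 * pi * (Num.floor (th / (2 * pi)))%:~R.

Let pi2 : 0 < 2 * pi :> R. Proof. by rewrite mulr_gt0// pi_gt0. Qed.

Lemma wrap_circle th : circle R (wrap th).
Proof.
rewrite /circle /= in_itv/= /wrap; have /andP[h1 h2] := floor_itv (th / (2 * pi)).
rewrite intrD in h2; set n := (Num.floor _)%:~R in h1 h2 *.
have tE : th = 2 * pi * (th / (2 * pi)) by rewrite mulrC divfK// gt_eqF.
have -> : th - 2 * pi * n = 2 * pi * (th / (2 * pi) - n) by rewrite mulrBr -tE.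
rewrite mulr_ge0 ?subr_ge0// ?(ltW pi2)//= -[ltRHS]mulr1 ltr_pM2l//.
by rewrite ltrBlDr addrC.
Qed.

Lemma floor_unique (x : R) (n : int) : n%:~R <= x -> x < (n + 1)%:~R -> Num.floor x = n.
Proof. by move=> h1 h2; apply/eqP; rewrite floor_eq ?h1. Qed.

Lemma wrap_shift th (n : int) : wrap (th + 2 * pi * n%:~R) = wrap th.
Proof.
have E : (th + 2 * pi * n%:~R) / (2 * pi) = th / (2 * pi) + n%:~R.
  by rewrite mulrDl; congr (_ + _); rewrite mulrAC mulfV ?mul1r// gt_eqF.
rewrite /wrap E; have /andP[h1 h2] := floor_itv (th / (2 * pi)).
rewrite (@floor_unique _ (Num.floor (th / (2 * pi)) + n)); first by rewrite intrD; ring.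
  by rewrite intrD lerD2r.
by rewrite addrAC intrD ltrD2r.
Qed.

Lemma wrap_id th : circle R th -> wrap th = th.
Proof.
rewrite /circle /= in_itv/= => /andP[t0 t2]; rewrite /wrap (@floor_unique _ 0) ?mulr0 ?subr0//.
  by rewrite divr_ge0// ltW.
by rewrite ltr_pdivrMr// mul1r.
Qed.

Lemma wrap_4pi th : 0 <= th -> th < 4 * pi -> wrap th = th \/ wrap th = th - 2 * pi.
Proof.
move=> t0 t4; have [t2|t2] := ltP th (2 * pi).
  by left; apply: wrap_id; rewrite /circle /= in_itv/= t0.
right; rewrite -[th in LHS](subrK (2 * pi)) -[X in _ - _ + X]mulr1 -[1]/(1%:~R) wrap_shift wrap_id//.
by rewrite /circle /= in_itv/=; apply/andP; split; lra.
Qed.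

(* Vectors of [L^2(SM)] are only meaningful for angles in [circle]. *)
Definition per (x : plane * R -> C) (q : plane * R) : C := x (q.1, wrap q.2).

Lemma per_periodic x : periodic (per x).
Proof.
by move=> z t _; rewrite /per /= -[X in wrap (t + X)]mulr1 -[1]/(1%:~R) wrap_shift.
Qed.

Lemma expi_periodic (k : int) th (n : int) : expi (k%:~R * (th + 2 * pi * n%:~R)) = expi (k%:~R * th).
Proof.
rewrite /expi mulrDr.
have -> : k%:~R * (2 * pi * n%:~R) = (k * n)%:~R * (2 * pi) :> R by rewrite intrM; ring.
by rewrite cosD sinD cos_int_2pi sin_int_2pi !mulr1 !mulr0 subr0 addr0.
Qed.

Lemma expi_wrap k th : expi (k%:~R * wrap th) = expi (k%:~R * th).
Proof.
have -> : wrap th = th + 2 * pi * (- Num.floor (th / (2 * pi)))%:~R by rewrite /wrap mulrNz mulrN.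
exact: expi_periodic.
Qed.

Lemma cos_wrap th : cos (wrap th) = cos th.
Proof. by have := expi_wrap 1 th; rewrite !mul1r /expi => -[]. Qed.

Lemma sin_wrap th : sin (wrap th) = sin th.
Proof. by have := expi_wrap 1 th; rewrite !mul1r /expi => -[]. Qed.

Section OneRay.
Variable p : plane.
Hypothesis hp : inward p.

Definition base : plane := (cos p.1, sin p.1).
Definition angle : R := p.1 + pi + p.2.
Definition ray_pt t : plane := ray base angle t.
Definition ray_SM t : plane * R := (ray_pt t, wrap angle).
Definition len : R := 2 * cos p.2.
Definition ray_itv : set mR := `[0, len]%classic.

Lemma inward_snd : - (pi / 2) <= p.2 <= pi / 2.
Proof. by case: hp => _; rewrite /= in_itv. Qed.

Lemma len_ge0 : 0 <= len.
Proof. by rewrite mulr_ge0// cos_ge0_pihalf// inward_snd. Qed.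

(** The angle [beta + pi + alpha] lies between [pi / 2] and [7 pi / 2], so at most one turn has to
    be removed. *)
Lemma wrap_angle : wrap angle = angle \/ wrap angle = angle - 2 * pi.
Proof.
have /andP[h1 h2] := inward_snd; case: hp => /=; rewrite in_itv/= => /andP[b0 b2] _.
have p0 := pi_gt0 R; apply: wrap_4pi; rewrite /angle; lra.
Qed.

(** In coordinates rotated to the direction of the chord, the base point is
    [(- cos alpha, sin alpha)]; this identifies the chord with the line of offset [sin alpha]. *)
Lemma ray_rot t : ray_pt t = rot angle (t - cos p.2, sin p.2).
Proof.
have h : angle - p.2 = p.1 + pi by rewrite /angle addrK.
have hc : cos (angle - p.2) = - cos p.1 by rewrite h cosD cospi sinpi; ring.
have hs : sin (angle - p.2) = - sin p.1 by rewrite h sinD cospi sinpi; ring.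
rewrite cosB in hc; rewrite sinB in hs.
rewrite /ray_pt /ray /rot /base /=; congr pair.
  have -> : cos p.1 = - (cos angle * cos p.2 + sin angle * sin p.2) by rewrite hc opprK.
  by ring.
have -> : sin p.1 = - (sin angle * cos p.2 - cos angle * sin p.2) by rewrite hs opprK.
by ring.
Qed.

(** The power of a point: the squared norm of [ray_pt p t] minus 1 equals [t (t - len)]. *)
Lemma ray_disc t : disc (ray_pt t) <-> t * (t - len) <= 0.
Proof.
rewrite ray_rot /disc /rot /=.
have c2 := cos2Dsin2 angle; have d2 := cos2Dsin2 p.2.
set s := t - cos p.2; set y := sin p.2 in d2 *.
have -> : (s * cos angle - y * sin angle) ^+ 2 + (s * sin angle + y * cos angle) ^+ 2 =
   (s ^+ 2 + y ^+ 2) * (cos angle ^+ 2 + sin angle ^+ 2) by ring.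
rewrite c2 mulr1 -subr_le0.
have -> : s ^+ 2 + y ^+ 2 - 1 = t * (t - len) by rewrite -d2 /s /len; ring.
by [].
Qed.

Lemma ray_disc_itv t : 0 <= t -> t <= len -> disc (ray_pt t).
Proof. by move=> t0 tl; apply/ray_disc; rewrite mulr_ge0_le0// subr_le0. Qed.

Lemma exit_len : exit_time base angle = len.
Proof.
rewrite /exit_time.
have -> : [set t : R | 0 <= t /\ disc (ray base angle t)] = `[0, len]%classic.
  apply/seteqP; split => t /=; rewrite in_itv/=.
    move=> [t0 /ray_disc h]; rewrite t0/=; have [->|tn] := eqVneq t 0; first exact: len_ge0.
    have tp : 0 < t by rewrite lt_neqAle eq_sym tn.
    by move: h; rewrite pmulr_rle0// subr_le0.
  by move=> /andP[t0 tl]; split => //; exact: ray_disc_itv.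
by rewrite sup_itvcc// len_ge0.
Qed.

Lemma ray_SM_in t : ray_itv t -> @SM R (ray_SM t).
Proof.
rewrite /ray_itv /= in_itv/= => /andP[t0 tl]; split; first exact: ray_disc_itv.
exact: wrap_circle.
Qed.

Lemma continuous_affine (a b : R) : continuous (fun t : R => a + t * b).
Proof. by move=> t; apply: cvgD; [exact: cvg_cst|apply: cvgMl; exact: cvg_id]. Qed.

Lemma measurable_ray_SM : measurable_fun setT (ray_SM : mR -> (mplane * mR)%type).
Proof.
apply: measurable_fun_pair; last exact: measurable_cst.
by apply: measurable_fun_pair; apply: measurable_ctsT; exact: continuous_affine.
Qed.

Lemma measurable_SM : measurable (@SM R : set (mplane * mR)%type).
Proof. by apply: measurableX; [exact: measurable_disc|exact: measurable_itv]. Qed.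

Lemma measurable_ray d (T : measurableType d) (G : mplane * mR -> T) :
  measurable_fun (@SM R) G -> measurable_fun ray_itv (G \o ray_SM).
Proof.
move=> mG; apply: (measurable_comp measurable_SM _ mG).
  by move=> _ [t tI <-]; exact: ray_SM_in.
exact: measurable_funTS measurable_ray_SM.
Qed.

Lemma xray_per (a : plane -> C) (x : plane * R -> C) : xray a (per x) p =
  Cintegral mu ray_itv (fun t => x (ray_SM t) *
    cexp (Cintegral mu `[0, t]%classic (fun s => a (ray_pt s)))).
Proof. by rewrite /xray /xray_at -/base -/angle exit_len. Qed.

End OneRay.

(** After extension by zero off [SM], the integral over a chord is at most the one over the whole
    line, which [ae_line_integral] makes finite. *)
Lemma ray_integral_lty (F : mplane * mR -> \bar R) : measurable_fun (@SM R) F ->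
  (forall q, @SM R q -> (0 <= F q)%E) -> (\int[vol R]_(q in @SM R) F q < +oo)%E ->
  {ae area R, forall p, inward p -> (\int[mu]_(t in ray_itv p) F (ray_SM p t) < +oo)%E}.
Proof.
move=> mF F0 Ffin; pose F1 := F \_ (@SM R).
have mF1 : measurable_fun setT F1 by apply/(measurable_restrictT _ measurable_SM).
have F1_ge0 q : (0 <= F1 q)%E by rewrite /F1 patchE; case: ifP => //; rewrite inE; exact: F0.
have F1c z th : ~ circle R th -> F1 (z, th) = 0%E.
  by move=> nc; rewrite /F1 patchE; case: ifP => //; rewrite inE => -[].
have F1fin : (\int[area_sf R \x mu]_q F1 q < +oo)%E.
  by move: Ffin; rewrite integral_mkcond.
have := ae_line_integral mF1 F1_ge0 F1c F1fin.
apply: aeS => p h hp; have [h1 h2] := h (inward_snd hp).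
have le : (\int[mu]_(t in ray_itv p) F (ray_SM p t) <= line_integral F1 (sin p.2, wrap (angle p)))%E.
  rewrite /line_integral /=.
  have mG : measurable_fun setT (fun t : mR => F1 (rot (wrap (angle p)) (t, sin p.2), wrap (angle p))).
    apply: (measurableT_comp mF1); apply: measurable_fun_pair; last exact: measurable_cst.
    exact: (@measurable_rot R _ mR id (fun=> sin p.2) (fun=> wrap (angle p))).
  rewrite (@integral_affine R _ 1 (- cos p.2) (oner_neq0 _) mG)// normr1 mul1e.
  have E t : (rot (wrap (angle p)) (1 * t - cos p.2, sin p.2), wrap (angle p)) = ray_SM p t.
    by rewrite /ray_SM ray_rot /rot mul1r cos_wrap sin_wrap.
  rewrite [leRHS](_ : _ = \int[mu]_t F1 (ray_SM p t))%E; last first.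
    by apply: eq_integral => t _; rewrite -E.
  rewrite [leLHS](_ : _ = \int[mu]_(t in ray_itv p) F1 (ray_SM p t))%E; last first.
    by apply: eq_integral => t; rewrite inE => tI; rewrite /F1 patchE mem_set//; exact: ray_SM_in.
  apply: ge0_subset_integral => //; first exact: measurable_itv.
  exact: (measurableT_comp mF1 (measurable_ray_SM p)).
apply: le_lt_trans le _.
by have [->|->] := wrap_angle hp; [exact: h1|exact: h2].
Qed.

End Rays.

(** * The attenuation along a chord *)

Section Attenuation.
Variable R : realType.
Local Notation C := R[i].
Local Notation plane := (R * R)%type.
Local Notation mR := (measurableTypeR R).
Local Notation mplane := (mR * mR)%type.
Local Notation mu := (@lebesgue_measure R).
Variable a : plane -> C.
Hypothesis ha : {within @disc R, continuous (a : plane -> C^o)}.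

Lemma within_disc_cvg (L : C -> R) : (forall x y, `|L x - L y| <= Normc.normc (x - y)) ->
  {within @disc R, continuous (L \o a)}.
Proof.
move=> hL; apply/subspace_continuousP => z Dz.
move/subspace_continuousP : ha => /(_ z Dz) h.
apply/cvgrPdist_lt => e e0.
have /cvgrPdist_lt/(_ e%:C) h' := h.
have e0' : 0 < e%:C by rewrite ltcR.
have := h' e0'; apply: filterS => w /= hw.
apply: le_lt_trans (hL _ _) _.
by rewrite -ltcR; move: hw; rewrite normc_def; case: (a z - a w).
Qed.

Lemma normc_lip (x y : C) : `|Normc.normc x - Normc.normc y| <= Normc.normc (x - y).
Proof.
have nE (v : C) : `|v| = (Normc.normc v)%:C by rewrite normc_def; case: v.
have h (v w : C) : Normc.normc v - Normc.normc w <= Normc.normc (v - w).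
  by have := lerB_dist v w; rewrite !nE -rmorphB/= lecR.
rewrite ler_norml h andbT lerNl opprB; apply: le_trans (h _ _) _.
by rewrite -lecR -!nE distrC.
Qed.

Lemma attenuation_cts_Re : {within @disc R, continuous (fun z => complex.Re (a z))}.
Proof.
apply: (within_disc_cvg (L := @complex.Re R)) => x y.
rewrite -raddfB -lecR; apply: le_trans (normc_ge_Re _) _.
by rewrite normc_def; case: (x - y).
Qed.

Lemma attenuation_cts_Im : {within @disc R, continuous (fun z => complex.Im (a z))}.
Proof.
apply: (within_disc_cvg (L := @complex.Im R)) => x y.
rewrite -raddfB; case: (x - y) => u v /=.
by rewrite -[leLHS]sqrtr_sqr ler_wsqrtr// lerDr sqr_ge0.
Qed.

Lemma disc0 : disc ((0, 0) : plane).
Proof. by rewrite /disc /= expr0n /= addr0 ler01. Qed.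

Lemma attenuation_le z : disc z -> Normc.normc (a z) <= sup_disc a.
Proof.
move=> Dz; have h := within_disc_cvg normc_lip.
have [c _ hc] := compact_EVT_max (ex_intro _ _ disc0) (@compact_disc R) h.
apply: ub_le_sup; last by exists z.
exists (Normc.normc (a c)) => _ [w Dw <-]; exact: (hc w (mem_set Dw)).
Qed.

Lemma sup_disc_ge0 : 0 <= sup_disc a.
Proof.
apply: le_trans (attenuation_le disc0); by case: (a _) => x y /=; exact: sqrtr_ge0.
Qed.

Lemma within_disc_measurable (F : plane -> R) : {within @disc R, continuous F} ->
  measurable_fun (@disc R : set mplane) (F : mplane -> mR).
Proof.
move=> cF; apply: (measurability _ (RGenOpens.measurableE R)).
move=> _ [_ [x [y ->] <-]].
have /continuousP/(_ _ (@interval_open _ (BRight x) (BLeft y) isT isT)) := cF.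
move=> /open_subspaceP[V oV VE]; rewrite setIC -VE.
by apply: measurableI; [exact: open_plane_measurable|exact: measurable_disc].
Qed.

Lemma cmeasurable_attenuation : cmeasurable (@disc R : set mplane) a.
Proof.
by split; apply: within_disc_measurable; [exact: attenuation_cts_Re|exact: attenuation_cts_Im].
Qed.

Lemma disc_comp_cts (F : plane -> R) (f : R -> plane) : {within @disc R, continuous F} ->
  continuous f -> (forall t, disc (f t)) -> continuous (F \o f).
Proof.
move=> /subspace_continuousP cF cf df t.
move=> U hU; have h : within (@disc R) (nbhs (f t)) (F @^-1` U) := cF _ (df t) U hU.
by apply: (@filterS _ (nbhs t) _ _ _ _ (cf t _ h)) => s; apply; exact: df.
Qed.

Lemma is_derive1 (F : R -> R) (t d : R) : derivable F t 1 -> F^`()%classic t = d ->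
  is_derive t (1 : R) F d.
Proof. by move=> h1 h2; apply: (@DeriveDef _ _ _ _ _ _ _ h1); rewrite -derive1E. Qed.

(** Integrating from -1 rather than 0 makes the derivative at [t = 0] two-sided; subtracting a
    constant restores the value 0 there. *)
Lemma primitive (f : R -> R) : continuous f -> exists U : R -> R, forall t : R, 0 <= t ->
  is_derive t (1 : R) U (f t) /\ Rintegral mu `[0, t] f = U t.
Proof.
move=> cf.
have fi (x y : R) : mu.-integrable `[x, y] (EFin \o f).
  by apply: continuous_compact_integrable; [exact: segment_compact|exact: continuous_subspaceT].
exists (fun t => Rintegral mu `[-1, t] f - Rintegral mu `[-1, 0] f) => t t0; split.
  have tt : t < t + 1 by rewrite ltrDl.
  have ht : (-1 < t)%R by apply: lt_le_trans t0; rewrite oppr_lt0.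
  have [|d1 d2] := @continuous_FTC1_closed R f (-1) t (t + 1) tt (fi _ _) _ (cf t).
    by [].
  rewrite -[f t]subr0; apply: is_deriveB.
  exact: is_derive1.
rewrite (@Rintegral_itvB _ f (BLeft (-1)) (BRight t) 0) ?(fi _ _)//.
- by rewrite Rintegral_itv_obnd_cbnd//; apply: integrableS (fi 0 t) => //; exact: subset_itv_oc_cc.
- by rewrite bnd_simp oppr_le0.
Qed.

(* Makes the attenuation along a chord continuous on the whole line. *)
Definition clamp (l t : R) : R := Num.max 0 (Num.min t l).

Lemma continuous_clamp l : continuous (clamp l).
Proof.
move=> t; apply/cvgrPdist_lt => e e0; exists e => //= s.
apply: le_lt_trans; rewrite /clamp /Num.max /Num.min.
have n1 := ler_norm (t - s); have n2 := ler_norm (- (t - s)); rewrite normrN in n2.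
rewrite ler_norml; case: (ltP t l) => h1; case: (ltP s l) => h2;
  case: ltP => h3; case: ltP => h4; apply/andP; split; lra.
Qed.

Lemma clamp_itv l t : 0 <= l -> 0 <= clamp l t <= l.
Proof. by move=> l0; rewrite /clamp le_max lexx/= ge_max l0 ge_min lexx orbT. Qed.

Lemma clamp_id l t : 0 <= t -> t <= l -> clamp l t = t.
Proof. by move=> t0 tl; rewrite /clamp min_l// max_r. Qed.

Section OneRay.
Variable p : plane.
Hypothesis hp : inward p.
Local Notation ray_itv := (ray_itv p).
Local Notation len := (len p).

Definition attn t : C := cexp (Cintegral mu `[0, t]%classic (fun s => a (ray_pt p s))).

Lemma continuous_ray_pt : continuous (ray_pt p).
Proof.
move=> t; apply: (@cvg_pair _ _ _ (nbhs t) (nbhs _) (nbhs _)); exact: continuous_affine.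
Qed.

Lemma line_primitive (F : plane -> R) : {within @disc R, continuous F} ->
  exists (f U : R -> R), [/\ continuous f, forall t, ray_itv t -> f t = F (ray_pt p t) &
    forall t, ray_itv t -> is_derive t (1 : R) U (f t) /\
    Rintegral mu `[0, t] (fun s => F (ray_pt p s)) = U t].
Proof.
move=> cF; pose f := F \o (fun t => ray_pt p (clamp len t)).
have cf : continuous f.
  apply: disc_comp_cts => //.
    by move=> t; apply: continuous_comp; [exact: continuous_clamp|exact: continuous_ray_pt].
  by move=> t; have /andP[h1 h2] := clamp_itv t (len_ge0 hp); exact: ray_disc_itv.
have [U hU] := primitive cf; exists f, U; split => //.
  by move=> t; rewrite /ray_itv /= in_itv/= => /andP[t0 tl]; rewrite /f /= clamp_id.
move=> t; rewrite /ray_itv /= in_itv/= => /andP[t0 tl].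
have [h1 h2] := hU _ t0; split => //; rewrite -h2; apply: eq_Rintegral => s.
rewrite inE /= in_itv/= => /andP[s0 st].
by rewrite /f /= clamp_id// (le_trans st).
Qed.

(** On the chord the weight is [exp (u + i v)], with [u + i v] a primitive of the attenuation: the
    form that the product rule calls for. *)
Lemma line_weight : exists (fr fi u v : R -> R),
  [/\ continuous fr, continuous fi,
   forall t, ray_itv t -> a (ray_pt p t) = fr t +i* fi t,
   forall t, ray_itv t -> is_derive t (1 : R) u (fr t) /\ is_derive t (1 : R) v (fi t) &
   forall t, ray_itv t -> attn t = (expR (u t))%:C * expi (v t)].
Proof.
have [fr [u [c1 e1 d1]]] := line_primitive attenuation_cts_Re.
have [fi [v [c2 e2 d2]]] := line_primitive attenuation_cts_Im.
exists fr, fi, u, v; split => //.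
- by move=> t h; rewrite e1// e2//; case: (a _).
- by move=> t h; split; [exact: (d1 t h).1|exact: (d2 t h).1].
- by move=> t h; rewrite /attn /cexp /Cintegral /= (d1 t h).2 (d2 t h).2.
Qed.

Lemma measurable_ray_itv : measurable ray_itv.
Proof. exact: measurable_itv. Qed.

Lemma ray_itv_lty : (mu ray_itv < +oo)%E.
Proof.
by rewrite /ray_itv lebesgue_measure_itv/=; case: ifP => // _; rewrite -EFinB ltry.
Qed.

Lemma is_derive_continuous (f : R -> R) t d : is_derive t (1 : R) f d -> {for t, continuous f}.
Proof. by move=> h; apply: differentiable_continuous; apply/derivable1_diffP; exact: ex_derive. Qed.

Lemma within_measurable (F : R -> R) : (forall t, ray_itv t -> {for t, continuous F}) ->
  measurable_fun ray_itv (F : mR -> mR).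
Proof.
move=> cF; apply: subspace_continuous_measurable_fun; first exact: measurable_itv.
by apply: continuous_in_subspaceT => t; rewrite inE; exact: cF.
Qed.

(** The conjugate appears because the transform at [p] is a Hermitian product with it. *)
Lemma L2_attn : L2 mu ray_itv (fun t => conjc (attn t)).
Proof.
have [fr [fi [u [v [_ _ _ hd hw]]]]] := line_weight.
have cu t : ray_itv t -> {for t, continuous u} by move=> h; exact: is_derive_continuous (hd t h).1.
have cv t : ray_itv t -> {for t, continuous v} by move=> h; exact: is_derive_continuous (hd t h).2.
have ce t : ray_itv t -> {for t, continuous (expR \o u)}.
  by move=> h; apply: continuous_comp; [exact: cu|exact: continuous_expR].
have [c ? hc] : exists2 c : R, c \in `[0, len] & forall t : R, t \in `[0, len] -> (expR \o u) t <= (expR \o u) c.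
  by apply: EVT_max; [exact: len_ge0|apply: continuous_in_subspaceT => t; rewrite inE; exact: ce].
apply: (@L2_bounded _ _ _ _ _ measurable_ray_itv (expR (u c))) ray_itv_lty _ _.
  split.
    apply: (eq_measurable_fun (fun t => (expR \o u) t * (cos \o v) t)).
      by move=> t; rewrite inE => tI; rewrite hw//= mul0r subr0.
    apply: measurable_funM; apply: within_measurable => // t h.
    by apply: continuous_comp; [exact: cv|exact: continuous_cos].
  apply: (eq_measurable_fun (fun t => - ((expR \o u) t * (sin \o v) t))).
    by move=> t; rewrite inE => tI; rewrite hw//= mul0r addr0.
  apply: measurable_funN; apply: measurable_funM; apply: within_measurable => // t h.
  by apply: continuous_comp; [exact: cv|exact: continuous_sin].
move=> t tI; rewrite hw//=.
have -> : (expR (u t) * cos (v t) - 0 * sin (v t)) ^+ 2 + (- (expR (u t) * sin (v t) + 0 * cos (v t))) ^+ 2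
  = expR (u t) ^+ 2 * (cos (v t) ^+ 2 + sin (v t) ^+ 2) by ring.
by rewrite cos2Dsin2 mulr1 sqrtr_sqr ger0_norm ?expR_ge0//; exact: hc.
Qed.

End OneRay.
End Attenuation.

Lemma nneseries_term_cvg (R : realType) (f : nat -> \bar R) : (forall k, 0 <= f k)%E ->
  (\sum_(k <oo) f k < +oo)%E -> f @ \oo --> 0%E.
Proof.
move=> f0 fin; have h := nneseries_tail_cvg fin (fun k _ => f0 k).
apply: (squeeze_cvge _ (@cvg_cst _ _ _ _ _) h); apply: nearW => N; rewrite f0/=.
have := @nneseries_lim_ge R f xpredT N N.+1 (fun k _ _ => f0 k).
by rewrite big_nat1.
Qed.

Section ComplexOrthogonality.
Variables (R : realType) (V : semiHilbertType R).
Implicit Types x y : V.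

Definition corth x y := ip x y = 0 /\ ip x ('i%C *: y) = 0.

Lemma corth_lin (c : R[i]) x x' y : corth x y -> corth x' y -> corth (c *: x + x') y.
Proof.
move=> [h1 h2] [h3 h4].
have cE : c = (complex.Re c)%:C + (complex.Im c)%:C * 'i by rewrite [LHS]complexE [_ * 'i]mulrC.
have i1 : ip ('i%C *: x) y = 0.
  have -> : y = 'i%C *: (- ('i%C *: y)) by rewrite scalerN scalerA -expr2 sqr_i scaleN1r opprK.
  by rewrite ipI ipNr h2 oppr0.
have i2 : ip ('i%C *: x) ('i%C *: y) = 0 by rewrite ipI.
by split; rewrite cE scalerDl -scalerA !ipDl !ipZl ?(h1, h2, h3, h4, i1, i2) !(mulr0, addr0).
Qed.

Lemma corth_lim (u : nat -> V) x y : (forall n, corth (u n) y) -> Hcvg u x -> corth x y.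
Proof.
move=> h hu; split.
  have := @Hcvg_ip _ _ u x y hu; rewrite (_ : (fun n => ip (u n) y) = cst 0).
    by move=> c; exact: (cvg_unique (@norm_hausdorff _ _) c (@cvg_cst _ _ _ _ _)).
  by apply/funext => n; exact: (h n).1.
have := @Hcvg_ip _ _ u x ('i%C *: y) hu; rewrite (_ : (fun n => ip (u n) _) = cst 0).
  by move=> c; exact: (cvg_unique (@norm_hausdorff _ _) c (@cvg_cst _ _ _ _ _)).
by apply/funext => n; exact: (h n).2.
Qed.

End ComplexOrthogonality.

Lemma Re_rprod (R : realType) (x w : R[i]) : complex.Re (x * w) =
  complex.Re x * complex.Re (conjc w) + complex.Im x * complex.Im (conjc w).
Proof. by rewrite cReM; case: w => u v /=; ring. Qed.

Lemma Im_rprod (R : realType) (x w : R[i]) : complex.Im (x * w) =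
  complex.Re x * complex.Re ('i%C * conjc w) + complex.Im x * complex.Im ('i%C * conjc w).
Proof. by rewrite !cImM !cReM; case: w => u v /=; ring. Qed.

(** * The kernel of the transform is a closed subspace *)

Section Kernel.
Variable R : realType.
Local Notation C := R[i].
Local Notation plane := (R * R)%type.
Local Notation mR := (measurableTypeR R).
Local Notation mplane := (mR * mR)%type.
Local Notation mu := (@lebesgue_measure R).

Definition HS := L2space (vol R) (@measurable_SM R).

Lemma HS_linE c (x y : HS) q : (c *: x + y : HS) q = c * x q + y q.
Proof. by rewrite L2spaceD L2spaceZ. Qed.

Lemma HS_subK (x y : HS) q : (x - y : HS) q + y q = x q.
Proof. by rewrite L2spaceB subrK. Qed.

Section OneRay.
Variable p : plane.

Definition line_space := L2space mu (@measurable_ray_itv R p).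

Definition on_ray (x : plane * R -> C) : line_space := toL2 mu (@measurable_ray_itv R p) (x \o ray_SM p).

(** The real and imaginary parts of the chord integral are real products with [w] and [i w], so
    vanishing of the transform at [p] is a closed complex linear condition on the chord. *)
Lemma xray_ip (a : plane -> C) (hp : inward p) (w : line_space) x :
  (w = (fun t => conjc (attn a p t)) :> (mR -> C)) ->
  L2 mu (ray_itv p) (x \o ray_SM p) ->
  xray a (per x) p = ip (on_ray x) w +i* ip (on_ray x) ('i%C *: w).
Proof.
move=> wE hx; rewrite xray_per// /Cintegral !ipE.
have xE t : on_ray x t = x (ray_SM p t) by rewrite /on_ray toL2E.
congr (_ +i* _); apply: eq_Rintegral => t _; rewrite /rprod xE ?L2spaceZ wE.
  exact: Re_rprod.
exact: Im_rprod.
Qed.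

Lemma xray_eq0 (a : plane -> C) (hp : inward p) (w : line_space) x :
  (w = (fun t => conjc (attn a p t)) :> (mR -> C)) ->
  L2 mu (ray_itv p) (x \o ray_SM p) ->
  (xray a (per x) p = 0 <-> corth (on_ray x) w).
Proof. by move=> wE hx; rewrite (xray_ip hp wE hx) /corth; split => [[]//|[-> ->]]. Qed.

End OneRay.

Definition ray_sq (x : plane * R -> C) p : \bar R := sqnorm mu (ray_itv p) (x \o ray_SM p).

Lemma L2_ray (x : HS) p : (ray_sq x p < +oo)%E -> L2 mu (ray_itv p) (x \o ray_SM p).
Proof.
move=> h; split => //; have [[h1 h2] _] := L2funP x.
by split; [exact: measurable_ray h1|exact: measurable_ray h2].
Qed.

Lemma measurable_SM_sq (x : HS) : measurable_fun (@SM R : set (mplane * mR)%type)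
  (fun q => (Normc.normc (x q) ^+ 2)%:E : \bar R).
Proof. by apply/measurable_EFinP; apply: cmeasurable_sq; have [] := L2funP x. Qed.

Lemma ae_ray_L2 (x : HS) :
  {ae area R, forall p, inward p -> L2 mu (ray_itv p) (x \o ray_SM p)}.
Proof.
have [_ fin] := L2funP x.
have f0 q : @SM R q -> (0 <= (Normc.normc (x q) ^+ 2)%:E)%E by move=> _; rewrite lee_fin sqr_ge0.
have := ray_integral_lty (measurable_SM_sq x) f0 fin.
apply: aeS => p h hp; by apply: L2_ray; exact: h.
Qed.

(** The sum of the squared functions is integrable on [SM], so the sum of the squared chord norms is
    finite on almost every chord, and its terms tend to zero there. *)
Lemma ae_ray_cvg0 (x : nat -> HS) : (\sum_(j <oo) sqnorm (vol R) (@SM R) (x j) < +oo)%E ->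
  {ae area R, forall p, inward p -> (forall j, L2 mu (ray_itv p) (x j \o ray_SM p)) /\
    (fun j => ray_sq (x j) p) @ \oo --> 0%E}.
Proof.
move=> fin.
pose f j q := ((Normc.normc (x j q) ^+ 2)%:E : \bar R).
have mf j : measurable_fun (@SM R : set (mplane * mR)%type) (f j) by exact: measurable_SM_sq.
have f0 j q : (0 <= f j q)%E by rewrite lee_fin sqr_ge0.
have mS : measurable_fun (@SM R : set (mplane * mR)%type) (fun q => \sum_(j <oo) f j q)%E.
  by apply: ge0_emeasurable_sum.
have S0 q : @SM R q -> (0 <= \sum_(j <oo) f j q)%E by move=> _; exact: nneseries_ge0.
have Sfin : (\int[vol R]_(q in @SM R) (\sum_(j <oo) f j q) < +oo)%E.
  by rewrite integral_nneseries//; exact: measurable_SM.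
have := ray_integral_lty mS S0 Sfin.
apply: aeS => p h hp; have {h} := h hp.
have mfr j : measurable_fun (ray_itv p) (fun t : mR => f j (ray_SM p t)) by exact: measurable_ray (mf j).
rewrite (@integral_nneseries _ _ _ mu _ (@measurable_ray_itv R p) (fun j t => f j (ray_SM p t)))//.
rewrite -[X in (X < _)%E -> _]/(\sum_(j <oo) ray_sq (x j) p)%E => h.
have r0 j : (0 <= ray_sq (x j) p)%E by exact: sqnorm_ge0.
split; last exact: nneseries_term_cvg.
move=> j; apply: L2_ray; apply: le_lt_trans h.
apply: le_trans (nneseries_lim_ge j.+1 _) => [|k _ _]; last exact: r0.
by rewrite big_mkord big_ord_recr/= leeDr// sume_ge0.
Qed.

Variable a : plane -> C.
Hypothesis ha : {within @disc R, continuous (a : plane -> C^o)}.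

Definition xray_null (x : HS) : Prop := {ae area R, forall p, inward p -> xray a (per x) p = 0}.

Lemma attn_space p : inward p ->
  exists w : line_space p, w = (fun t => conjc (attn a p t)) :> (mR -> C).
Proof.
move=> hp; exists (toL2 mu (@measurable_ray_itv R p) (fun t => conjc (attn a p t))).
by rewrite toL2E//; exact: L2_attn.
Qed.

Lemma xray_null_lin c x y : xray_null x -> xray_null y -> xray_null (c *: x + y).
Proof.
move=> zx zy.
have h1 := aeS2 (fun p h1 h2 => conj h1 h2) (ae_ray_L2 x) (ae_ray_L2 y).
have h2 := aeS2 (fun p h1 h2 => conj h1 h2) zx zy.
apply: (aeS2 _ h1 h2) => p [hx hy] [hx0 hy0] hp.
have {}hx := hx hp; have {}hy := hy hp.
have [w wE] := attn_space hp.
have mI := @measurable_ray_itv R p.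
have E : (c *: x + y) \o ray_SM p = fun t => c * (x \o ray_SM p) t + (y \o ray_SM p) t.
  by apply/funext => t; exact: HS_linE.
have hxy : L2 mu (ray_itv p) ((c *: x + y) \o ray_SM p).
  by rewrite E; apply: L2_add => //; exact: L2_scale.
apply/(xray_eq0 hp wE hxy); rewrite /on_ray E toL2_lin//.
by apply: corth_lin; [exact/(xray_eq0 hp wE hx)/hx0|exact/(xray_eq0 hp wE hy)/hy0].
Qed.

Lemma xray_null_sub x y : xray_null (x - y) ->
  {ae area R, forall p, inward p -> xray a (per x) p = xray a (per y) p}.
Proof.
move=> zxy.
have h := aeS2 (fun p h1 h2 => conj h1 h2) (ae_ray_L2 x) (ae_ray_L2 y).
apply: (aeS2 _ h zxy) => p [hx hy] hz hp.
have {}hx := hx hp; have {}hy := hy hp; have {}hz := hz hp.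
have [w wE] := attn_space hp; have mI := @measurable_ray_itv R p.
have E : (x - y) \o ray_SM p = fun t => -1 * (y \o ray_SM p) t + (x \o ray_SM p) t.
  by apply/funext => t; rewrite mulN1r addrC.
have hxy : L2 mu (ray_itv p) ((x - y) \o ray_SM p).
  by rewrite E; apply: L2_add => //; exact: L2_scale.
move: hz; rewrite (xray_ip hp wE hxy) (xray_ip hp wE hx) (xray_ip hp wE hy).
rewrite /on_ray E toL2_lin// scaleN1r addrC !ipDl !ipNl => -[/eqP h1 /eqP h2].
by move: h1 h2; rewrite !subr_eq0 => /eqP -> /eqP ->.
Qed.

Lemma xray_null_lim (u : nat -> HS) x : (forall n, xray_null (u n)) -> Hcvg u x -> xray_null x.
Proof.
move=> zu /HcvgP hu.
have q0 j : (0 : R) < 2^-1 ^+ j by rewrite exprn_gt0// invr_gt0.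
(* Distances below [2^-j] have summable squares, as [ae_ray_cvg0] requires. *)
have /choice[N hN] : forall j, exists n, nm (u n - x) < 2^-1 ^+ j.
  by move=> j; have [n hn] := hu _ (q0 j); exists n; exact: hn.
have fin : (\sum_(j <oo) sqnorm (vol R) (@SM R) (u (N j) - x)%R < +oo)%E.
  apply: (@le_lt_trans _ _ (\sum_(j <oo) (2^-1 ^+ j)%:E)%E).
    apply: lee_nneseries => [j _ _|j _]; first exact: sqnorm_ge0.
    rewrite (sqnorm_nm (u (N j) - x)) lee_fin expr2; apply: le_trans (ltW (hN j)).
    rewrite ler_piMr ?nm_ge0//; apply: le_trans (ltW (hN j)) _.
    by rewrite exprn_ile1 ?invr_ge0// invf_le1 ?ler1n.
  rewrite (_ : (fun _ => _) = (fun n => (series (geometric 1 2^-1) n)%:E)).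
    have h2 : `|2^-1| < 1 :> R by rewrite ger0_norm ?invr_ge0// invf_lt1 ?ltr1n.
    by rewrite EFin_lim ?ltry//; apply/cvg_ex; eexists; exact: cvg_geometric_series.
  apply/funext => n; rewrite -sumEFin; apply: eq_bigr => i _.
  by rewrite /geometric /= mul1r.
have zN := ae_foralln (fun j => zu (N j)).
have hd := @ae_ray_cvg0 (fun j => u (N j) - x) fin.
apply: (aeS2 _ (ae_ray_L2 x) (aeS2 (fun p h1 h2 => conj h1 h2) zN hd)) => p hx [hz hc] hp.
have {}hx := hx hp; have [hL hc0] := hc hp.
have [w wE] := attn_space hp.
have hL' j : L2 mu (ray_itv p) (u (N j) \o ray_SM p).
  have -> : u (N j) \o ray_SM p = fun t => ((u (N j) - x) \o ray_SM p) t + (x \o ray_SM p) t.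
    by apply/funext => t; rewrite [RHS](HS_subK (u (N j)) x).
  by apply: L2_add => //; exact: measurable_ray_itv.
apply/(xray_eq0 hp wE hx).
apply: (@corth_lim _ _ (fun j => on_ray p (u (N j)))).
  by move=> j; apply/(xray_eq0 hp wE (hL' j)); exact: hz.
apply/L2_cvgP; rewrite /L2_cvg; apply: cvg_trans hc0; apply: near_eq_cvg.
apply: nearW => j; rewrite /ray_sq; congr (sqnorm _ _ _); apply/funext => t.
by rewrite /on_ray !toL2E//= L2spaceB.
Qed.

End Kernel.

(** The two parts of the complex integrand have the same shape up to a quarter turn of the phase, so
    one real lemma, [line_ftc], serves for both. *)
Lemma transport_Re (R : realType) (c s x1 y1 x2 y2 fr fi x y e ck sk cv sv : R) :
  complex.Re ((ck +i* sk) * (c%:C * (x1 +i* x2) + s%:C * (y1 +i* y2) + (fr +i* fi) * (x +i* y)) *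
    (e%:C * (cv +i* sv))) =
  e * ((c * x1 + s * y1 + (fr * x - fi * y)) * (cv * ck - sv * sk) -
       (c * x2 + s * y2 + (fr * y + fi * x)) * (sv * ck + cv * sk)).
Proof. by rewrite /=; ring. Qed.

Lemma transport_Im (R : realType) (c s x1 y1 x2 y2 fr fi x y e ck sk cv sv : R) :
  complex.Im ((ck +i* sk) * (c%:C * (x1 +i* x2) + s%:C * (y1 +i* y2) + (fr +i* fi) * (x +i* y)) *
    (e%:C * (cv +i* sv))) =
  e * ((c * x1 + s * y1 + (fr * x - fi * y)) * (sv * ck + cv * sk) -
       (c * x2 + s * y2 + (fr * y + fi * x)) * - (cv * ck - sv * sk)).
Proof. by rewrite /=; ring. Qed.

(** * The fundamental theorem of calculus on a chord *)

Section LineFTC.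
Variable R : realType.
Local Notation C := R[i].
Local Notation plane := (R * R)%type.
Local Notation mR := (measurableTypeR R).
Local Notation mu := (@lebesgue_measure R).

Lemma is_derive_trig_shift (v : R -> R) (t dv s : R) : is_derive t (1 : R) v dv ->
  is_derive t (1 : R) (fun x => cos (v x + s)) (- (dv * sin (v t + s))) /\
  is_derive t (1 : R) (fun x => sin (v x + s)) (dv * cos (v t + s)).
Proof.
move=> hv; have hw : is_derive t (1 : R) (fun x => v x + s) dv.
  by rewrite -[dv]addr0; apply: is_deriveD.
split.
  apply: (is_derive_eq (@is_derive1_comp _ cos (fun x => v x + s) t _ _ (is_derive_cos _) hw)).
  by ring.
apply: (is_derive_eq (@is_derive1_comp _ sin (fun x => v x + s) t _ _ (is_derive_sin _) hw)).
by ring.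
Qed.

Lemma is_derive_exp_comp (u : R -> R) (t du : R) : is_derive t (1 : R) u du ->
  is_derive t (1 : R) (fun x => expR (u x)) (du * expR (u t)).
Proof.
move=> hu; apply: (is_derive_eq (@is_derive1_comp _ expR u t _ _ (is_derive_expR _) hu)).
by ring.
Qed.

(** The integrand is the derivative of the real part of [exp (u + i (v + s)) (r + i q)], which
    vanishes at both ends along with [r] and [q]. *)
Lemma line_ftc (l s : R) (r q r' q' fr fi u v : R -> R) : 0 <= l ->
  (forall t, 0 <= t -> t <= l -> is_derive t (1 : R) r (r' t)) ->
  (forall t, 0 <= t -> t <= l -> is_derive t (1 : R) q (q' t)) ->
  (forall t, 0 <= t -> t <= l -> is_derive t (1 : R) u (fr t)) ->
  (forall t, 0 <= t -> t <= l -> is_derive t (1 : R) v (fi t)) ->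
  continuous r' -> continuous q' -> continuous fr -> continuous fi ->
  r 0 = 0 -> q 0 = 0 -> r l = 0 -> q l = 0 ->
  Rintegral mu `[0, l] (fun t => expR (u t) *
    ((r' t + (fr t * r t - fi t * q t)) * cos (v t + s) -
     (q' t + (fr t * q t + fi t * r t)) * sin (v t + s))) = 0.
Proof.
move=> l0 dr dq du dv cr' cq' cfr cfi r0 q0 rl ql.
(* A tangential direction gives a chord reduced to a point. *)
have [l1|l1] := eqVneq l 0; first by rewrite l1 set_itv1 Rintegral_set1.
have lp : 0 < l by rewrite lt_neqAle eq_sym l1.
pose Q t := expR (u t) * (r t * cos (v t + s) - q t * sin (v t + s)).
set f := (X in Rintegral _ _ X).
have dQ t : 0 <= t -> t <= l -> is_derive t (1 : R) Q (f t).
  move=> t0 tl; have [hc hs] := is_derive_trig_shift s (dv t t0 tl).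
  have he := is_derive_exp_comp (du t t0 tl).
  have h1 := is_deriveM (dr t t0 tl) hc.
  have h2 := is_deriveM (dq t t0 tl) hs.
  apply: (is_derive_eq (is_deriveM he (is_deriveB h1 h2))).
  rewrite -[(r * _ - q * _) t]/(r t * cos (v t + s) - q t * sin (v t + s)) /f.
  rewrite -![_ *: _]/(_ * _); ring.
have cf t : 0 <= t -> t <= l -> {for t, continuous f}.
  move=> t0 tl; have [hc hs] := is_derive_trig_shift s (dv t t0 tl).
  have ce := is_derive_continuous (is_derive_exp_comp (du t t0 tl)).
  have cc := is_derive_continuous hc; have cs := is_derive_continuous hs.
  have cr := is_derive_continuous (dr t t0 tl); have cq := is_derive_continuous (dq t t0 tl).
  apply: cvgM; first exact: ce.
  apply: cvgB; apply: cvgM => //; apply: cvgD; try exact: cr'; try exact: cq'.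
    by apply: cvgB; apply: cvgM; [exact: cfr|exact: cr|exact: cfi|exact: cq].
  by apply: cvgD; apply: cvgM; [exact: cfr|exact: cq|exact: cfi|exact: cr].
rewrite /Rintegral (@continuous_FTC2 _ f Q)//.
- have QE t : r t = 0 -> q t = 0 -> Q t = 0 by rewrite /Q => -> ->; rewrite !mul0r subrr mulr0.
  by rewrite !QE// -EFinB subrr.
- apply: continuous_in_subspaceT => t; rewrite inE /= in_itv/= => /andP[t0 tl]; exact: cf.
- split.
  + by move=> t; rewrite in_itv/= => /andP[t0 tl]; case: (dQ t (ltW t0) (ltW tl)).
  + by apply: cvg_at_right_filter; exact: is_derive_continuous (dQ 0 (lexx _) l0).
  + by apply: cvg_at_left_filter; exact: is_derive_continuous (dQ l l0 (lexx _)).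
- by move=> t; rewrite in_itv/= => /andP[t0 tl]; rewrite derive1E; case: (dQ t (ltW t0) (ltW tl)).
Qed.

Section OneRay.
Variable p : plane.
Hypothesis hp : inward p.

Lemma linear_pair_dir (L : {linear plane -> R}) c s :
  L (c *: ((1, 0) : plane) + s *: ((0, 1) : plane)) = c * L (1, 0) + s * L (0, 1).
Proof. by rewrite linearD !linearZ. Qed.

Lemma is_derive_ray (F : plane -> R) t : differentiable F (ray_pt p t) ->
  is_derive t (1 : R) (F \o ray_pt p)
    (cos (angle p) * 'D_(1, 0) F (ray_pt p t) + sin (angle p) * 'D_(0, 1) F (ray_pt p t)).
Proof.
move=> dF; set c := cos _; set s := sin _.
have dv (v : plane) : derivable F (ray_pt p t) v by exact: diff_derivable.
have E : (fun h : R => h^-1 *: ((F \o ray_pt p) (h *: (1 : R) + t) - (F \o ray_pt p) t)) =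
         (fun h : R => h^-1 *: (F (h *: ((c, s) : plane) + ray_pt p t) - F (ray_pt p t))).
  apply/funext => h; congr (_ *: (F _ - _)); rewrite /ray_pt /ray /=; congr pair;
    rewrite /= -![_ *: _]/(_ * _) -/c -/s; ring.
split; first by rewrite /derivable /= E; exact: dv.
have DE v : 'D_v F (ray_pt p t) = 'd F (ray_pt p t) v by exact: deriveE.
rewrite [LHS]/derive E -/(derive F (ray_pt p t) (c, s)) !DE.
have -> : (c, s) = c *: ((1, 0) : plane) + s *: ((0, 1) : plane).
  transitivity (c * 1 + s * 0, c * 0 + s * 1) => //.
  by rewrite !mulr1 !mulr0 addr0 add0r.
exact: linear_pair_dir.
Qed.

(** Just before the entry and just after the exit the line is off the disc, where [F] is zero;
    continuity carries this to the end points. *)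
Lemma ray_ends (F : plane -> R) : continuous F -> (forall z, ~ disc z -> F z = 0) ->
  F (ray_pt p 0) = 0 /\ F (ray_pt p (len p)) = 0.
Proof.
move=> cF F0; have cG t : F (ray_pt p s) @[s --> t] --> F (ray_pt p t).
  by apply: continuous_comp; [exact: continuous_ray_pt|exact: cF].
have l0 := len_ge0 hp; split.
- have h := cvg_at_left_filter (cG 0).
  apply: (cvg_unique _ h); first exact: norm_hausdorff.
  apply: cvg_trans (@cvg_cst _ (0 : R) _ (at_left (0 : R)) _); apply: near_eq_cvg.
  near=> t; rewrite F0//= => /ray_disc; apply/negP; rewrite -ltNge.
  by rewrite nmulr_rgt0 ?subr_lt0 ?(lt_le_trans _ l0).
- have h := cvg_at_right_filter (cG (len p)).
  apply: (cvg_unique _ h); first exact: norm_hausdorff.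
  apply: cvg_trans (@cvg_cst _ (0 : R) _ (at_right (len p)) _); apply: near_eq_cvg.
  near=> t; rewrite F0//= => /ray_disc; apply/negP; rewrite -ltNge.
  by rewrite pmulr_rgt0 ?subr_gt0// (le_lt_trans l0).
Unshelve. all: by end_near. Qed.

End OneRay.

Variable a : plane -> C.
Hypothesis ha : {within @disc R, continuous (a : plane -> C^o)}.

(** This is [(X + a) (e^(i k theta) phi)], with [X] written as [cos theta dx + sin theta dy]. *)
Definition transport (k : int) (phi : plane -> C) (q : plane * R) : C :=
  expi (k%:~R * q.2) * ((cos q.2)%:C * dx phi q.1 + (sin q.2)%:C * dy phi q.1 + a q.1 * phi q.1).

Lemma xray_transport k phi p : test_function phi -> inward p -> xray a (per (transport k phi)) p = 0.
Proof.
move=> tp hp; rewrite xray_per//.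
have [fr [fi [u [v [cfr cfi aE hd hw]]]]] := line_weight ha hp.
have tIP t : 0 <= t -> t <= len p -> ray_itv p t by move=> t0 tl; rewrite /ray_itv /= in_itv/= t0.
pose c := cos (angle p); pose s := sin (angle p).
have sr := test_Re tp; have si := test_Im tp.
pose r := (fun z => complex.Re (phi z)) \o ray_pt p.
pose q := (fun z => complex.Im (phi z)) \o ray_pt p.
pose r' t := c * 'D_(1, 0) (fun z => complex.Re (phi z)) (ray_pt p t) +
  s * 'D_(0, 1) (fun z => complex.Re (phi z)) (ray_pt p t).
pose q' t := c * 'D_(1, 0) (fun z => complex.Im (phi z)) (ray_pt p t) +
  s * 'D_(0, 1) (fun z => complex.Im (phi z)) (ray_pt p t).
have dr t : 0 <= t -> t <= len p -> is_derive t (1 : R) r (r' t).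
  by move=> _ _; exact: (@is_derive_ray p (fun z => complex.Re (phi z)) t (rsmooth_diff _ sr)).
have dq t : 0 <= t -> t <= len p -> is_derive t (1 : R) q (q' t).
  by move=> _ _; exact: (@is_derive_ray p (fun z => complex.Im (phi z)) t (rsmooth_diff _ si)).
have cF (F : plane -> R) : continuous F -> continuous (fun t => F (ray_pt p t)).
  by move=> cF t; apply: continuous_comp; [exact: continuous_ray_pt|exact: cF].
have cFD (F : plane -> R) : rsmooth F -> continuous (fun t =>
    c * 'D_(1, 0) F (ray_pt p t) + s * 'D_(0, 1) F (ray_pt p t)).
  move=> sF t; have h1 := cF _ (rsmooth_cont (rsmooth_dx sF)) t.
  have h2 := cF _ (rsmooth_cont (rsmooth_dy sF)) t.
  by apply: cvgD; apply: cvgMr; [exact: h1|exact: h2].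
have cr' : continuous r' by exact: cFD.
have cq' : continuous q' by exact: cFD.
have off z : ~ disc z -> phi z = 0 by exact: test_off_disc.
have [r0 rl] := ray_ends hp (rsmooth_cont sr) (fun z h => congr1 (@complex.Re R) (off z h)).
have [q0 ql] := ray_ends hp (rsmooth_cont si) (fun z h => congr1 (@complex.Im R) (off z h)).
pose kt : R := k%:~R * wrap (angle p).
have FTC x := @line_ftc (len p) x r q r' q' fr fi u v (len_ge0 hp) dr dq
  (fun t t0 tl => (hd t (tIP t t0 tl)).1) (fun t t0 tl => (hd t (tIP t t0 tl)).2)
  cr' cq' cfr cfi r0 q0 rl ql.
rewrite /Cintegral; have -> : forall x y : R, x = 0 -> y = 0 -> (x +i* y)%C = 0 by move=> x y -> ->.
- by [].
- rewrite -[RHS](FTC kt); apply: eq_Rintegral => t; rewrite inE => tI.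
  rewrite -/(attn a p t) hw// /transport aE// cos_wrap sin_wrap -/c -/s -/kt cosD sinD.
  by rewrite -transport_Re /r /q /=; case: (phi _).
(* The imaginary part is the real part with the phase turned by [- pi / 2]. *)
- rewrite -[RHS](FTC (kt - pi / 2)); apply: eq_Rintegral => t; rewrite inE => tI.
  rewrite -/(attn a p t) hw// /transport aE// cos_wrap sin_wrap -/c -/s -/kt.
  have -> : cos (v t + (kt - pi / 2)) = sin (v t) * cos kt + cos (v t) * sin kt.
    by rewrite addrA cosB cos_pihalf sin_pihalf mulr0 add0r mulr1 sinD.
  have -> : sin (v t + (kt - pi / 2)) = - (cos (v t) * cos kt - sin (v t) * sin kt).
    by rewrite addrA sinB cos_pihalf sin_pihalf mulr0 sub0r mulr1 cosD.
  by rewrite -transport_Im /r /q /=; case: (phi _).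
Qed.

End LineFTC.

(** * The concrete spaces *)

Section PlaneModel.
Variable R : realType.
Local Notation plane := (R * R)%type.
Local Notation C := R[i].
Local Notation HM := (HM R).
Implicit Types (phi psi : plane -> C) (u v w : HM).

Definition GM u ux uy := exists phi, [/\ test_function phi, u = toHM phi,
  ux = toHM (dx phi) & uy = toHM (dy phi)].

Lemma toHM0 : toHM (fun=> 0) = 0 :> HM.
Proof. by apply: L2space_ext => z; rewrite toHM_test//; exact: test0. Qed.

Lemma GM_space : gradient_space GM.
Proof.
split.
- exists (fun=> 0); split; rewrite ?dx_cst0 ?dy_cst0 ?toHM0//; exact: test0.
- move=> c u ux uy v vx vy [phi [tp -> -> ->]] [psi [tq -> -> ->]].
  exists (fun z => c * phi z + psi z); split; first exact: test_lin.
  + exact: (esym (toHM_lin c tp tq)).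
  + exact: (esym (toHM_dx_lin c tp tq)).
  + exact: (esym (toHM_dy_lin c tp tq)).
- by move=> u ux uy [phi [tp _ -> ->]]; exact: ip_dx_dy_test.
- by move=> u ux uy [phi [tp -> -> _]]; exact: poincare_test.
Qed.

Lemma L2_cvg_toHM (phi : nat -> plane -> C) f : (forall n, L2M (phi n)) -> L2M f ->
  L2_cvg (area R) (@disc R) phi f <-> Hcvg (fun n => toHM (phi n) : HM) (toHM f).
Proof.
move=> hp hf; have E : phi = (fun n => toHM (phi n) : plane -> C).
  by apply/funext => n; rewrite toHME.
by rewrite -L2_cvgP -E toHME.
Qed.

Section Weak.
Variables (L L' : (plane -> C) -> plane -> C).
Hypothesis tL : forall phi, test_function phi -> test_function (L phi).
Hypothesis cL : forall phi, test_function phi ->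
  cj (toHM (L phi)) = toHM (L' (fun z => conjc (phi z))).
Hypothesis iL : forall phi, test_function phi ->
  toHM (L' (fun z => 'i%C * phi z + 0)) = 'i%C *: toHM (L' phi) :> HM.

(** [L'] is the operator for which [conj (L phi) = L' (conj phi)]. Using the conjugated test
    function, and [i] times it, recovers both parts of the unconjugated pairing from the real
    product. *)
Lemma weaklyP w wL : (forall phi, test_function phi ->
    ip w (toHM (L' phi)) = - ip wL (toHM phi)) -> weakly L w wL.
Proof.
move=> h phi tp; have tc := test_conj tp.
have ti : test_function (fun z => 'i%C * conjc (phi z) + 0) by apply: test_lin => //; exact: test0.
have -> : (fun z => w z * L phi z) = (fun z => w z * (toHM (L phi) : plane -> C) z).
  by rewrite toHM_test//; exact: tL.
have -> : (fun z => wL z * phi z) = (fun z => wL z * (toHM phi : plane -> C) z).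
  by rewrite toHM_test.
rewrite !Cintegral_ip cL// -iL// cj_test//.
rewrite (h _ tc) (h _ ti) toHM_lin//; last exact: test0.
by rewrite toHM0 addr0.
Qed.

End Weak.

Lemma toHM_del phi : test_function phi ->
  test_function (del phi) /\ toHM (del phi) = Dsg true (toHM (dx phi)) (toHM (dy phi)) :> HM.
Proof.
move=> tp; have tx := test_dx tp; have ty := test_dy tp.
have E : del phi = fun z => 2%:R^-1 * ((fun x => - 'i%C * dy phi x + dx phi x) z) + 0.
  by apply/funext => z; rewrite /del addr0 mulNr addrC.
have t1 : test_function (fun x => - 'i%C * dy phi x + dx phi x) by exact: test_lin.
have t0 := test0 R.
rewrite E; split; first exact: test_lin.
by rewrite toHM_lin// toHM_lin// toHM0 addr0 /Dsg addrC.
Qed.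

Lemma toHM_delbar phi : test_function phi ->
  test_function (delbar phi) /\ toHM (delbar phi) = Dsg false (toHM (dx phi)) (toHM (dy phi)) :> HM.
Proof.
move=> tp; have tx := test_dx tp; have ty := test_dy tp.
have E : delbar phi = fun z => 2%:R^-1 * ((fun x => 'i%C * dy phi x + dx phi x) z) + 0.
  by apply/funext => z; rewrite /delbar addr0 addrC.
have t1 : test_function (fun x => 'i%C * dy phi x + dx phi x) by exact: test_lin.
have t0 := test0 R.
rewrite E; split; first exact: test_lin.
by rewrite toHM_lin// toHM_lin// toHM0 addr0 /Dsg addrC.
Qed.

Lemma toHM_dx_i phi : test_function phi ->
  toHM (dx (fun z => 'i%C * phi z + 0)) = 'i%C *: toHM (dx phi) :> HM.
Proof. by move=> tp; rewrite toHM_dx_lin//; [rewrite dx_cst0 toHM0 addr0|exact: test0]. Qed.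

Lemma toHM_dy_i phi : test_function phi ->
  toHM (dy (fun z => 'i%C * phi z + 0)) = 'i%C *: toHM (dy phi) :> HM.
Proof. by move=> tp; rewrite toHM_dy_lin//; [rewrite dy_cst0 toHM0 addr0|exact: test0]. Qed.

Lemma test_i phi : test_function phi -> test_function (fun z => 'i%C * phi z + 0).
Proof. by move=> tp; apply: test_lin => //; exact: test0. Qed.

Lemma toHM_del_i phi : test_function phi ->
  toHM (del (fun z => 'i%C * phi z + 0)) = 'i%C *: toHM (del phi) :> HM.
Proof.
move=> tp; rewrite (toHM_del (test_i tp)).2 (toHM_del tp).2 toHM_dx_i// toHM_dy_i//.
exact: DsgZ.
Qed.

Lemma toHM_delbar_i phi : test_function phi ->
  toHM (delbar (fun z => 'i%C * phi z + 0)) = 'i%C *: toHM (delbar phi) :> HM.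
Proof.
move=> tp; rewrite (toHM_delbar (test_i tp)).2 (toHM_delbar tp).2 toHM_dx_i// toHM_dy_i//.
exact: DsgZ.
Qed.

Lemma conj_half_sub (x y : C) :
  conjc (2%:R^-1 * (x - 'i%C * y)) = 2%:R^-1 * (conjc x + 'i%C * conjc y).
Proof.
have -> : (2%:R^-1 : C) = (2^-1)%:C by rewrite fmorphV rmorph_nat.
by case: x y => x1 x2 [y1 y2]; apply: complex_eq => /=; ring.
Qed.

Lemma conj_half_add (x y : C) :
  conjc (2%:R^-1 * (x + 'i%C * y)) = 2%:R^-1 * (conjc x - 'i%C * conjc y).
Proof.
have -> : (2%:R^-1 : C) = (2^-1)%:C by rewrite fmorphV rmorph_nat.
by case: x y => x1 x2 [y1 y2]; apply: complex_eq => /=; ring.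
Qed.

Lemma del_conj phi : test_function phi ->
  (fun z => conjc (del phi z)) = delbar (fun z => conjc (phi z)).
Proof.
move=> tp; have sp := test_smooth tp; apply/funext => z.
by rewrite /del /delbar dx_conj// dy_conj// -conj_half_sub.
Qed.

Lemma delbar_conj phi : test_function phi ->
  (fun z => conjc (delbar phi z)) = del (fun z => conjc (phi z)).
Proof.
move=> tp; have sp := test_smooth tp; apply/funext => z.
by rewrite /del /delbar dx_conj// dy_conj// -conj_half_add.
Qed.

Lemma weakly_dx w wx : (forall phi, test_function phi ->
  ip w (toHM (dx phi)) = - ip wx (toHM phi)) -> weakly (@dx R) w wx.
Proof.
apply: weaklyP; [exact: test_dx| |exact: toHM_dx_i].
by move=> phi tp; rewrite cj_test ?dx_conj//; [exact: test_smooth|exact: test_dx].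
Qed.

Lemma weakly_dy w wy : (forall phi, test_function phi ->
  ip w (toHM (dy phi)) = - ip wy (toHM phi)) -> weakly (@dy R) w wy.
Proof.
apply: weaklyP; [exact: test_dy| |exact: toHM_dy_i].
by move=> phi tp; rewrite cj_test ?dy_conj//; [exact: test_smooth|exact: test_dy].
Qed.

(** Conjugation exchanges [del] and [delbar]: orthogonality to the range of [del] becomes, in the
    pairing without conjugation, a weak equation for [delbar]. *)
Lemma Kso_delbar h : Kso GM true h -> weakly (@delbar R) h (fun=> 0).
Proof.
move=> hk; have -> : (fun=> 0) = (0 : HM) :> (plane -> C) by [].
apply: (weaklyP (L' := @del R)); [by move=> phi /toHM_delbar[]| |exact: toHM_del_i|].
  by move=> phi tp; rewrite cj_test ?delbar_conj//; exact: (toHM_delbar tp).1.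
move=> phi tp; rewrite ip0l oppr0 (toHM_del tp).2; apply: hk.
by exists phi.
Qed.

Lemma Kso_del h : Kso GM false h -> weakly (@del R) h (fun=> 0).
Proof.
move=> hk; have -> : (fun=> 0) = (0 : HM) :> (plane -> C) by [].
apply: (weaklyP (L' := @delbar R)); [by move=> phi /toHM_del[]| |exact: toHM_delbar_i|].
  by move=> phi tp; rewrite cj_test ?del_conj//; exact: (toHM_del tp).1.
move=> phi tp; rewrite ip0l oppr0 (toHM_delbar tp).2; apply: hk.
by exists phi.
Qed.

Lemma Hcvg_ip_opp (x y : nat -> HM) (x0 y0 v v' : HM) : Hcvg x x0 -> Hcvg y y0 ->
  (forall n, ip (x n) v = - ip (y n) v') -> ip x0 v = - ip y0 v'.
Proof.
move=> hx hy E; have h1 := @Hcvg_ip _ _ x x0 v hx.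
have h2 : (fun n => - ip (y n) v') @ \oo --> - ip y0 v'.
  by apply: cvgN; exact: (@Hcvg_ip _ _ y y0 v' hy).
have EE : (fun n => ip (x n) v) = (fun n => - ip (y n) v') by exact/funext.
rewrite EE in h1; exact: (cvg_unique (@norm_hausdorff _ _) h1 h2).
Qed.

(** Integration by parts holds for the approximating test functions and passes to the limit, which
    provides the weak derivatives. *)
Lemma H10_gradient w wx wy : H10 GM w wx wy -> H10_grad w wx wy.
Proof.
move=> /H10P[u [ux [uy [hG h0 hx hy]]]].
have [phi hphi] := choice hG.
have tp n : test_function (phi n) by case: (hphi n).
split.
- by split; exact: L2funP.
- apply: weakly_dx => psi tq; apply: Hcvg_ip_opp h0 hx _ => n.
  by case: (hphi n) => _ -> -> _; exact: ip_dx_test.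
- apply: weakly_dy => psi tq; apply: Hcvg_ip_opp h0 hy _ => n.
  by case: (hphi n) => _ -> _ ->; exact: ip_dy_test.
- exists phi; split => //.
  + have := (L2_cvg_toHM (fun n => L2M_test (tp n)) (L2funP w)).2; apply; rewrite toHM_val.
    by have -> : (fun n => toHM (phi n)) = u by apply/funext => n; case: (hphi n).
  + have := (L2_cvg_toHM (fun n => L2M_test (test_dx (tp n))) (L2funP wx)).2; apply; rewrite toHM_val.
    by have -> : (fun n => toHM (dx (phi n))) = ux by apply/funext => n; case: (hphi n).
  + have := (L2_cvg_toHM (fun n => L2M_test (test_dy (tp n))) (L2funP wy)).2; apply; rewrite toHM_val.
    by have -> : (fun n => toHM (dy (phi n))) = uy by apply/funext => n; case: (hphi n).
Qed.

Lemma gradient_H10 f fx fy : H10_grad f fx fy -> H10 GM (toHM f) (toHM fx) (toHM fy).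
Proof.
move=> [[hf hfx hfy] _ _ [phi [tp c0 cx cy]]]; apply/H10P.
exists (fun n => toHM (phi n)), (fun n => toHM (dx (phi n))), (fun n => toHM (dy (phi n))).
split; first by move=> n; exists (phi n).
- exact/(L2_cvg_toHM (fun n => L2M_test (tp n))).
- exact/(L2_cvg_toHM (fun n => L2M_test (test_dx (tp n)))).
- exact/(L2_cvg_toHM (fun n => L2M_test (test_dy (tp n)))).
Qed.

Lemma sqnormM_toHM f : L2M f -> sqnormM f = (nm (toHM f : HM) ^+ 2)%:E.
Proof. by move=> hf; rewrite -sqnorm_nm toHME. Qed.

Let poincare_set := [set c : R | 0 < c /\ forall f fx fy, H10_grad f fx fy ->
    (sqnormM f <= c%:E * (sqnormM fx + sqnormM fy))%E].

Lemma poincare4 : poincare_set 4.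
Proof.
split; first by []. move=> f fx fy hg; have hH := gradient_H10 hg.
have [[hf hfx hfy] _ _ _] := hg.
rewrite !sqnormM_toHM// -EFinD -EFinM lee_fin (le_trans (H10_poincare4 GM_space hH))//.
by rewrite ler_pM2l// lerDl sqr_ge0.
Qed.

Lemma poincare_constant_ge0 : 0 <= poincare_constant R.
Proof.
apply: (@lb_le_inf R poincare_set); first by exists 4; exact: poincare4.
by move=> c [/ltW].
Qed.

(** The infimum is attained, because [nm w ^+ 2 / Q] is a lower bound of the admissible constants;
    when [Q = 0], the constant 4 already forces [nm w = 0]. *)
Lemma H10_poincare w wx wy : H10 GM w wx wy ->
  nm w ^+ 2 <= poincare_constant R * (nm wx ^+ 2 + nm wy ^+ 2).
Proof.
move=> hw; have hg := H10_gradient hw.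
set Q := nm wx ^+ 2 + nm wy ^+ 2; have Q0 : 0 <= Q by rewrite addr_ge0 ?sqr_ge0.
have hc c : poincare_set c -> nm w ^+ 2 <= c * Q.
  by move=> [_ /(_ _ _ _ hg)]; rewrite /sqnormM !sqnorm_nm -EFinD -EFinM lee_fin.
have [Q00|Qn] := eqVneq Q 0.
  by have := hc _ poincare4; rewrite Q00 !mulr0.
have Qp : 0 < Q by rewrite lt_neqAle eq_sym Qn.
rewrite -ler_pdivrMr//; apply: (@lb_le_inf R poincare_set); first by exists 4; exact: poincare4.
by move=> c /hc; rewrite ler_pdivrMr.
Qed.

Variable a : plane -> C.
Hypothesis ha : {within @disc R, continuous (a : plane -> C^o)}.

Definition amul u : HM := toHM (fun z => a z * u z).

Lemma amulE u : amul u = (fun z => a z * u z) :> (plane -> C).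
Proof.
rewrite /amul toHME//; apply: (@L2_mul _ _ R (area R) (@disc R) (@measurable_disc R) a (sup_disc a)).
- exact: cmeasurable_attenuation.
- by move=> z Dz; exact: attenuation_le.
- exact: L2funP.
Qed.

Lemma amul_lin c u v : amul (c *: u + v) = c *: amul u + amul v.
Proof.
by apply: L2space_ext => z; rewrite L2spaceD L2spaceZ !amulE L2spaceD L2spaceZ; ring.
Qed.

Lemma nm_amul u : nm (amul u) <= sup_disc a * nm u.
Proof.
have s0 := sup_disc_ge0 ha.
suff : (sqnorm (area R) (@disc R) (amul u) <= (sup_disc a ^+ 2)%:E * sqnorm (area R) (@disc R) u)%E.
  rewrite (sqnorm_nm (amul u)) (sqnorm_nm u) -EFinM lee_fin -exprMn ler_pXn2r//.
    by rewrite nnegrE nm_ge0.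
  by rewrite nnegrE mulr_ge0// nm_ge0.
rewrite amulE.
have mD := @measurable_disc R; have [mu_ _] := L2funP u.
rewrite /sqnorm -ge0_integralZl//; last 3 first.
- exact/measurable_EFinP/cmeasurable_sq.
- by move=> z _; rewrite lee_fin sqr_ge0.
- by rewrite lee_fin sqr_ge0.
apply: ge0_le_integral => //.
- by move=> z _; rewrite lee_fin sqr_ge0.
- apply/measurable_EFinP/cmeasurable_sq; apply: cmeasurableM => //.
  exact: cmeasurable_attenuation.
- by apply/measurable_EFinP/measurable_funM; [exact: measurable_cst|exact: cmeasurable_sq].
- move=> z Dz; rewrite -EFinM lee_fin normc_sqM ler_wpM2r ?sqr_ge0//.
  by rewrite ler_pXn2r ?nnegrE ?(attenuation_le ha)//; case: (a z) => x y; exact: sqrtr_ge0.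
Qed.

End PlaneModel.

HB.lock Definition toHS (R : realType) (f : (R * R) * R -> R[i]) : HS R :=
  toL2 (vol R) (@measurable_SM R) f.

Lemma Hcvg_lipschitz (R : realType) (V W : semiHilbertType R) (f : V -> W) (c : R) (u : nat -> V) x :
  (forall y z, f (y - z) = f y - f z) -> 0 <= c -> (forall y, nm (f y) <= c * nm y) ->
  Hcvg u x -> Hcvg (fun n => f (u n)) (f x).
Proof.
move=> fB c0 fc hu; apply: (squeeze_cvgr _ (@cvg_cst _ _ _ _ _)).
  by apply: nearW => n; rewrite nm_ge0 -fB; exact: fc.
by rewrite -[X in _ --> X](mulr0 c); apply: cvgMr.
Qed.

Section SphereModel.
Variable R : realType.
Local Notation plane := (R * R)%type.
Local Notation C := R[i].
Local Notation HM := (HM R).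
Local Notation HS := (HS R).
Implicit Types (k j : int) (u v w : HM) (x y : HS).
Local Notation mD := (@measurable_disc R).
Local Notation fD := (@area_disc_lty R).

Lemma toHSE f : L2 (vol R) (@SM R) f -> toHS f = f :> (plane * R -> C).
Proof. by move=> hf; rewrite unlock toL2E. Qed.

Lemma toHS_lin c f g : L2 (vol R) (@SM R) f -> L2 (vol R) (@SM R) g ->
  toHS (fun p => c * f p + g p) = c *: toHS f + toHS g.
Proof. by move=> hf hg; rewrite unlock; exact: toL2_lin. Qed.

Definition Em k u : HS := toHS (harmonic k u).

Lemma EmE k u : Em k u = harmonic k u :> (plane * R -> C).
Proof. by apply: toHSE; exact: (L2_harmonic (m := area_sf R) mD k (L2funP u)). Qed.

Lemma Em_lin k c u v : Em k (c *: u + v) = c *: Em k u + Em k v.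
Proof.
apply: L2space_ext => q; rewrite L2spaceD L2spaceZ !EmE /harmonic L2spaceD L2spaceZ; ring.
Qed.

Lemma EmB k u v : Em k (u - v) = Em k u - Em k v.
Proof. by rewrite addrC -scaleN1r Em_lin scaleN1r addrC. Qed.

Definition modeM k x : HM := toHM (fmode k x).

Lemma modeME k x : modeM k x = fmode k x :> (plane -> C).
Proof.
rewrite /modeM toHME//.
have h := @L2_fmode _ _ _ (area_sf R) _ mD fD k x (L2funP x).
exact: h.
Qed.

Lemma modeM_adj k x u : ip x (Em k u) = 2 * pi * ip (modeM k x) u.
Proof.
have := fmode_adjoint (m := area_sf R) mD fD k (L2funP x) (L2funP u).
by rewrite -(EmE k u) -(modeME k x).
Qed.

Lemma modeM_Em j k u : modeM k (Em j u) = if j == k then u else 0.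
Proof.
by apply: L2space_ext => z; rewrite modeME EmE fmode_harmonic; case: ifP.
Qed.

Lemma Em_ip j k u v : ip (Em j u) (Em k v) = if j == k then 2 * pi * ip u v else 0.
Proof. by rewrite modeM_adj modeM_Em; case: ifP => // _; rewrite ip0l mulr0. Qed.

Lemma modeM_total x : (forall k, aeq (modeM k x) 0) -> aeq x 0.
Proof.
move=> h; apply/aeq_ae; apply: (fmode_total (m := area_sf R) mD (L2funP x)) => k.
by have /aeq_ae := h k; rewrite modeME.
Qed.

Lemma nm_Em k u : nm (Em k u) = Num.sqrt (2 * pi) * nm u.
Proof. by rewrite /nm Em_ip eqxx sqrtrM// mulr_ge0// pi_ge0. Qed.

Lemma Hcvg_Em k (u : nat -> HM) w : Hcvg u w -> Hcvg (fun n => Em k (u n)) (Em k w).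
Proof.
apply: (@Hcvg_lipschitz _ _ _ (Em k) (Num.sqrt (2 * pi))); first exact: EmB.
  exact: sqrtr_ge0.
by move=> v; rewrite nm_Em.
Qed.

Variable a : plane -> C.
Hypothesis ha : {within @disc R, continuous (a : plane -> C^o)}.

Lemma Hcvg_amul (u : nat -> HM) w : Hcvg u w -> Hcvg (fun n => amul a (u n)) (amul a w).
Proof.
apply: (@Hcvg_lipschitz _ _ _ (amul a) (sup_disc a)).
- by move=> v v'; rewrite addrC -scaleN1r (amul_lin ha) scaleN1r addrC.
- exact: sup_disc_ge0.
- exact: nm_amul.
Qed.

Lemma expi_shift (t : R) k : expi ((k + 1)%:~R * t) = expi (k%:~R * t) * expi t /\
  expi ((k - 1)%:~R * t) = expi (k%:~R * t) * conjc (expi t).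
Proof.
by split; rewrite ?intrD ?intrB mulrDl ?mulNr mul1r /expi ?cosD ?sinD ?cosN ?sinN;
  apply: complex_eq => /=; ring.
Qed.

(** The identity [e^(i theta) del + e^(-i theta) delbar = cos theta dx + sin theta dy], multiplied
    by the factor of frequency [k]. *)
Lemma transport_algebra (e : C) (c s : R) (X Y Z : C) :
  e * (c +i* s) * (2%:R^-1 * (X + - 'i%C * Y)) + e * (c -i* s) * (2%:R^-1 * (X + 'i%C * Y)) + e * Z =
  e * (c%:C * X + s%:C * Y + Z).
Proof.
have -> : (2%:R^-1 : C) = (2^-1)%:C by rewrite fmorphV rmorph_nat.
by case: e X Y Z => e1 e2 [x1 x2] [y1 y2] [z1 z2]; apply: complex_eq => /=; field.
Qed.

Definition transportM k w wx wy : HS :=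
  Em (k + 1) (Dsg true wx wy) + Em (k - 1) (Dsg false wx wy) + Em k (amul a w).

Lemma transportME k phi : test_function phi ->
  transportM k (toHM phi) (toHM (dx phi)) (toHM (dy phi)) = transport a k phi :> (plane * R -> C).
Proof.
move=> tp; apply/funext => q; rewrite /transportM !L2spaceD !EmE /harmonic.
have [-> ->] := expi_shift q.2 k; rewrite (amulE ha) /Dsg !L2spaceZ !L2spaceD !L2spaceZ.
rewrite (toHM_test tp) (toHM_test (test_dx tp)) (toHM_test (test_dy tp)).
exact: transport_algebra.
Qed.

Lemma xray_null_transportM k w wx wy : H10 (@GM R) w wx wy -> xray_null a (transportM k w wx wy).
Proof.
move=> /H10P[u [ux [uy [hG h0 hx hy]]]].
apply: (xray_null_lim ha (u := fun n => transportM k (u n) (ux n) (uy n))) => [n|].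
  have [phi [tp -> -> ->]] := hG n.
  rewrite /xray_null transportME//; apply: nearW => p; exact: (xray_transport ha).
apply: HcvgD; first by apply: HcvgD; apply: Hcvg_Em; exact: Hcvg_Dsg.
by apply: Hcvg_Em; exact: Hcvg_amul.
Qed.

Lemma xray_modelM : xray_model (@GM R) Em modeM (amul a) (2 * pi) (sup_disc a)
  (poincare_constant R) (xray_null a).
Proof.
split.
- exact: GM_space.
- by rewrite mulr_gt0// pi_gt0.
- exact: Em_lin.
- exact: Em_ip.
- exact: modeM_adj.
- exact: modeM_total.
- exact: amul_lin.
- exact: sup_disc_ge0.
- exact: nm_amul.
- exact: poincare_constant_ge0.
- exact: H10_poincare.
- exact: xray_null_lin.
- exact: xray_null_lim.
- exact: xray_null_transportM.
Qed.

End SphereModel.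

Section Periodic.
Variable R : realType.
Local Notation C := R[i].
Local Notation plane := (R * R)%type.
Local Notation mR := (measurableTypeR R).
Implicit Types (f g x y : plane * R -> C).

Lemma per_SM x q : @SM R q -> per x q = x q.
Proof. by case: q => z t [_ ht]; rewrite /per /= wrap_id. Qed.

Lemma sqnorm_eqin f g : (forall q, @SM R q -> f q = g q) ->
  sqnorm (vol R) (@SM R) f = sqnorm (vol R) (@SM R) g.
Proof. by move=> fg; apply: eq_integral => q; rewrite inE => hq; rewrite fg. Qed.

Lemma L2_eqin f g : (forall q, @SM R q -> f q = g q) ->
  L2 (vol R) (@SM R) f -> L2 (vol R) (@SM R) g.
Proof.
move=> fg [[m1 m2] fin]; split; last by rewrite -(sqnorm_eqin fg).
split; [apply: eq_measurable_fun m1|apply: eq_measurable_fun m2] => q;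
  by rewrite inE => hq; rewrite fg.
Qed.

Lemma L2SM_per (x : HS R) : L2SM (per x).
Proof.
split; first exact: per_periodic.
by apply: L2_eqin (L2funP x) => q hq; rewrite per_SM.
Qed.

Lemma periodic_int f z t (n : int) : periodic f -> disc z -> f (z, t + 2 * pi * n%:~R) = f (z, t).
Proof.
move=> pf Dz; have pos s (m : nat) : f (z, s + 2 * pi * m%:R) = f (z, s).
  elim: m => [|m ih]; first by rewrite mulr0 addr0.
  have -> : s + 2 * pi * m.+1%:R = s + 2 * pi * m%:R + 2 * pi by rewrite -natr1; ring.
  by rewrite pf.
case: n => m; first exact: pos.
by rewrite NegzE mulrNz mulrN -(pos (t - _) m.+1) subrK.
Qed.

Lemma periodic_wrap f z t : periodic f -> disc z -> f (z, wrap t) = f (z, t).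
Proof.
move=> pf Dz; have -> : wrap t = t + 2 * pi * (- Num.floor (t / (2 * pi)))%:~R.
  by rewrite /wrap mulrNz mulrN.
exact: periodic_int.
Qed.

(** [xray] evaluates [f] at an angle that may lie outside the fundamental interval, where vectors of
    [HS] carry no information; periodicity brings it back. *)
Lemma xray_periodic (a : plane -> C) f p : periodic f -> inward p -> xray a f p = xray a (per f) p.
Proof.
move=> pf hp; rewrite xray_per// /xray /xray_at -/(base p) -/(angle p) exit_len//.
have E t : ray_itv p t -> f (ray (base p) (angle p) t, angle p) = f (ray_SM p t).
  rewrite /ray_itv /= in_itv/= => /andP[t0 tl].
  by rewrite /ray_SM periodic_wrap//; exact: ray_disc_itv.
by rewrite /Cintegral; congr (_ +i* _); apply: eq_Rintegral => t; rewrite inE => tI; rewrite E.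
Qed.

End Periodic.

(** Finiteness of the weighted norm turns an extended series into a real number, which bounds all
    truncated weights at once. *)
Lemma sqnormK_weight (R : realType) (al P : R) (f : (R * R) * R -> R[i]) : 0 <= al -> 0 <= P ->
  L2K (4 + 8 * al ^+ 2 * P) f -> exists K : R,
  (2 * pi * K)%:E = sqnormK (4 + 8 * al ^+ 2 * P) f /\
  forall n, weight al P n (fun k => modeM k (toHS f)) <= K.
Proof.
move=> al0 P0; set C := 4 + _ => -[[_ hf] fin].
have C0 : 0 <= C by rewrite /C addr_ge0// mulr_ge0// mulr_ge0// sqr_ge0.
pose X := toHS f; pose N k := nm (modeM k X) ^+ 2.
have NE k : sqnormM (mode f k) = (N k)%:E.
  rewrite /N -sqnorm_nm modeME /X toHSE//.
pose T (k : nat) := ((C ^+ k)%:E * ((N k%:Z)%:E + (N (- k%:Z))%:E))%E.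
have T0 k : (0 <= T k)%E by rewrite /T -EFinD -EFinM lee_fin mulr_ge0 ?exprn_ge0// addr_ge0// sqr_ge0.
pose S := (\sum_(1 <= k <oo) T k)%E.
have S0 : (0 <= S)%E by apply: nneseries_ge0.
have KE : sqnormK C f = ((2 * pi)%:E * ((N 0)%:E + S))%E.
  rewrite /sqnormK NE; congr (_ * (_ + _))%E; apply: eq_eseriesr => k _.
  by rewrite !NE.
have NS0 : (0 <= (N 0)%:E + S)%E by rewrite adde_ge0// lee_fin sqr_ge0.
have p2 : 0 < 2 * pi :> R by rewrite mulr_gt0// pi_gt0.
have NSfin : ((N 0)%:E + S)%E \is a fin_num.
  rewrite ge0_fin_numE//; case: (ltP ((N 0)%:E + S)%E +oo%E) => //.
  rewrite leye_eq => /eqP e; move: fin; rewrite KE e gt0_muley ?ltxx// lte_fin.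
exists (fine ((N 0)%:E + S)%E); split; first by rewrite EFinM fineK.
move=> n; rewrite -lee_fin fineK// /weight EFinD; apply: leeD => //.
apply: le_trans (nneseries_lim_ge n.+1 _) => [|k _ _]; last exact: T0.
by rewrite -sumEFin lee_sum// => k _; rewrite /T EFinM EFinD.
Qed.

Section Pointwise.
Variable R : realType.
Local Notation C := R[i].
Local Notation plane := (R * R)%type.
Implicit Types (x y z : HS R) (w : HM R).

Lemma HS_add3 x y z q : (x + y + z : HS R) q = x q + y q + z q.
Proof. by []. Qed.

Lemma per_lin c x y z q : @SM R q -> x q = (c *: y + z : HS R) q -> per x q = c * per y q + per z q.
Proof. by move=> hq; rewrite (per_SM x hq) (per_SM y hq) (per_SM z hq) HS_linE. Qed.

Lemma DsgE (s : bool) (wx wy : HM R) p :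
  (Dsg s wx wy : HM R) p = 2%:R^-1 * (wx p + isg R s * wy p).
Proof. by []. Qed.

(** The operator [e^(i theta) del - e^(-i theta) delbar] is [X_perp] applied to [i] times the
    function, which is why [g_s] is [i] times the limit of the half differences. *)
Lemma Xperp_algebra (c s : R) (x y : C) :
  (c +i* s) * (2%:R^-1 * (x + - 'i%C * y)) - (c +i* - s) * (2%:R^-1 * (x + 'i%C * y)) =
  s%:C * ('i%C * x) - c%:C * ('i%C * y).
Proof.
have -> : (2%:R^-1 : C) = (2^-1)%:C by rewrite fmorphV rmorph_nat.
by case: x y => x1 x2 [y1 y2]; apply: complex_eq => /=; field.
Qed.

Lemma Xperp_Dsg (wx wy : HM R) (q : plane * R) :
  (Em 1 (Dsg true wx wy) - Em (-1) (Dsg false wx wy) : HS R) q =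
  Xperp ('i%C *: wx : HM R) ('i%C *: wy : HM R) q.
Proof.
transitivity (harmonic 1 (Dsg true wx wy : HM R) q - harmonic (-1) (Dsg false wx wy : HM R) q).
  by rewrite -(EmE 1) -(EmE (-1)).
rewrite /harmonic (DsgE true) (DsgE false) /Xperp (L2spaceZ _ wx) (L2spaceZ _ wy) mulrNz mul1r mulN1r.
by rewrite /expi cosN sinN; exact: Xperp_algebra.
Qed.

Lemma Hsol_sum (h : bool -> nat -> HM R) n q :
  (\sum_(1 <= k < n) (Em (sg true k) (h true k) + Em (sg false k) (h false k)) : HS R) q =
  \sum_(1 <= k < n) (expi (k%:R * q.2) * h true k q.1 + expi (- (k%:R * q.2)) * h false k q.1).
Proof.
rewrite L2space_sum; apply: eq_bigr => k _; rewrite L2spaceD !EmE /harmonic /sg.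
by rewrite mulrNz mulNr.
Qed.

Lemma Em0E w q : Em 0 w q = w q.1.
Proof. by rewrite EmE /harmonic mul0r /expi cos0 sin0 mul1r. Qed.

End Pointwise.

(** * Construction of g *)

Section Assembly.
Variable R : realType.
Local Notation C := R[i].
Local Notation plane := (R * R)%type.
Variable a : plane -> C.
Hypothesis ha : {within @disc R, continuous (a : plane -> C^o)}.
Let M := xray_modelM ha.
Let K := 4 + 8 * sup_disc a ^+ 2 * poincare_constant R.
Let Rl (X Y : HS R) := Rel (@GM R) (@Em R) (@modeM R) (amul a) X Y.
Implicit Types (f : plane * R -> C).

(** A related vector is determined up to null sets, so one is chosen; where none exists the value is
    0. *)
Definition solution f : HS R :=
  if pselect (exists Y, Rl (toHS f) Y) is left h then projT1 (cid h) else 0.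

Lemma solutionP f : (exists Y, Rl (toHS f) Y) -> Rl (toHS f) (solution f).
Proof. by move=> h; rewrite /solution; case: pselect => // h'; case: (cid h'). Qed.

Lemma L2K_Rel f : L2K K f -> exists2 c : R, (2 * pi * c)%:E = sqnormK K f &
  Rl (toHS f) (solution f) /\ nm (solution f) ^+ 2 <= 4 * (2 * pi) * c.
Proof.
move=> hf; have [c [cE hc]] := sqnormK_weight (sup_disc_ge0 ha) (poincare_constant_ge0 R) hf.
exists c => //; have hR : Rl (toHS f) (solution f) by apply: solutionP; exact: (Rel_exists M hc).
by split => //; exact: (Rel_bound M hR hc).
Qed.

(** [Rel_lin] itself supplies a vector related to the combination, so its weighted norm need not be
    estimated; uniqueness identifies this vector with the chosen one. *)
Lemma solution_lin c f1 f2 : L2K K f1 -> L2K K f2 ->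
  aeq (solution (fun p => c * f1 p + f2 p)) (c *: solution f1 + solution f2).
Proof.
move=> h1 h2; have [_ _ [R1 _]] := L2K_Rel h1; have [_ _ [R2 _]] := L2K_Rel h2.
have [[_ l1] _] := h1; have [[_ l2] _] := h2.
have R12 : Rl (toHS (fun p => c * f1 p + f2 p)) (c *: solution f1 + solution f2).
  by rewrite toHS_lin//; exact: (Rel_lin M c R1 R2).
move: (fun p => _) R12 => f R12; have R0 : Rl (toHS f) (solution f) by apply: solutionP; exists (c *: solution f1 + solution f2).
exact: (Rel_unique M R0 R12).
Qed.

Lemma solution_xray f : L2K K f -> ae_eq_in (area R) (@inward R) (xray a f) (xray a (per (solution f))).
Proof.
move=> hf; have [_ _ [hR _]] := L2K_Rel hf; have [[pf l2] _] := hf.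
have := xray_null_sub ha (Rel_Z M hR).
apply: aeS => p h hp; rewrite -h// toHSE//; exact: xray_periodic.
Qed.

Lemma solution_structure f : L2K K f -> exists (g0 gs gsx gsy : plane -> C) (gk : nat -> plane * R -> C),
  [/\ L2M g0, H10_grad gs gsx gsy, forall k, (1 <= k)%N -> Hsol k (gk k) &
      L2_cvg (vol R) (@SM R)
        (fun N p => g0 p.1 + Xperp gsx gsy p + \sum_(1 <= k < N.+1) gk k p) (per (solution f))].
Proof.
move=> hf; have [_ _ [hR _]] := L2K_Rel hf.
have [t [h [hH hK hcvg]]] := Rel_structure M hR.
pose gk (k : nat) (q : plane * R) := expi (k%:R * q.2) * h true k q.1 + expi (- (k%:R * q.2)) * h false k q.1.
exists (modeM 0 (solution f)), ('i%C *: t.1.1), ('i%C *: t.1.2), ('i%C *: t.2), gk; split.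
- exact: L2funP.
- apply: H10_gradient; exact: (H10Z (GM_space R) _ hH).
- move=> k k1; exists (h true k), (h false k); split => //.
  + by split; exact: L2funP.
  + exact/Kso_delbar/hK.
  + exact/Kso_del/hK.
- have := (L2_cvgP _ _).2 hcvg; rewrite /L2_cvg.
  apply: cvg_trans; apply: near_eq_cvg; apply: nearW => N; apply: sqnorm_eqin => q hq.
  rewrite (per_SM _ hq); congr (_ - _).
  by rewrite HS_add3 Hsol_sum Xperp_Dsg Em0E.
Qed.

End Assembly.

Theorem theorem2 (R : realType) (a : R * R -> R[i])
  (ha : {within @disc R, continuous (a : R * R -> R[i]^o)}) :
  let C : R := 4 + 8 * sup_disc a ^+ 2 * poincare_constant R in
  exists G : ((R * R) * R -> R[i]) -> ((R * R) * R -> R[i]),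
    (forall (c : R[i]) (f1 f2 : (R * R) * R -> R[i]), L2K C f1 -> L2K C f2 ->
       ae_eq_in (vol R) (@SM R) (G (fun p => c * f1 p + f2 p))
                (fun p => c * G f1 p + G f2 p)) /\
    (forall f : (R * R) * R -> R[i], L2K C f ->
       let g := G f in
       [/\ L2SM g,
           ae_eq_in (area R) (@inward R) (xray a f) (xray a g),
           exists (g0 gs gsx gsy : R * R -> R[i])
                  (gk : nat -> (R * R) * R -> R[i]),
             [/\ L2M g0, H10_grad gs gsx gsy,
                 forall k, (1 <= k)%N -> Hsol k (gk k) &
                 L2_cvg (vol R) (@SM R)
                   (fun N p => g0 p.1 + Xperp gsx gsy p +
                               \sum_(1 <= k < N.+1) gk k p)
                   g] &
           (sqnormSM g <= 4%:E * sqnormK C f)%E]).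
Proof.
(* [solution] is meaningful on one period of the angle; [per] extends it periodically, as [L2SM]
   demands. *)
move=> C; exists (fun f => per (solution a f)); split.
  move=> c f1 f2 h1 h2; have /aeq_ae H := solution_lin ha c h1 h2.
  by apply: (aeS _ H) => q h hq; exact: per_lin hq (h hq).
move=> f hf g; split.
- exact: L2SM_per.
- exact: solution_xray.
- exact: solution_structure.
- have [c cE [_ hc]] := L2K_Rel ha hf.
  rewrite /g /sqnormSM (sqnorm_eqin (g := solution a f)) => [|q hq]; last by rewrite per_SM.
  by rewrite (sqnorm_nm (solution a f)) -cE -EFinM lee_fin mulrA.
Qed.
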